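(* Let $T>0$. For every $n\in\mathbb{N}$, $\mathcal{B}_T\psi_{n,T}=g_n$. Moreover, $\mathcal{S}_T$ is injective from $L^2(\mathbb{R})$ onto $\mathcal{F}^2(\mathbb{C})$ and satisfies $$(\mathcal{S}_Tf,\mathcal{S}_Th)_{\mathcal{F}}=\sqrt2\,(f,h)_{L^2(\mathbb{R})},\qquad f,h\in L^2(\mathbb{R}).$$ Consequently, $2^{-1/4}\mathcal{S}_T$ is a unitary operator from $L^2(\mathbb{R})$ onto $\mathcal{F}^2(\mathbb{C})$.
   Context: $\mathbb{N}$ contains $0$. $L^2(\mathbb{R})$ is the space of complex-valued square-integrable functions with $(f,h)_{L^2(\mathbb{R})}=\int_{\mathbb{R}}f(v)\overline{h(v)}\,dv$. The scaled asymmetrically-weighted Hermite functions are $\psi_{n,T}(v)=\left(2^n n!\sqrt{\pi T}\right)^{-1/2}H_n\!\left(\frac{v}{\sqrt T}\right)e^{-v^2/T}$, where $H_n$ is the (physicists') Hermite polynomial of degree $n$, with positive leading coefficient and $\int_{\mathbb{R}}H_nH_m e^{-v^2}\,dv=\sqrt{\pi}\,2^m m!\,\delta_{n,m}$. The Bargmann--Fock space $\mathcal{F}^2(\mathbb{C})$ is the space of entire functions $F$ with $\|F\|_{\mathcal{F}}^2=\frac1\pi\int_{\mathbb{C}}|F(z)|^2e^{-|z|^2}\,dA(z)<\infty$ ($dA$ is Lebesgue measure on $\mathbb{C}$), with inner product $(F,G)_{\mathcal{F}}=\frac1\pi\int_{\mathbb{C}}F(z)\overline{G(z)}e^{-|z|^2}\,dA(z)$.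 For $n\in\mathbb{N}$, $$g_n(z)=\exp\left(-\tfrac14\partial_z^2\right)\frac{z^n}{\sqrt{n!}}=\sum_{k=0}^{\lfloor n/2\rfloor}\frac{\sqrt{n!}}{k!\,(n-2k)!}\left(-\frac14\right)^k z^{n-2k}.$$ The $T$-dependent Bargmann transform is $$(\mathcal{B}_Tf)(z)=\frac{\sqrt2}{(\pi T)^{1/4}}\int_{\mathbb{R}}\exp\left(-z^2+2\sqrt{\tfrac2T}\,zv-\frac{v^2}{T}\right)f(v)\,dv,\qquad z\in\mathbb{C},$$ and the rescaled transform is $(\mathcal{S}_Tf)(z)=(\mathcal{B}_Tf)\left(\frac{z}{\sqrt2}\right)$. *)

(* Defs.v *)
From HB Require Import structures.
From mathcomp Require Import all_boot all_order all_algebra.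
From mathcomp Require Import all_classical all_reals all_analysis.
From mathcomp Require Import measurable_realfun complex.
From mathcomp Require Import ring lra zify.
Set Implicit Arguments.
Unset Strict Implicit.
Unset Printing Implicit Defensive.
Import Order.TTheory GRing.Theory Num.Theory.
Import numFieldNormedType.Exports.
Local Open Scope classical_set_scope.
Local Open Scope ring_scope.
Local Open Scope complex_scope.

(* Physicists' Hermite polynomials: the recurrence is Rodrigues' formula
   H_n(x) e^{-x^2} = (-1)^n (d/dx)^n e^{-x^2} with the Gaussian divided out.
   [size_hermite] and [integral_hermite] below show that H_n has degree n and
   leading coefficient 2^n > 0, and that
   int H_n H_m e^{-v^2} dv = sqrt(pi) 2^m m! delta_{n,m}. *)
Fixpoint hermite (R : nzRingType) (n : nat) : {poly R} :=
  if n is m.+1 then ('X * hermite R m) *+ 2 - (hermite R m)^`() else 1.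

Lemma size_hermite (R : numDomainType) (n : nat) :
  size (hermite R n) = n.+1 /\ lead_coef (hermite R n) = 2 ^+ n.
Proof.
elim: n => [|n [IHs IHl]]; first by rewrite /= size_poly1 lead_coef1 expr0.
have H0 : hermite R n != 0 by rewrite -size_poly_eq0 IHs.
have s2 : size (('X * hermite R n) *+ 2) = n.+2.
  by rewrite -scaler_nat size_scale ?pnatr_eq0// mulrC size_mulX// IHs.
have sd : (size (- (hermite R n)^`()) < n.+2)%N.
  by rewrite size_polyN (leq_trans (lt_size_deriv H0))// IHs.
split; first by rewrite /= size_polyDl s2.
rewrite /= lead_coefDl ?s2// -scaler_nat lead_coefZ ['X * _]mulrC lead_coefMX IHl.
by rewrite exprS.
Qed.

Lemma poly_le_expR (R : realType) (p : {poly R}) :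
  exists C, forall x : R, `|p.[x]| <= C * expR (x ^+ 2 / 2).
Proof.
exists (\sum_(i < size p) `|p`_i| * (1 + 2 ^+ i * i`!%:R)) => x.
rewrite horner_coef (le_trans (ler_norm_sum _ _ _))// mulr_suml ler_sum// => i _.
rewrite normrM -mulrA ler_wpM2l// normrX.
have y0 : 0 <= x ^+ 2 / 2 by rewrite divr_ge0// sqr_ge0.
have e1 : 1 <= expR (x ^+ 2 / 2) by rewrite -[leLHS]expR0 ler_expR.
have xi : (`|x| ^+ i) ^+ 2 <= 2 ^+ i * i`!%:R * expR (x ^+ 2 / 2).
  have [->|i0] := posnP i; first by rewrite !expr0 expr1n !mul1r.
  have := expR_ge1Dxn i.-1 y0; rewrite prednK// => /(le_trans _) h.
  have {h} : (x ^+ 2 / 2) ^+ i / i`!%:R <= expR (x ^+ 2 / 2) by apply: h; rewrite lerDr.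
  rewrite ler_pdivrMr ?ltr0n ?fact_gt0// expr_div_n ler_pdivrMr ?exprn_gt0//.
  by rewrite exprAC real_normK ?num_real// => /le_trans; apply; rewrite le_eqVlt; apply/orP; left; apply/eqP; ring.
have t2 : `|x| ^+ i <= 1 + (`|x| ^+ i) ^+ 2.
  by have := sqr_ge0 (`|x| ^+ i - 1/2); nra.
nra.
Qed.

Lemma integrable_poly_gauss (R : realType) (p : {poly R}) :
  lebesgue_measure.-integrable [set: R] (fun x => (p.[x] * gauss_fun x)%:E).
Proof.
have [C pC] := poly_le_expR p.
have mf : measurable_fun [set: R] (fun x => p.[x] * gauss_fun x).
  apply: continuous_measurable_fun => x; apply: cvgM; last exact: continuous_gauss_fun.
  exact: continuous_horner.
have := @integrable_normal_pdf R 0 1.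
rewrite (normal_pdfE _ (oner_neq0 R)) => ig.
have := integrableZl measurableT (C / normal_peak 1) ig.
apply: le_integrable => //.
- exact/measurable_EFinP.
- move=> x _; rewrite -EFinM !abse_EFin lee_fin mulrA mulfVK; last first.
    by rewrite gt_eqF// normal_peak_gt0// oner_neq0.
  rewrite (le_trans _ (ler_norm _))// normrM (ger0_norm (gauss_fun_ge0 x)).
  rewrite (le_trans (ler_wpM2r (gauss_fun_ge0 x) (pC x)))//.
  rewrite -mulrA /gauss_fun -expRD /normal_fun subr0 expr1n.
  rewrite le_eqVlt; apply/orP; left; apply/eqP.
  by congr (_ * expR _); field.
Qed.

Lemma is_derive_poly_gauss (R : realType) (p : {poly R}) (x : R) :
  is_derive x (1 : R) (fun y => p.[y] * gauss_fun y)
    ((p^`() - ('X * p) *+ 2).[x] * gauss_fun x).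
Proof.
have dg : is_derive x (1 : R) (@gauss_fun R) (- (x *+ 2) * gauss_fun x).
  have d1 : is_derive x (1 : R) (fun y : R => - y ^+ 2) (- (x *+ 2)).
    by apply: is_deriveN; apply: is_derive_eq; rewrite /GRing.scale /=; ring.
  have de := is_derive_expR (- x ^+ 2).
  have := @is_derive1_comp R expR (fun y : R => - y ^+ 2) x _ _ de d1.
  by move=> /is_derive_eq; apply; rewrite /gauss_fun mulrC.
have dp := is_derive_poly p x.
have := is_deriveM dp dg; rewrite /GRing.scale /=.
move=> /is_derive_eq; apply.
by rewrite !hornerE /=; ring.
Qed.

Lemma cvg_poly_gauss (R : realType) (p : {poly R}) (e : R) : `|e| = 1 ->
  p.[e * n.+1%:R] * gauss_fun (e * n.+1%:R) @[n --> \oo] --> (0 : R).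
Proof.
move=> e1; have [C pC] := poly_le_expR p.
have e2 : e ^+ 2 = 1 by rewrite -real_normK ?num_real// e1 expr1n.
have C0 : 0 <= C by have := pC 0; rewrite expr0n mul0r expR0 mulr1; exact: le_trans.
apply/norm_cvg0P.
apply: (@squeeze_cvgr _ _ _ _ (cst 0) (fun n => C * 2 * harmonic n)); last 2 first.
- exact: cvg_cst.
- rewrite -[X in _ --> X](mulr0 (C * 2)); apply: cvgM; [exact: cvg_cst|exact: cvg_harmonic].
near=> n; rewrite normr_ge0 /= normrM (ger0_norm (gauss_fun_ge0 _)).
rewrite (le_trans (ler_wpM2r (gauss_fun_ge0 _) (pC _)))//.
rewrite -[leLHS]mulrA -[leRHS]mulrA ler_wpM2l// /gauss_fun -expRD exprMn e2 mul1r.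
set y : R := n.+1%:R.
have y1 : 1 <= y by rewrite ler1n.
have y0 : 0 < y by lra.
have -> : y ^+ 2 / 2 - y ^+ 2 = - (y ^+ 2 / 2) by field.
rewrite expRN /harmonic -/y -[2 in leRHS]invrK -invfM; rewrite lef_pV2 ?posrE ?expR_gt0 ?mulr_gt0//.
by apply: le_trans (expR_ge1Dx _); nra.
Unshelve. all: by end_near.
Qed.

Lemma integral_deriv_gauss (R : realType) (p : {poly R}) :
  (\int[lebesgue_measure]_x ((p^`() - ('X * p) *+ 2).[x] * gauss_fun x)%:E = 0)%E.
Proof.
set q := _ - _; set f := fun x : R => q.[x] * gauss_fun x.
set F := fun x : R => p.[x] * gauss_fun x.
have cf : continuous f.
  by move=> x; apply: cvgM; [exact: continuous_horner|exact: continuous_gauss_fun].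
have cF : continuous F.
  by move=> x; apply: cvgM; [exact: continuous_horner|exact: continuous_gauss_fun].
pose I (n : nat) : set R := [set` `[(- n.+1%:R)%R, n.+1%:R%R]].
have fint : lebesgue_measure.-integrable [set: R] (EFin \o f) := integrable_poly_gauss q.
have [] := @dominated_convergence _ _ _ lebesgue_measure _ measurableT
  (fun n => (EFin \o f) \_ (I n)) (EFin \o f) (fun x => `|(f x)%:E|%E).
- move=> n; apply/(measurable_restrictT _ _).1 => //.
    exact: measurable_itv.
  exact: measurable_funS (measurable_int _ fint).
- exact: measurable_int fint.
- apply: aeW => x _; apply: cvg_near_cst; near=> n.
  rewrite patchE mem_set// /I /= in_itv /= -ler_norml.
  rewrite (@le_trans _ _ n%:R) ?ler_nat//.
  by near: n; exact: nbhs_infty_ger.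
- exact: integrable_abse fint.
- apply: aeW => x n _; rewrite patchE; case: ifP => // _.
  by rewrite abse0 abse_ge0.
move=> _ _ /cvg_lim <-//.
apply/cvg_lim => //.
have -> : (fun n => \int[lebesgue_measure]_x ((EFin \o f) \_ (I n)) x)%E =
   (fun n => (F (1 * n.+1%:R) - F (-1 * n.+1%:R))%:E).
  apply/funext => n; rewrite -integral_mkcond mul1r mulN1r.
  rewrite (@continuous_FTC2 _ _ F) ?EFinB//.
  - by rewrite gtrN.
  - exact: continuous_subspaceT.
  - split.
    + by move=> x _; have [] := is_derive_poly_gauss p x.
    + exact/cvg_at_right_filter/cF.
    + exact/cvg_at_left_filter/cF.
  - move=> x _; rewrite derive1E; have [_ ->//] := is_derive_poly_gauss p x.
apply: cvg_EFin; first by near=> n.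
rewrite -[X in _ --> X](subrr 0).
by apply: cvgB; apply: cvg_poly_gauss; rewrite ?normrN ?normr1.
Unshelve. all: by end_near.
Qed.

Lemma integral_hermite_mul (R : realType) (n : nat) (q : {poly R}) :
  (\int[lebesgue_measure]_x (((hermite R n) * q).[x] * gauss_fun x)%:E =
   \int[lebesgue_measure]_x ((q^`(n)).[x] * gauss_fun x)%:E)%E.
Proof.
elim: n q => [|n IH] q; first by rewrite /= mul1r.
rewrite derivSn -IH.
have h := integral_deriv_gauss (hermite R n * q).
have i1 := integrable_poly_gauss (hermite R n * q^`()).
have i2 := integrable_poly_gauss (hermite R n.+1 * q).
have fin := integrable_fin_num measurableT i1.
suff : (\int[lebesgue_measure]_x (((hermite R n * q^`()).[x] * gauss_fun x)%:E
    - ((hermite R n.+1 * q).[x] * gauss_fun x)%:E) = 0)%E.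
  rewrite integralB//; have := integrable_fin_num measurableT i2; move: fin.
  move: (integral _ _ _) (integral _ _ _) => [a||] [b||]//= _ _ [] /eqP.
  by rewrite subr_eq0 => /eqP ->.
rewrite -[RHS]h; apply: eq_integral => x _; rewrite -EFinB; congr (_%:E).
rewrite derivM /= !(hornerD, hornerN, hornerMn, hornerM, hornerX); move: (x : R) => y; ring.
Qed.

Lemma integral_hermite (R : realType) (n m : nat) :
  (\int[lebesgue_measure]_x
     ((hermite R n).[x] * (hermite R m).[x] * expR (- x ^+ 2))%:E =
   (Num.sqrt pi * 2 ^+ m * m`!%:R * (n == m)%:R)%:E)%E.
Proof.
wlog mn : n m / (m <= n)%N => [hw|].
  have [|/ltnW nm] := leqP m n; first exact: hw.
  have [->|nem] := eqVneq n m; first by rewrite hw// eqxx.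
  under eq_integral do rewrite [X in X * expR _]mulrC.
  by rewrite hw// eq_sym (negbTE nem) !mulr0.
have := integral_hermite_mul n (hermite R m).
under eq_integral do rewrite hornerM.
move=> ->.
have [sm lm] := size_hermite R m.
have [->|nem] := eqVneq n m; last first.
  rewrite derivn_poly0 ?sm ?ltn_neqAle 1?eq_sym ?nem// mulr0.
  under eq_integral do rewrite horner0 mul0r.
  by rewrite integral0.
have -> : (hermite R m)^`(m) = (2 ^+ m * m`!%:R)%:P.
  apply/polyP => -[|i]; rewrite coef_derivn coefC /=.
    by rewrite addn0 ffactnn -[_ *+ m`!]mulr_natr -lm /lead_coef sm.
  rewrite nth_default ?mul0rn// sm; lia.
under eq_integral do rewrite hornerC EFinM.
rewrite integralZl// ?integralT_gauss -?EFinM; last exact: integrableT_gauss.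
by congr (_%:E); rewrite mulr1; ring.
Qed.

Definition psi (R : realType) (T : R) (n : nat) (v : R) : R[i] :=
  ((2 ^+ n * n`!%:R * Num.sqrt (pi * T)) `^ (- 2^-1)
   * (hermite R n).[v / Num.sqrt T] * expR (- (v ^+ 2 / T)))%:C.

Definition cexp (R : realType) (z : R[i]) : R[i] :=
  (expR (complex.Re z))%:C * (cos (complex.Im z) +i* sin (complex.Im z)).

Definition cintegral (d : measure_display) (X : measurableType d) (R : realType)
    (mu : {measure set X -> \bar R}) (f : X -> R[i]) : R[i] :=
  (\int[mu]_x complex.Re (f x)) +i* (\int[mu]_x complex.Im (f x)).

(* Representatives: elements of L^2(R) are the functions satisfying [L2],
   identified when they agree almost everywhere ([L2_eq]). *)
Definition L2 (R : realType) (f : R -> R[i]) : Prop :=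
  [/\ measurable_fun setT (fun v => complex.Re (f v)),
      measurable_fun setT (fun v => complex.Im (f v)) &
      (\int[lebesgue_measure]_v (ComplexField.Normc.normc (f v) ^+ 2)%:E
        < +oo)%E].

Definition L2_eq (R : realType) (f h : R -> R[i]) : Prop :=
  ae_eq lebesgue_measure setT f h.

Definition L2_inner (R : realType) (f h : R -> R[i]) : R[i] :=
  cintegral lebesgue_measure (fun v => f v * (h v)^*).

(* [R[i]^o] is R[i] as a normed space over the field R[i], so that [derivable]
   in the direction 1 is complex differentiability. *)
Definition entire (R : realType) (F : R[i] -> R[i]) : Prop :=
  forall z : R[i], derivable (F : R[i]^o -> R[i]^o) z 1.

(* Lebesgue measure on C is the product measure on R x R transported along
   (x, y) |-> x + i y. *)
Definition area (R : realType) :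
    {measure set (measurableTypeR R * measurableTypeR R) -> \bar R} :=
  (@lebesgue_measure R \x @lebesgue_measure R)%E.

Definition fock (R : realType) (F : R[i] -> R[i]) : Prop :=
  entire F /\
  (pi^-1%:E * \int[area R]_p
     (let z := p.1 +i* p.2 in
      ComplexField.Normc.normc (F z) ^+ 2
      * expR (- ComplexField.Normc.normc z ^+ 2))%:E < +oo)%E.

Definition fock_inner (R : realType) (F G : R[i] -> R[i]) : R[i] :=
  (pi^-1)%:C * cintegral (area R) (fun p =>
    let z := p.1 +i* p.2 in
    F z * (G z)^* * (expR (- ComplexField.Normc.normc z ^+ 2))%:C).

(* The sum exp(- (1/4) d^2/dz^2) (z^n / sqrt(n!)) written out. *)
Definition heat_monomial (R : realType) (n : nat) (z : R[i]) : R[i] :=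
  \sum_(0 <= k < (n./2).+1)
    (Num.sqrt n`!%:R / (k`!%:R * (n - 2 * k)`!%:R) * (- 4^-1) ^+ k)%:C
    * z ^+ (n - 2 * k).

Definition bargmann (R : realType) (T : R) (f : R -> R[i]) (z : R[i]) : R[i] :=
  (Num.sqrt 2 / (pi * T) `^ 4^-1)%:C *
  cintegral lebesgue_measure (fun v : R =>
    cexp (- z ^+ 2 + (2 * Num.sqrt (2 / T))%:C * z * v%:C - (v ^+ 2 / T)%:C)
    * f v).

Definition rescaled_bargmann (R : realType) (T : R) (f : R -> R[i]) (z : R[i]) :
    R[i] :=
  bargmann T f (z / (Num.sqrt 2)%:C).

Section operators.
Variable R : realType.
Implicit Type U : (R -> R[i]) -> R[i] -> R[i].

(* U induces a well-defined map from the classes of L^2(R) to F^2(C). *)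
Definition maps_L2_fock U : Prop :=
  (forall f, L2 f -> fock (U f)) /\
  (forall f h, L2 f -> L2 h -> L2_eq f h -> U f = U h).

Definition linear_on_L2 U : Prop :=
  forall (a : R[i]) f h, L2 f -> L2 h ->
    U (fun v => a * f v + h v) = (fun z => a * U f z + U h z).

Definition injective_on_L2 U : Prop :=
  forall f h, L2 f -> L2 h -> U f = U h -> L2_eq f h.

Definition onto_fock U : Prop :=
  forall F, fock F -> exists2 f, L2 f & U f = F.

Definition unitary_L2_fock U : Prop :=
  [/\ maps_L2_fock U, linear_on_L2 U, onto_fock U &
      forall f h, L2 f -> L2 h -> fock_inner (U f) (U h) = L2_inner f h].

End operators.

(* Main.v *)
Require Import Defs.
From HB Require Import structures.
From mathcomp Require Import all_boot all_order all_algebra.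
From mathcomp Require Import all_classical all_reals all_analysis.
From mathcomp Require Import measurable_realfun complex.
From mathcomp Require Import ring lra zify.
Import Order.TTheory GRing.Theory Num.Theory.
Import numFieldNormedType.Exports.
Import ComplexField.Normc.
Set Implicit Arguments.
Unset Strict Implicit.
Unset Printing Implicit Defensive.
Local Open Scope classical_set_scope.
Local Open Scope ring_scope.
Local Open Scope complex_scope.

(* Write S for the rescaled transform. Up to a Gaussian factor, S f is the Laplace transform of
   f(v) exp(-v^2/T), hence entire. A circle mean argument for entire functions (Goursat's theorem on
   rectangles) gives the reproducing formula of the Fock space, while a Gaussian integral shows that
   S S^* is sqrt 2 times the integral operator of the reproducing kernel. Schur's test then bounds
   S^*, hence S, and S (S^* F) = sqrt 2 F makes S onto. Injectivity is that of the Laplace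
   transform: the restrictions of g to two complementary half lines have opposite transforms if that
   of g is 0, each decaying in one half plane, so g has integral 0 over every half line. Surjectivity and injectivity give
   S^* S = sqrt 2, the isometry relation. Finally, B_T maps the Hermite recurrence
   H_{n+1} = 2 x H_n - H_n' to the recurrence g_{n+1} = z g_n - g_n' / 2 of the (unnormalized) heat
   monomials. *)

(** The kernel of S, with the weight of the Fock space absorbed, has a modulus that depends on Re z
    and v but not on Im z. It is therefore not square-integrable in z, and S^* F need not be an
    absolutely convergent integral for F in the Fock space. This is why S^* is first defined on
    integrable functions, why truncations to sets of finite area occur throughout, and why S^* F is
    reached as a limit through completeness of L^2. Schur's test bounds the squared norm of S^* by 2
    sqrt 2, twice its true value; this suffices for all limits, and the exact constant enters only
    with the reproducing formula. That constant comes from c^2 = 2 / sqrt (pi T), the squared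
    prefactor, times the integral sqrt (pi T / 2) of exp (- 2 v^2 / T): the product is sqrt 2. The
    relation S S^* = sqrt 2 by itself makes S^* a multiple of an isometry onto the orthogonal
    complement of the kernel of S, so injectivity of S is an independent input and has to precede
    the isometry relation. *)

Notation cRe := (complex.Re).
Notation cIm := (complex.Im).

(** * Complex modulus, exponential and derivative *)

Section complex_modulus.
Variable R : realType.
Implicit Types (z w : R[i]) (x y : R).

Lemma normc_sqr z : normc z ^+ 2 = cRe z ^+ 2 + cIm z ^+ 2.
Proof. by case: z => x y /=; rewrite sqr_sqrtr// addr_ge0// sqr_ge0. Qed.

Lemma normc_ge0 z : 0 <= normc z.
Proof. by case: z => x y /=; exact: sqrtr_ge0. Qed.

Lemma normcD z w : normc (z + w) <= normc z + normc w.
Proof. exact: le_normcD. Qed.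

Lemma normcN z : normc (- z) = normc z.
Proof. exact: (@complex.normcN R). Qed.

Lemma normcB z w : normc (z - w) = normc (w - z).
Proof. by rewrite -normcN opprB. Qed.

Lemma normc_real x : normc x%:C = `|x|.
Proof. by rewrite /= expr0n addr0 sqrtr_sqr. Qed.

Lemma normc_conj z : normc z^* = normc z.
Proof. by case: z => x y /=; rewrite sqrrN. Qed.

Lemma cReD z w : cRe (z + w) = cRe z + cRe w. Proof. by case: z w => ? ? []. Qed.
Lemma cImD z w : cIm (z + w) = cIm z + cIm w. Proof. by case: z w => ? ? []. Qed.
Lemma cReN z : cRe (- z) = - cRe z. Proof. by case: z. Qed.
Lemma cImN z : cIm (- z) = - cIm z. Proof. by case: z. Qed.
Lemma cReM z w : cRe (z * w) = cRe z * cRe w - cIm z * cIm w.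
Proof. by case: z w => ? ? []. Qed.
Lemma cImM z w : cIm (z * w) = cRe z * cIm w + cIm z * cRe w.
Proof. by case: z w => ? ? []. Qed.
Lemma cReJ z : cRe z^* = cRe z. Proof. by case: z. Qed.
Lemma cImJ z : cIm z^* = - cIm z. Proof. by case: z. Qed.

Lemma complex_eq z w : cRe z = cRe w -> cIm z = cIm w -> z = w.
Proof. by case: z w => ? ? [] ? ? /= -> ->. Qed.

Lemma mulc_conj z : z * z^* = (normc z ^+ 2)%:C.
Proof. by rewrite normc_sqr; apply: complex_eq; rewrite !(cReM, cImM, cReJ, cImJ) /=; ring. Qed.

Lemma Re_le_normc z : `|cRe z| <= normc z.
Proof. by rewrite -ler_sqr ?nnegrE ?normc_ge0// normc_sqr real_normK ?num_real// lerDl sqr_ge0. Qed.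

Lemma Im_le_normc z : `|cIm z| <= normc z.
Proof. by rewrite -ler_sqr ?nnegrE ?normc_ge0// normc_sqr real_normK ?num_real// lerDr sqr_ge0. Qed.

Lemma normc_le_ReIm z : normc z <= `|cRe z| + `|cIm z|.
Proof.
rewrite -ler_sqr ?nnegrE ?normc_ge0 ?addr_ge0// normc_sqr sqrrD !real_normK ?num_real//.
by rewrite -addrA lerD2l lerDr mulrn_wge0// mulr_ge0.
Qed.

Lemma normc_gt0 z : z != 0 -> 0 < normc z.
Proof.
move=> z0; rewrite lt_neqAle normc_ge0 andbT eq_sym; apply: contra z0 => /eqP/eq0_normc->.
by rewrite eqxx.
Qed.

Lemma cexpD z w : cexp (z + w) = cexp z * cexp w.
Proof.
rewrite /cexp cReD cImD expRD cosD sinD.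
by apply: complex_eq; rewrite !(cReM, cImM)/=; ring.
Qed.

Lemma cexp0 : cexp (0 : R[i]) = 1.
Proof. by rewrite /cexp /= expR0 cos0 sin0 mul1r. Qed.

Lemma normc_cexp z : normc (cexp z) = expR (cRe z).
Proof.
rewrite /cexp normcM normc_real (ger0_norm (expR_ge0 _)) /= cos2Dsin2 sqrtr1 mulr1//.
Qed.

Lemma cexp_conj z : cexp z^* = (cexp z)^*.
Proof.
rewrite /cexp cReJ cImJ cosN sinN; apply: complex_eq; rewrite !(cReM, cImM, cReJ, cImJ)/=; ring.
Qed.

Lemma cexp_real x : cexp x%:C = (expR x)%:C.
Proof. by rewrite /cexp /= cos0 sin0 mulr1. Qed.

Lemma cexp_neq0 z : cexp z != 0.
Proof.
by apply/eqP => h; have := normc_cexp z; rewrite h normc0 => /esym/eqP; rewrite gt_eqF ?expR_gt0.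
Qed.

Lemma expR_sub1_le x : `|expR x - 1| <= `|x| * expR `|x|.
Proof.
have h1 := expR_ge1Dx x; have h2 := expR_ge1Dx (- x).
have h3 : expR x * expR (- x) = 1 by rewrite -expRD subrr expR0.
have h4 := expR_gt0 x.
have [x0|x0] := leP 0 x.
  rewrite (ger0_norm x0) ger0_norm; nra.
rewrite (ltr0_norm x0); rewrite ler0_norm; last by rewrite subr_le0 -expR0 ler_expR ltW.
have : 1 <= expR (- x) by rewrite -expR0 ler_expR; lra.
nra.
Qed.

Lemma expR_sub1B_le x : `|expR x - 1 - x| <= x ^+ 2 * expR `|x|.
Proof.
have h1 := expR_ge1Dx x; have h2 := expR_ge1Dx (- x).
have h3 : expR x * expR (- x) = 1 by rewrite -expRD subrr expR0.
have h4 := expR_gt0 x.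
rewrite ger0_norm; last lra.
have h5 : expR x - 1 <= x * expR x by nra.
have [x0|x0] := leP 0 x; first by rewrite (ger0_norm x0); nra.
rewrite (ltr0_norm x0).
have : 1 <= expR (- x) by rewrite -expR0 ler_expR; lra.
nra.
Qed.

Lemma sin_le_norm x : `|sin x| <= `|x|.
Proof.
wlog x0 : x / 0 <= x.
  move=> h; have [x0|x0] := leP 0 x; first exact: h.
  by have := h (- x); rewrite sinN !normrN; apply; lra.
have := x0; rewrite le_eqVlt => /predU1P[<-|x1]; first by rewrite sin0.
have [c _] := @MVT R sin cos 0 x x1 (fun y _ => is_derive_sin y) (continuous_subspaceT (@continuous_sin R)).
rewrite sin0 !subr0 => ->; rewrite normrM ler_piMl// ler_norml cos_geN1 cos_le1//.
Qed.

Lemma cos_sub1_sqr x : `|cos x - 1| <= x ^+ 2.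
Proof.
have -> : cos x - 1 = - (2 * sin (x / 2) ^+ 2).
  have {1}-> : x = x / 2 + x / 2 by field.
  by rewrite cosD; have := cos2Dsin2 (x / 2); nra.
rewrite normrN normrM normrX (ger0_norm (@ler0n R 2)).
have := sin_le_norm (x / 2); rewrite normrM normfV (ger0_norm (@ler0n R 2)).
have := normr_ge0 (sin (x / 2)); have := normr_ge0 x.
have <- : `|x| ^+ 2 = x ^+ 2 by rewrite real_normK// num_real.
nra.
Qed.

Lemma cos_sub1_norm x : `|cos x - 1| <= `|x|.
Proof.
have -> : cos x - 1 = - (2 * sin (x / 2) ^+ 2).
  have {1}-> : x = x / 2 + x / 2 by field.
  by rewrite cosD; have := cos2Dsin2 (x / 2); nra.
rewrite normrN normrM normrX (ger0_norm (@ler0n R 2)).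
have := sin_le_norm (x / 2); rewrite normrM normfV (ger0_norm (@ler0n R 2)).
have : `|sin (x / 2)| <= 1 by rewrite ler_norml sin_geN1 sin_le1.
have := normr_ge0 (sin (x / 2)); have := normr_ge0 x.
nra.
Qed.

Lemma sin_sub_le x : `|sin x - x| <= x ^+ 2.
Proof.
wlog x0 : x / 0 <= x.
  move=> h; have [x0|x0] := leP 0 x; first exact: h.
  by have := h (- x); rewrite sinN -opprD normrN sqrrN; apply; lra.
have := x0; rewrite le_eqVlt => /predU1P[<-|x1]; first by rewrite sin0 subr0 normr0 expr0n.
have d y : is_derive y (1 : R) (fun y : R => sin y - y) (cos y - 1).
  by apply: is_deriveB.
have [|c] := @MVT R (fun y => sin y - y) (fun y => cos y - 1) 0 x x1 (fun y _ => d y).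
  apply: continuous_subspaceT => y; apply: cvgB; [exact: continuous_sin|exact: cvg_id].
rewrite in_itv/= => /andP[c0 cx]; rewrite sin0 !subr0 => ->; rewrite normrM expr2 (ger0_norm x0) ler_wpM2r//.
by rewrite (le_trans (cos_sub1_norm c))// ger0_norm; lra.
Qed.

(** Second order at 0, yet valid for all [z] thanks to the exponential factor: the same bound gives
    the derivative of [cexp] and, with [z] replaced by [h * v] for all real [v], the dominating
    function for differentiating a Laplace transform. *)
Lemma cexp_sub1B_le z : normc (cexp z - 1 - z) <= 3 * normc z ^+ 2 * expR (normc z).
Proof.
set x := cRe z; set y := cIm z.
have xz := Re_le_normc z; have yz := Im_le_normc z.
have s := normc_sqr z; rewrite -/x -/y in xz yz s.
have -> : cexp z - 1 - z = (expR x - 1 - x)%:C + (expR x * (cos y - 1))%:C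
    + ('i * (expR x * (sin y - y))%:C + 'i * ((expR x - 1) * y)%:C).
  apply: complex_eq; rewrite !(cReD, cImD, cReN, cImN, cReM, cImM) /=;
  rewrite -/x -/y; ring.
have i1 : normc ('i : R[i]) = 1 by rewrite /= expr0n expr1n add0r sqrtr1.
apply: le_trans (normcD _ _) _; apply: le_trans (lerD (normcD _ _) (lexx _)) _.
have e0 := expR_gt0 x.
have ex : expR x <= expR (normc z) by rewrite ler_expR (le_trans _ xz)// ler_norm.
have ex' : expR `|x| <= expR (normc z) by rewrite ler_expR.
rewrite [leLHS](_ : _ = `|expR x - 1 - x| + expR x * `|cos y - 1| + (normc ('i * (expR x * (sin y - y))%:C + 'i * ((expR x - 1) * y)%:C))); last first.
  by rewrite !normc_real normrM (gtr0_norm e0).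
have h4 : normc ('i * (expR x * (sin y - y))%:C + 'i * ((expR x - 1) * y)%:C)
    <= expR x * `|sin y - y| + `|expR x - 1| * `|y|.
  by apply: le_trans (normcD _ _) _; rewrite !normcM !i1 !mul1r !normc_real !normrM (gtr0_norm e0).
apply: le_trans (lerD (lexx _) h4) _.
have h1 := expR_sub1B_le x; have h2 := expR_sub1_le x.
have h3 := cos_sub1_sqr y; have h5 := sin_sub_le y.
set N := expR (normc z) in ex ex' *.
have N0 : 0 < N by rewrite expR_gt0.
have x2 : x ^+ 2 * expR `|x| <= x ^+ 2 * N by rewrite ler_wpM2l ?sqr_ge0.
have b2 : expR x * `|cos y - 1| <= N * y ^+ 2 by rewrite ler_pM// ltW.
have b3 : expR x * `|sin y - y| <= N * y ^+ 2 by rewrite ler_pM// ltW.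
have b4 : `|expR x - 1| * `|y| <= `|x| * N * `|y|.
  by rewrite ler_wpM2r// (le_trans h2)// ler_wpM2l.
have xx : `|x| ^+ 2 = x ^+ 2 by rewrite real_normK// num_real.
have yy : `|y| ^+ 2 = y ^+ 2 by rewrite real_normK// num_real.
have xy : 2 * (`|x| * `|y|) <= normc z ^+ 2.
  by have := sqr_ge0 (`|x| - `|y|); rewrite s -xx -yy; nra.
have : `|x| * N * `|y| <= N * normc z ^+ 2.
  rewrite mulrAC mulrC ler_pM2l//.
  have := mulr_ge0 (normr_ge0 x) (normr_ge0 y); lra.
rewrite s; have := mulr_ge0 (ltW N0) (sqr_ge0 x); have := mulr_ge0 (ltW N0) (sqr_ge0 y); nra.
Qed.

End complex_modulus.

(** * Complex differentiability in terms of the real modulus *)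

Section complex_derivative.
Variable R : realType.
Implicit Types (z w L M : R[i]) (x y : R) (F G : R[i] -> R[i]).

(** The remainder form, with real radii and errors: there is no quotient by [h], hence no exclusion
    of [h = 0], and the order on [R[i]] stays out of the estimates. *)
Definition cdiff F z (L : R[i]) := forall e : R, 0 < e -> exists2 d : R, 0 < d &
  forall h, normc h < d -> normc (F (z + h) - F z - L * h) <= e * normc h.

Lemma derivable_cdiff F z :
  derivable (F : R[i]^o -> R[i]^o) z 1 <-> exists L, cdiff F z L.
Proof.
split.
  move=> /cvg_ex[/= L /cvgrPdist_le FL]; exists L => e e0.
  have /FL : 0 < e%:C by rewrite ltcR.
  move=> /nbhs_ballP[/= r r0 rF].
  (* Norms of [R[i]^o] take values in [R[i]], and a positive element there has zero imaginary
     part. *)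
  have rE : r = (cRe r)%:C by move: r0; case: (r) => a b /andP[/eqP/= -> _].
  have r0' : 0 < cRe r by move: r0; rewrite rE ltcR.
  exists (cRe r) => // h hr.
  have [->|h0] := eqVneq h 0.
    by rewrite addr0 subrr mulr0 subrr normc0 mulr0.
  have := rF h; rewrite /ball /= sub0r normrN.
  have hN (u : R[i]^o) : `|u| = (normc u)%:C by [].
  rewrite hN rE ltcR => /(_ hr h0); rewrite hN lecR.
  have -> : F (z + h) - F z - L * h = - (L - h^-1 *: (F (h *: 1 + z) - F z)) * h.
    by rewrite /GRing.scale /= mulr1 (addrC h) mulNr mulrBl mulrAC mulVf// mul1r opprB.
  by rewrite normcM normcN => u; rewrite ler_wpM2r// normc_ge0.
move=> [L FL]; apply/cvg_ex; exists L; apply/cvgrPdist_le => /= e e0.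
have eE : e = (cRe e)%:C by move: e0; case: (e) => a b /andP[/eqP/= -> _].
have e0' : 0 < cRe e by move: e0; rewrite eE ltcR.
have [d d0 dF] := FL _ e0'.
apply/nbhs_ballP; exists d%:C; first by rewrite /= ltcR.
move=> h; rewrite /ball /= sub0r normrN.
have hN (u : R[i]^o) : `|u| = (normc u)%:C by [].
rewrite hN ltcR => /dF hd h0; rewrite hN eE lecR.
have -> : L - h^-1 *: (F (h *: 1 + z) - F z) = - (h^-1 * (F (z + h) - F z - L * h)).
  rewrite /GRing.scale /= mulr1 (addrC h).
    apply: (mulfI h0); rewrite mulrN mulVKf// mulrBr mulVKf//.
    by rewrite !opprB (mulrC L).
rewrite normcN normcM normcV ler_pdivrMl ?normc_gt0// [leRHS]mulrC; exact: hd.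
Qed.

(* A [Variant] rather than a definition, so that unification does not unfold it. *)
Variant holomorphic F : Prop := Holomorphic of forall z, exists L, cdiff F z L.

Lemma holomorphicP F : holomorphic F <-> forall z, exists L, cdiff F z L.
Proof. by split=> [[]|]. Qed.

Lemma entireP F : entire F <-> holomorphic F.
Proof.
split=> [h|/holomorphicP h z]; last exact/derivable_cdiff.
by apply/holomorphicP => z; apply/derivable_cdiff; exact: h.
Qed.

(** Serves to equate two computations of one derivative: under the integral sign, and from a closed
    form of the transform. *)
Lemma cdiff_unique F z L M : cdiff F z L -> cdiff F z M -> L = M.
Proof.
move=> FL FM; apply/eqP; rewrite -subr_eq0; apply/eqP/eq0_normc.
apply/eqP; rewrite eq_le normc_ge0 andbT; apply/ler_addgt0Pl => e e0; rewrite addr0.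
have [d1 d10 h1] := FL _ (divr_gt0 e0 (ltr0n _ 2)).
have [d2 d20 h2] := FM _ (divr_gt0 e0 (ltr0n _ 2)).
pose r := Num.min d1 d2 / 2.
have r0 : 0 < r by rewrite divr_gt0// lt_min d10.
have rm : r < Num.min d1 d2 by rewrite /r; have : 0 < Num.min d1 d2 by [rewrite lt_min d10|]; lra.
move: rm; rewrite lt_min => /andP[r1 r2].
have rr : normc r%:C = r by rewrite normc_real gtr0_norm.
have := h1 r%:C; have := h2 r%:C; rewrite rr => /(_ r2) k2 /(_ r1) k1.
have := le_trans (normcD _ _) (lerD k2 (eq_ind_r (fun u => u <= _) k1 (normcN _))).
have -> : F (z + r%:C) - F z - M * r%:C - (F (z + r%:C) - F z - L * r%:C) = (L - M) * r%:C by ring.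
rewrite normcM rr -mulrDl ler_pM2r//; lra.
Qed.

Lemma cdiff_lip F z L : cdiff F z L -> exists2 d : R, 0 < d &
  forall h, normc h < d -> normc (F (z + h) - F z) <= (normc L + 1) * normc h.
Proof.
move=> /(_ 1 ltr01)[d d0 h]; exists d => // k /h {}h.
have := le_trans (normcD _ (L * k)) (lerD h (lexx _)).
by rewrite subrK normcM mulrDl [leRHS]addrC.
Qed.

Lemma cdiff_cont F z L : cdiff F z L -> forall e : R, 0 < e -> exists2 d : R, 0 < d &
  forall w, normc (w - z) < d -> normc (F w - F z) < e.
Proof.
move=> /cdiff_lip[d d0 h] e e0.
have l0 : 0 < normc L + 1 by rewrite ltr_wpDl// normc_ge0.
exists (Num.min d (e / (normc L + 1))); first by rewrite lt_min d0 divr_gt0.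
move=> w; rewrite lt_min => /andP[wd we].
have := h _ wd; rewrite (addrC z) subrK => /le_lt_trans; apply.
by rewrite mulrC -ltr_pdivlMr.
Qed.

Lemma cdiff_affine a b z : cdiff (fun z => a * z + b) z a.
Proof.
by move=> e e0; exists 1 => // h _; rewrite (_ : _ - _ - _ = 0) ?normc0 ?mulr_ge0 ?normc_ge0 ?ltW//; ring.
Qed.

Lemma cdiff_comp F G z L M : cdiff G z M -> cdiff F (G z) L -> cdiff (fun z => F (G z)) z (L * M).
Proof.
move=> GM FL e e0.
have m0 : 0 < normc M + 1 by rewrite ltr_wpDl// normc_ge0.
have l0 : 0 < normc L + 1 by rewrite ltr_wpDl// normc_ge0.
have [d1 d10 h1] := FL _ (divr_gt0 (divr_gt0 e0 (ltr0n _ 2)) m0).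
have [d2 d20 h2] := GM _ (divr_gt0 (divr_gt0 e0 (ltr0n _ 2)) l0).
have [d3 d30 h3] := cdiff_lip GM.
exists (Num.min d2 (Num.min d3 (d1 / (normc M + 1)))); first by rewrite !lt_min d20 d30 divr_gt0.
move=> h; rewrite !lt_min => /and3P[/h2 {}h2 /h3 {}h3 hd].
have {h1} := h1 (G (z + h) - G z).
rewrite (addrC (G z)) subrK => h1.
have {}h1 := h1 (le_lt_trans h3 _).
have -> : F (G (z + h)) - F (G z) - L * M * h =
   (F (G (z + h)) - F (G z) - L * (G (z + h) - G z)) + L * (G (z + h) - G z - M * h) by ring.
apply: le_trans (normcD _ _) _; rewrite normcM.
have k1 : normc (F (G (z + h)) - F (G z) - L * (G (z + h) - G z)) <= e / 2 * normc h.
  apply: (le_trans (h1 _)); first by rewrite mulrC -ltr_pdivlMr.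
  by rewrite -[leLHS]mulrA ler_pM2l ?divr_gt0// ler_pdivrMl.
have k2 : normc L * normc (G (z + h) - G z - M * h) <= e / 2 * normc h.
  apply: (@le_trans _ _ ((normc L + 1) * (e / 2 / (normc L + 1) * normc h))).
    by rewrite ler_pM ?normc_ge0// lerDl.
  by rewrite mulrA mulrCA divff ?mulr1// gt_eqF.
lra.
Qed.

Lemma cdiffM F G z L M : cdiff F z L -> cdiff G z M ->
  cdiff (fun z => F z * G z) z (L * G z + F z * M).
Proof.
move=> FL GM e e0.
set A := normc (F z) + 1; set B := normc (G z) + 1.
have A0 : 0 < A by rewrite ltr_wpDl// normc_ge0.
have B0 : 0 < B by rewrite ltr_wpDl// normc_ge0.
set K := (normc L + 1) * (normc M + 1).
have K0 : 0 < K by rewrite mulr_gt0// ltr_wpDl// normc_ge0.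
have e3 : 0 < e / 3 by rewrite divr_gt0.
have [d1 d10 h1] := FL _ (divr_gt0 e3 B0).
have [d2 d20 h2] := GM _ (divr_gt0 e3 A0).
have [d3 d30 h3] := cdiff_lip GM.
have [d4 d40 h4] := cdiff_lip FL.
exists (Num.min (Num.min d1 d2) (Num.min (Num.min d3 d4) (e / 3 / K))); first by rewrite !lt_min d10 d20 d30 d40 divr_gt0.
move=> h; rewrite !lt_min => /and3P[/andP[/h1 {}h1 /h2 {}h2] /andP[/h3 {}h3 /h4 {}h4] hd].
have -> : F (z + h) * G (z + h) - F z * G z - (L * G z + F z * M) * h =
   (F (z + h) - F z - L * h) * G z + F z * (G (z + h) - G z - M * h)
   + (F (z + h) - F z) * (G (z + h) - G z) by ring.
apply: le_trans (normcD _ _) _; apply: le_trans (lerD (normcD _ _) (lexx _)) _; rewrite !normcM.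
have n0 := normc_ge0 h.
have k1 : normc (F (z + h) - F z - L * h) * normc (G z) <= e / 3 * normc h.
  apply: (@le_trans _ _ (e / 3 / B * normc h * B)).
    by rewrite ler_pM ?normc_ge0// lerDl.
  by rewrite mulrAC divfK// gt_eqF.
have k2 : normc (F z) * normc (G (z + h) - G z - M * h) <= e / 3 * normc h.
  apply: (@le_trans _ _ (A * (e / 3 / A * normc h))).
    by rewrite ler_pM ?normc_ge0// lerDl.
  by rewrite mulrA mulrCA divff ?mulr1// gt_eqF.
have k3 : normc (F (z + h) - F z) * normc (G (z + h) - G z) <= e / 3 * normc h.
  apply: (le_trans (ler_pM (normc_ge0 _) (normc_ge0 _) h4 h3)).
  rewrite mulrACA -/K mulrA ler_wpM2r// mulrC -ler_pdivlMr// ltW//.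
lra.
Qed.

Lemma cdiff_cexp z : cdiff (@cexp R) z (cexp z).
Proof.
move=> e e0; have N0 : 0 < normc (cexp z) by rewrite normc_gt0// cexp_neq0.
have E0 : 0 < 3 * expR 1 * normc (cexp z) :> R by rewrite !mulr_gt0// expR_gt0.
exists (Num.min 1 (e / (3 * expR 1 * normc (cexp z)))); first by rewrite lt_min ltr01 divr_gt0.
move=> h; rewrite lt_min => /andP[h1 he].
rewrite cexpD (_ : _ - _ - _ = cexp z * (cexp h - 1 - h)); last by ring.
rewrite normcM; have n0 := normc_ge0 h.
apply: (le_trans (ler_wpM2l (ltW N0) (cexp_sub1B_le h))).
apply: (@le_trans _ _ (normc (cexp z) * (3 * normc h ^+ 2 * expR 1))).
  by rewrite ler_pM2l// ler_wpM2l ?mulr_ge0// ?sqr_ge0// ler_expR ltW.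
rewrite [leLHS](_ : _ = 3 * expR 1 * normc (cexp z) * normc h * normc h); last by ring.
by rewrite ler_wpM2r// mulrC -ler_pdivlMr// ltW.
Qed.

End complex_derivative.

(** * Integration of complex functions *)

Section complex_measurability.
Context d (X : measurableType d) (R : realType).
Implicit Types f g : X -> R[i].

Definition cmeasurable f :=
  measurable_fun setT (fun x => cRe (f x)) /\ measurable_fun setT (fun x => cIm (f x)).

Lemma cmeasurable_cst (c : R[i]) : cmeasurable (fun=> c).
Proof. by split; exact: measurable_cst. Qed.

Lemma cmeasurable_real (f : X -> R) : measurable_fun setT f -> cmeasurable (fun x => (f x)%:C).
Proof. by split => //; exact: measurable_cst. Qed.

Lemma cmeasurable_pair (f g : X -> R) : measurable_fun setT f -> measurable_fun setT g ->
  cmeasurable (fun x => f x +i* g x).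
Proof. by []. Qed.

Lemma cmeasurableD f g : cmeasurable f -> cmeasurable g -> cmeasurable (fun x => f x + g x).
Proof.
move=> [f1 f2] [g1 g2]; split.
  by under eq_fun do rewrite cReD; exact: measurable_funD.
by under eq_fun do rewrite cImD; exact: measurable_funD.
Qed.

Lemma cmeasurableN f : cmeasurable f -> cmeasurable (fun x => - f x).
Proof.
move=> [f1 f2]; split.
  by under eq_fun do rewrite cReN; exact: measurableT_comp.
by under eq_fun do rewrite cImN; exact: measurableT_comp.
Qed.

Lemma cmeasurableB f g : cmeasurable f -> cmeasurable g -> cmeasurable (fun x => f x - g x).
Proof. by move=> mf mg; apply: cmeasurableD => //; exact: cmeasurableN. Qed.

Lemma cmeasurableM f g : cmeasurable f -> cmeasurable g -> cmeasurable (fun x => f x * g x).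
Proof.
move=> [f1 f2] [g1 g2]; split.
  by under eq_fun do rewrite cReM; apply: measurable_funB; exact: measurable_funM.
by under eq_fun do rewrite cImM; apply: measurable_funD; exact: measurable_funM.
Qed.

Lemma cmeasurableJ f : cmeasurable f -> cmeasurable (fun x => (f x)^*).
Proof.
move=> [f1 f2]; split; first by under eq_fun do rewrite cReJ.
by under eq_fun do rewrite cImJ; exact: measurableT_comp.
Qed.

Lemma cmeasurable_cexp f : cmeasurable f -> cmeasurable (fun x => cexp (f x)).
Proof.
move=> [f1 f2]; rewrite /cexp; apply: cmeasurableM.
  by apply: cmeasurable_real; exact: measurableT_comp.
by apply: cmeasurable_pair; apply: (measurableT_comp _ f2);
  apply: continuous_measurable_fun; [exact: continuous_cos|exact: continuous_sin].
Qed.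

Lemma measurable_normc_sqr f : cmeasurable f -> measurable_fun setT (fun x => normc (f x) ^+ 2).
Proof.
move=> [f1 f2]; under eq_fun do rewrite normc_sqr.
by apply: measurable_funD; exact: measurable_funX.
Qed.

Lemma measurable_normc f : cmeasurable f -> measurable_fun setT (fun x => normc (f x)).
Proof.
move=> mf; have := measurableT_comp (measurable_powR 2^-1) (measurable_normc_sqr mf).
apply: eq_measurable_fun => x _ /=.
by rewrite -powR_mulrn ?normc_ge0// -powRrM mulfV// powRr1// normc_ge0.
Qed.

Lemma cmeasurable_cvg (f_ : nat -> X -> R[i]) f : (forall n, cmeasurable (f_ n)) ->
  (forall x, normc (f_ n x - f x) @[n --> \oo] --> (0 : R)) -> cmeasurable f.
Proof.
move=> mf cf; split.
  apply: (measurable_fun_cvg (fun n => (mf n).1)) => x _.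
  apply/cvgrPdist_le => e e0; have /cvgrPdist_le /(_ _ e0) := cf x.
  apply: filterS => n; rewrite sub0r normrN (ger0_norm (normc_ge0 _)) => /(le_trans _); apply.
  by rewrite distrC -cReN -cReD Re_le_normc.
apply: (measurable_fun_cvg (fun n => (mf n).2)) => x _.
apply/cvgrPdist_le => e e0; have /cvgrPdist_le /(_ _ e0) := cf x.
apply: filterS => n; rewrite sub0r normrN (ger0_norm (normc_ge0 _)) => /(le_trans _); apply.
by rewrite distrC -cImN -cImD Im_le_normc.
Qed.

End complex_measurability.

Lemma cmeasurable_comp d d' (X : measurableType d) (Y : measurableType d') (R : realType)
  (f : Y -> R[i]) (g : X -> Y) : cmeasurable f -> measurable_fun setT g ->
  cmeasurable (fun x => f (g x)).
Proof.
move=> [f1 f2] mg; split.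
  exact: (measurableT_comp f1 mg).
exact: (measurableT_comp f2 mg).
Qed.

Section complex_integral.
Context d (X : measurableType d) (R : realType) (mu : {measure set X -> \bar R}).
Implicit Types f g : X -> R[i].
Local Notation ri h := (mu.-integrable setT (fun x => (h x)%:E)).

Definition cintegrable f := ri (fun x => cRe (f x)) /\ ri (fun x => cIm (f x)).

Lemma cintegrable_measurable f : cintegrable f -> cmeasurable f.
Proof. by move=> [/integrableP[/measurable_EFinP m1 _] /integrableP[/measurable_EFinP m2 _]]. Qed.

Lemma le_integrable_real (f g : X -> R) : measurable_fun setT f -> ri g ->
  (forall x, `|f x| <= g x) -> ri f.
Proof.
move=> mf ig fg; apply: (le_integrable measurableT _ _ ig).
  exact/measurable_EFinP.
by move=> x _ /=; rewrite lee_fin (le_trans (fg x))// ler_norm.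
Qed.

Lemma le_cintegrable f (g : X -> R) : cmeasurable f -> ri g ->
  (forall x, normc (f x) <= g x) -> cintegrable f.
Proof.
move=> [mf1 mf2] ig fg; split; apply: (le_integrable_real _ ig) => // x;
  apply: le_trans (fg x); [exact: Re_le_normc|exact: Im_le_normc].
Qed.

Lemma integrableD_real (f g : X -> R) : ri f -> ri g -> ri (fun x => f x + g x).
Proof. by move=> If Ig; have := integrableD measurableT If Ig; apply: eq_integrable. Qed.

Lemma integrableZl_real k (f : X -> R) : ri f -> ri (fun x => k * f x).
Proof. by move=> If; have := integrableZl measurableT k If; apply: eq_integrable. Qed.

Lemma integrable_norm_real (f : X -> R) : ri f -> ri (fun x => `|f x|).
Proof. by move=> If; have := integrable_abse If; apply: eq_integrable. Qed.

Lemma integrable_normc f : cintegrable f -> ri (fun x => normc (f x)).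
Proof.
move=> If; have mf := cintegrable_measurable If; case: If => i1 i2.
apply: (le_integrable_real (measurable_normc mf)
  (integrableD_real (integrable_norm_real i1) (integrable_norm_real i2))) => x.
by rewrite ger0_norm ?normc_ge0// normc_le_ReIm.
Qed.

Lemma cintegrableD f g : cintegrable f -> cintegrable g -> cintegrable (fun x => f x + g x).
Proof.
move=> [f1 f2] [g1 g2]; split.
  by under eq_fun do rewrite cReD; exact: integrableD_real.
by under eq_fun do rewrite cImD; exact: integrableD_real.
Qed.

Lemma cintegrableZl c f : cintegrable f -> cintegrable (fun x => c * f x).
Proof.
move=> If; apply: (le_cintegrable _ (integrableZl_real (normc c) (integrable_normc If))).
  by apply: cmeasurableM; [exact: cmeasurable_cst|exact: cintegrable_measurable].
by move=> x; rewrite normcM.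
Qed.

Lemma cintegrableN f : cintegrable f -> cintegrable (fun x => - f x).
Proof. by move=> If; under eq_fun do rewrite -mulN1r; exact: cintegrableZl. Qed.

Lemma cintegrableB f g : cintegrable f -> cintegrable g -> cintegrable (fun x => f x - g x).
Proof. by move=> If Ig; apply: cintegrableD => //; exact: cintegrableN. Qed.

Lemma cintegrableJ f : cintegrable f -> cintegrable (fun x => (f x)^*).
Proof.
move=> If; apply: (le_cintegrable _ (integrable_normc If)).
  by apply: cmeasurableJ; exact: cintegrable_measurable.
by move=> x; rewrite normc_conj.
Qed.

Lemma eq_cintegral f g : f =1 g -> cintegral mu f = cintegral mu g.
Proof. by move=> /funext ->. Qed.

Lemma cintegralD f g : cintegrable f -> cintegrable g ->
  cintegral mu (fun x => f x + g x) = cintegral mu f + cintegral mu g.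
Proof.
move=> [f1 f2] [g1 g2]; apply: complex_eq; rewrite !(cReD, cImD) /=.
  by under eq_Rintegral do rewrite cReD; rewrite RintegralD.
by under eq_Rintegral do rewrite cImD; rewrite RintegralD.
Qed.

Lemma cintegralZl c f : cintegrable f ->
  cintegral mu (fun x => c * f x) = c * cintegral mu f.
Proof.
move=> [f1 f2]; apply: complex_eq; rewrite !(cReM, cImM) /=.
  under eq_Rintegral do rewrite cReM; rewrite RintegralB; last 3 first.
  - exact: measurableT.
  - exact: integrableZl_real.
  - exact: integrableZl_real.
  by rewrite !RintegralZl.
under eq_Rintegral do rewrite cImM; rewrite RintegralD; last 3 first.
- exact: measurableT.
- exact: integrableZl_real.
- exact: integrableZl_real.
by rewrite !RintegralZl.
Qed.

Lemma cintegralZr c f : cintegrable f ->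
  cintegral mu (fun x => f x * c) = cintegral mu f * c.
Proof. by move=> If; under eq_cintegral do rewrite mulrC; rewrite cintegralZl// mulrC. Qed.

Lemma cintegralN f : cintegrable f -> cintegral mu (fun x => - f x) = - cintegral mu f.
Proof.
by move=> If; under eq_cintegral do rewrite -mulN1r; rewrite cintegralZl// mulN1r.
Qed.

Lemma cintegralB f g : cintegrable f -> cintegrable g ->
  cintegral mu (fun x => f x - g x) = cintegral mu f - cintegral mu g.
Proof. by move=> If Ig; rewrite cintegralD ?cintegralN//; exact: cintegrableN. Qed.

Lemma cintegral0 : cintegral mu (fun=> 0) = 0 :> R[i].
Proof. by rewrite /cintegral /= /Rintegral integral0. Qed.

Lemma cintegralJ f : cintegrable f ->
  cintegral mu (fun x => (f x)^*) = (cintegral mu f)^*.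
Proof.
move=> [f1 f2]; apply: complex_eq; rewrite ?(cReJ, cImJ) /=.
  by apply: eq_Rintegral => x _; rewrite cReJ.
under eq_Rintegral do rewrite cImJ -mulN1r.
by rewrite RintegralZl// mulN1r.
Qed.

Lemma cintegral_real (h : X -> R) : cintegral mu (fun x => (h x)%:C) = (\int[mu]_x h x)%:C.
Proof. by rewrite /cintegral /= [X in _ +i* X]/Rintegral integral0. Qed.

(* Rotate the integral onto the positive real axis and bound the real part. *)
Lemma normc_cintegral_le f (g : X -> R) : cmeasurable f -> ri g ->
  (forall x, normc (f x) <= g x) -> normc (cintegral mu f) <= \int[mu]_x g x.
Proof.
move=> mf ig fg; have If := le_cintegrable mf ig fg.
have g0 : 0 <= \int[mu]_x g x.
  by apply: Rintegral_ge0 => x _; exact: le_trans (normc_ge0 _) (fg x).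
have [->|n0] := eqVneq (cintegral mu f) 0; first by rewrite normc0.
set I := cintegral mu f in n0 *.
have N0 := normc_gt0 n0.
pose u := I^* * ((normc I)^-1)%:C.
have uI : u * I = (normc I)%:C.
  rewrite /u mulrAC mulrC (mulrC _ I) mulc_conj -rmorphM /=; congr (_%:C).
  by rewrite expr2 mulKf// gt_eqF.
have u1 : normc u = 1.
  by rewrite normcM normc_conj normc_real ger0_norm ?invr_ge0 ?normc_ge0// mulfV// gt_eqF.
have -> : normc I = \int[mu]_x cRe (u * f x).
  by rewrite -[LHS]/(cRe (normc I)%:C) -uI /I -cintegralZl.
apply: le_Rintegral => //.
  exact: (cintegrableZl u If).1.
move=> x _; apply: le_trans (ler_norm _) _; apply: le_trans (Re_le_normc _) _.
by rewrite normcM u1 mul1r.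
Qed.

Lemma normc_cintegral f : cintegrable f ->
  normc (cintegral mu f) <= \int[mu]_x normc (f x).
Proof.
by move=> If; apply: normc_cintegral_le => //;
  [exact: cintegrable_measurable|exact: integrable_normc].
Qed.

Lemma Rintegral_cvg0 (h_ : nat -> X -> R) (g : X -> R) :
  (forall n, measurable_fun setT (h_ n)) -> ri g ->
  (forall n x, `|h_ n x| <= g x) ->
  {ae mu, forall x, h_ n x @[n --> \oo] --> (0 : R)} ->
  \int[mu]_x h_ n x @[n --> \oo] --> (0 : R).
Proof.
move=> mh ig hg h0.
have [] := @dominated_convergence _ _ _ mu setT measurableT (fun n x => (h_ n x)%:E)
   (cst 0%E) (fun x => (g x)%:E).
- by move=> n; exact/measurable_EFinP.
- exact: measurable_cst.
- by apply: filterS h0 => x h _; apply: cvg_EFin => //; near=> n.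
- by [].
- by apply: aeW => x n _; rewrite lee_fin.
move=> _ _; rewrite integral0 => h.
by apply: (fine_cvg h).
Unshelve. all: by end_near.
Qed.

Lemma cintegral_cvg (f_ : nat -> X -> R[i]) f (g : X -> R) :
  (forall n, cmeasurable (f_ n)) -> cmeasurable f -> ri g ->
  (forall n x, normc (f_ n x) <= g x) -> (forall x, normc (f x) <= g x) ->
  {ae mu, forall x, normc (f_ n x - f x) @[n --> \oo] --> (0 : R)} ->
  normc (cintegral mu (f_ n) - cintegral mu f) @[n --> \oo] --> (0 : R).
Proof.
move=> mf_ mf ig f_g fg f_f.
have ig2 : ri (fun x => 2 * g x) by exact: integrableZl_real.
have k : forall n x, normc (f_ n x - f x) <= 2 * g x.
  by move=> n x; rewrite (le_trans (normcD _ _))// normcN; have := f_g n x; have := fg x; lra.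
have mk n : cmeasurable (fun x => f_ n x - f x) by exact: cmeasurableB.
have : \int[mu]_x normc (f_ n x - f x) @[n --> \oo] --> (0 : R).
  apply: (Rintegral_cvg0 (g := fun x => 2 * g x)) => //.
    by move=> n; exact: measurable_normc.
  by move=> n x; rewrite ger0_norm ?normc_ge0.
apply: squeeze_cvgr; last exact: cvg_cst.
near=> n; rewrite normc_ge0 -cintegralB; last 2 first.
- exact: le_cintegrable ig (f_g n).
- exact: le_cintegrable ig fg.
by apply: normc_cintegral; apply: le_cintegrable ig2 (k n).
Unshelve. all: by end_near.
Qed.

End complex_integral.

(** * Fubini's theorem for complex integrands *)

Section complex_fubini.
Context d1 d2 (X : measurableType d1) (Y : measurableType d2) (R : realType).
Variables (m1 : {sigma_finite_measure set X -> \bar R})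
  (m2 : {sigma_finite_measure set Y -> \bar R}).

Lemma integrable_fubini_G (f : X * Y -> \bar R) : (m1 \x m2)%E.-integrable setT f ->
  m2.-integrable setT (fubini_G m1 f).
Proof.
move=> If; have mf := measurable_int _ If.
apply/integrableP; split; first exact: (measurable_fubini_G If).
apply: le_lt_trans ((integrable21ltyP _ _ mf).1 If).
have ma : measurable_fun setT (fun x => `|f x|)%E by exact: measurableT_comp.
apply: ge0_le_integral => //.
- by apply: measurableT_comp => //; exact: (measurable_fubini_G If).
- by apply: (measurable_fun_fubini_tonelli_G (abse \o f)) => // p; exact: abse_ge0.
- by move=> y _; apply: le_abse_integral => //; exact: measurableT_comp.
Qed.

Lemma Rintegral_fubini (f : X * Y -> R) :
  (m1 \x m2)%E.-integrable setT (EFin \o f) ->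
  [/\ measurable_fun setT (fun x => \int[m2]_y f (x, y)),
   measurable_fun setT (fun y => \int[m1]_x f (x, y)) &
  \int[m1]_x \int[m2]_y f (x, y) = \int[m2]_y \int[m1]_x f (x, y)].
Proof.
move=> If; rewrite /Rintegral.
have I1 := integrable_fubini_F If.
have I2 := integrable_fubini_G If.
have M1 : measurable_fun setT (fun x => fine (\int[m2]_y (f (x, y))%:E)%E).
  by apply: measurableT_comp (measurable_int _ I1).
have M2 : measurable_fun setT (fun y => fine (\int[m1]_x (f (x, y))%:E)%E).
  by apply: measurableT_comp (measurable_int _ I2).
split => //.
(* [fine] alters the inner integral only where it is infinite, which happens on a null set. *)
have -> : (\int[m1]_x (fine (\int[m2]_y (f (x, y))%:E))%:E = \int[m1]_x \int[m2]_y (f (x, y))%:E)%E.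
  apply: ae_eq_integral => //.
  - exact/measurable_EFinP.
  - exact: measurable_int I1.
  - by have := integrable_ae measurableT I1; apply: filterS => x h _; rewrite fineK ?h.
have -> : (\int[m2]_y (fine (\int[m1]_x (f (x, y))%:E))%:E = \int[m2]_y \int[m1]_x (f (x, y))%:E)%E.
  apply: ae_eq_integral => //.
  - exact/measurable_EFinP.
  - exact: measurable_int I2.
  - by have := integrable_ae measurableT I2; apply: filterS => x h _; rewrite fineK ?h.
by rewrite (Fubini If).
Qed.

Lemma cintegral_fubini (f : X * Y -> R[i]) : cmeasurable f ->
  (\int[m1]_x \int[m2]_y (normc (f (x, y)))%:E < +oo)%E ->
  [/\ cmeasurable (fun x => cintegral m2 (fun y => f (x, y))),
    cmeasurable (fun y => cintegral m1 (fun x => f (x, y))) &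
  cintegral m1 (fun x => cintegral m2 (fun y => f (x, y))) =
  cintegral m2 (fun y => cintegral m1 (fun x => f (x, y)))].
Proof.
move=> mf foo.
have In : (m1 \x m2)%E.-integrable setT (fun p => (normc (f p))%:E).
  apply/integrable12ltyP; first exact/measurable_EFinP/measurable_normc.
  by under eq_integral do under eq_integral do rewrite abse_EFin (ger0_norm (normc_ge0 _)).
have [I1 I2] : cintegrable (m1 \x m2)%E f by apply: le_cintegrable In _.
have [a1 a2 a3] := Rintegral_fubini I1.
have [b1 b2 b3] := Rintegral_fubini I2.
by split => //; apply: complex_eq.
Qed.

End complex_fubini.

(** * Linear changes of variables *)

Section change_of_variables.
Context d1 d2 (X : measurableType d1) (Y : measurableType d2) (R : realType).
Variables (mu : {measure set X -> \bar R}) (nu : {measure set Y -> \bar R}).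

(** The image of [mu] under [phi] is [k] times [nu], tested on nonnegative functions. Constants
    multiply under composition, and real or complex integrands follow by splitting into positive and
    negative parts. *)
Definition scales_integral (phi : X -> Y) (k : R) := measurable_fun setT phi /\
  forall f : Y -> \bar R, measurable_fun setT f -> (forall y, 0 <= f y)%E ->
  (\int[mu]_x f (phi x) = k%:E * \int[nu]_y f y)%E.

Variables (phi : X -> Y) (k : R).
Hypotheses (k0 : 0 < k) (Hphi : scales_integral phi k).

Lemma scales_integrable (f : Y -> R) : nu.-integrable setT (fun y => (f y)%:E) ->
  mu.-integrable setT (fun x => (f (phi x))%:E).
Proof.
move=> If; have mf := measurable_int _ If; have [mphi H] := Hphi.
apply/integrableP; split; first exact: (measurableT_comp mf mphi).
rewrite (H (fun y => `|(f y)%:E|)%E)//; last exact: measurableT_comp.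
by rewrite lte_mul_pinfty// ?lee_fin ?ltW//; case/integrableP : If.
Qed.

Lemma scales_Rintegral (f : Y -> R) : nu.-integrable setT (fun y => (f y)%:E) ->
  \int[mu]_x f (phi x) = k * \int[nu]_y f y.
Proof.
move=> If; have [mphi H] := Hphi; have mf := measurable_int _ If.
rewrite /Rintegral integralE [in RHS]integralE.
have e1 : (\int[mu]_x ((fun x => (f (phi x))%:E)^\+ x) = k%:E * \int[nu]_y ((fun y => (f y)%:E)^\+ y))%E.
  have mp := measurable_funepos mf.
  by rewrite -(H _ mp)//; apply: eq_integral => x _; rewrite !funeposE.
have e2 : (\int[mu]_x ((fun x => (f (phi x))%:E)^\- x) = k%:E * \int[nu]_y ((fun y => (f y)%:E)^\- y))%E.
  have mp := measurable_funeneg mf.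
  by rewrite -(H _ mp)//; apply: eq_integral => x _; rewrite !funenegE.
rewrite [X in fine (X - _)]e1.
rewrite [X in fine (_ - X)]e2.
have f1 := integrable_pos_fin_num measurableT If.
have f2 := integrable_neg_fin_num measurableT If.
move: f1 f2; case: (integral _ _ _) => // r1 _; case: (integral _ _ _) => // r2 _ /=.
by rewrite mulrBr.
Qed.

Lemma scales_cintegrable (f : Y -> R[i]) : cintegrable nu f ->
  cintegrable mu (fun x => f (phi x)).
Proof.
by move=> [f1 f2]; split; [exact: scales_integrable f1|exact: scales_integrable f2].
Qed.

Lemma scales_cintegral (f : Y -> R[i]) : cintegrable nu f ->
  cintegral mu (fun x => f (phi x)) = k%:C * cintegral nu f.
Proof.
move=> [f1 f2]; apply: complex_eq; rewrite ?(cReM, cImM) /= ?mul0r ?subr0 ?addr0.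
  exact: scales_Rintegral f1.
exact: scales_Rintegral f2.
Qed.

End change_of_variables.

Lemma scales_integral_comp d1 d2 d3 (X : measurableType d1) (Y : measurableType d2)
  (Z : measurableType d3) (R : realType) (mu : {measure set X -> \bar R})
  (nu : {measure set Y -> \bar R}) (pi : {measure set Z -> \bar R})
  (f : X -> Y) (g : Y -> Z) (k l : R) : scales_integral mu nu f k ->
  scales_integral nu pi g l -> scales_integral mu pi (fun x => g (f x)) (k * l).
Proof.
move=> [mf Hf] [mg Hg]; split; first exact: measurableT_comp mg mf.
move=> h mh h0; rewrite (Hf (fun y => h (g y)))//; last exact: (measurableT_comp mh mg).
by rewrite Hg// EFinM muleA.
Qed.

Section affine_maps.
Variable R : realType.
Local Notation mR := (measurableTypeR R).
Local Notation leb := (@lebesgue_measure R).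

Lemma measurable_affine (a b : R) : measurable_fun [set: R] (fun x => a * x + b).
Proof. by apply: measurable_funD => //; exact: measurable_funM. Qed.

(** Lebesgue measure is determined by its values on the intervals []c, e]], and [a] times its image
    under the affine map takes these values. *)
Lemma scales_affine (a b : R) : 0 < a -> scales_integral leb leb (fun x => a * x + b) a^-1.
Proof.
move=> a0; split; first exact: measurable_affine.
pose phi := fun x : mR => a * x + b : mR.
have mphi : measurable_fun setT phi by exact: measurable_affine.
have [pm pmE] : exists pm : {measure set (mR) -> \bar R},
    pushforward leb phi = pm :> (set (mR) -> \bar R).
  by exists (measure_function_pushforward__canonical__measure_function_Measure leb mphi).
pose m := mscale (NngNum (ltW a0)) pm.
have lm A : measurable A -> leb A = m A.
  apply: lebesgue_measure_unique => B /ocitvP[->|[[c e] /= ce ->]].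
    by rewrite !measure0.
  rewrite /m /mscale -pmE /pushforward /=.
  have -> : phi @^-1` `]c, e]%classic = `](c - b) / a, (e - b) / a]%classic.
    apply/seteqP; split=> x /=; rewrite !in_itv /= /phi ltr_pdivrMr// ler_pdivlMr// mulrC; lra.
  rewrite !lebesgue_measure_itv /= !lte_fin ltr_pM2r ?invr_gt0// ltrD2r.
  case: ifP => _; last by rewrite mule0.
  by rewrite -!EFinB -EFinM; congr (_%:E); field; rewrite gt_eqF.
move=> f mf f0.
have -> : (\int[leb]_x f (a * x + b)%R = \int[pm]_x f x)%E.
  by rewrite -pmE ge0_integral_pushforward.
have -> : (\int[leb]_y f y = \int[m]_y f y)%E.
  by apply: eq_measure_integral => A mA _; exact: lm.
rewrite (@ge0_integral_mscale _ _ _ pm setT measurableT) //.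
by rewrite muleA -EFinM /= mulVf ?gt_eqF// mul1e.
Qed.

Lemma scales_shift (b : R) : scales_integral leb leb (fun x => x + b) 1.
Proof. by have := @scales_affine 1 b ltr01; rewrite invr1; under eq_fun do rewrite mul1r. Qed.

Local Notation ar := (@area R).

(** On each horizontal line the shear is a translation, so Tonelli's theorem reduces it to
    [scales_shift]. *)
Lemma scales_shear1 (a b : R) : scales_integral ar ar (fun p => (p.1 + (a * p.2 + b), p.2)) 1.
Proof.
have mp : measurable_fun setT (fun p : mR * mR =>
    (p.1 + (a * p.2 + b), p.2) : mR * mR).
  apply/measurable_fun_pairP; split => /=; last exact: measurable_snd.
  apply: measurable_funD; first exact: measurable_fst.
  exact: (measurableT_comp (measurable_affine a b) measurable_snd).
split => // f mf f0; rewrite mul1e /area fubini_tonelli2//; last exact: measurableT_comp mf mp.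
rewrite fubini_tonelli2//; apply: eq_integral => y _; rewrite /fubini_G /=.
have [_ H] := scales_shift (a * y + b).
rewrite (H (fun x => f (x, y))) ?mul1e//.
exact: measurableT_comp mf (measurable_pair2 y).
Qed.

Lemma scales_shear2 (a b : R) : scales_integral ar ar (fun p => (p.1, p.2 + (a * p.1 + b))) 1.
Proof.
have mp : measurable_fun setT (fun p : mR * mR =>
    (p.1, p.2 + (a * p.1 + b)) : mR * mR).
  apply/measurable_fun_pairP; split => /=; first exact: measurable_fst.
  apply: measurable_funD; first exact: measurable_snd.
  exact: (measurableT_comp (measurable_affine a b) measurable_fst).
split => // f mf f0; rewrite mul1e /area fubini_tonelli1//; last exact: measurableT_comp mf mp.
rewrite fubini_tonelli1//; apply: eq_integral => x _; rewrite /fubini_F /=.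
have [_ H] := scales_shift (a * x + b).
rewrite (H (fun y => f (x, y))) ?mul1e//.
exact: measurableT_comp mf (measurable_pair1 x).
Qed.

Lemma scales_area_shift (w : R[i]) :
  scales_integral ar ar (fun p => (p.1 + cRe w, p.2 + cIm w)) 1.
Proof.
have := scales_integral_comp (scales_shear1 0 (cRe w)) (scales_shear2 0 (cIm w)).
by rewrite mul1r; under eq_fun do rewrite /= !mul0r !add0r.
Qed.

(* A rotation by an angle other than pi is a product of three shears. *)
Lemma scales_rotation (c s : R) : c ^+ 2 + s ^+ 2 = 1 ->
  scales_integral ar ar (fun p => (c * p.1 - s * p.2, s * p.1 + c * p.2)) 1.
Proof.
have rot (c' s' : R) : c' ^+ 2 + s' ^+ 2 = 1 -> c' != -1 ->
    scales_integral ar ar (fun p => (c' * p.1 - s' * p.2, s' * p.1 + c' * p.2)) 1.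
  move=> cs c1; have c10 : c' + 1 != 0 by apply: contra c1; rewrite addr_eq0.
  (* The tangent of half the angle, which has no value at the excluded angle pi. *)
  set t := s' / (c' + 1).
  have := scales_integral_comp (scales_integral_comp (scales_shear1 (- t) 0) (scales_shear2 s' 0))
    (scales_shear1 (- t) 0).
  rewrite !mul1r; congr (scales_integral _ _ _ _); apply/funext => -[x y] /=.
  have tc : s' * t = 1 - c'.
    rewrite /t mulrA -expr2; apply: (mulIf c10); rewrite divfK//.
    have -> : s' ^+ 2 = 1 - c' ^+ 2 by lra.
    by ring.
  have ts : t * (c' + 1) = s' by rewrite /t divfK.
  congr (_, _).
    transitivity (x - (s' * t) * x - (t * (1 + (1 - s' * t))) * y); first by ring.
    by rewrite tc -[in RHS]ts; ring.
  transitivity (s' * x + (1 - s' * t) * y); first by ring.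
  by rewrite tc; ring.
move=> cs; have [c1|c1] := eqVneq c (-1); last exact: rot.
have s0 : s = 0.
  by apply/eqP; rewrite -sqrf_eq0; apply/eqP; move: cs; rewrite c1 sqrrN expr1n; lra.
(* The half turn is the square of a quarter turn. *)
have r90 := rot 0 1 (ltac:(by rewrite expr0n expr1n add0r)) (ltac:(by rewrite eq_sym oppr_eq0 oner_eq0)).
have := scales_integral_comp r90 r90.
rewrite mul1r; congr (scales_integral _ _ _ _); apply/funext => -[x y] /=.
by rewrite c1 s0; congr (_, _); ring.
Qed.

End affine_maps.

(** * Goursat's theorem and circle means *)

Section entire_measurability.
Variable R : realType.
Local Notation mR := (measurableTypeR R).
Implicit Types F : R[i] -> R[i].

Definition ccontinuous F := forall z (e : R), 0 < e -> exists2 d : R, 0 < d &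
  forall w, normc (w - z) < d -> normc (F w - F z) < e.

Lemma holomorphic_ccontinuous F : holomorphic F -> ccontinuous F.
Proof. by move=> /holomorphicP h z e e0; have [L FL] := h z; exact: cdiff_cont FL _ e0. Qed.

Lemma ccontinuous_comp_real F (g : R -> R[i]) : ccontinuous F ->
  continuous (fun t => cRe (g t)) -> continuous (fun t => cIm (g t)) ->
  continuous (fun t => cRe (F (g t))) /\ continuous (fun t => cIm (F (g t))).
Proof.
move=> cF g1 g2.
have H t (e : R) : 0 < e -> \forall s \near t, normc (F (g s) - F (g t)) < e.
  move=> e0; have [d d0 Fd] := cF (g t) e e0.
  have d2 : 0 < d / 2 by rewrite divr_gt0.
  have /cvgrPdist_lt/(_ _ d2) h1 := g1 t.
  have /cvgrPdist_lt/(_ _ d2) h2 := g2 t.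
  near=> s; apply: Fd; apply: le_lt_trans (normc_le_ReIm _) _.
  have k1 : `|cRe (g t) - cRe (g s)| < d / 2 by near: s.
  have k2 : `|cIm (g t) - cIm (g s)| < d / 2 by near: s.
  rewrite cReD cReN cImD cImN distrC (distrC (cIm _)); lra.
split=> t; apply/cvgrPdist_lt => e e0; have := H t e e0; apply: filterS => s;
  rewrite normcB; apply: le_lt_trans; [rewrite -cReN -cReD|rewrite -cImN -cImD].
  exact: Re_le_normc.
exact: Im_le_normc.
Unshelve. all: by end_near.
Qed.

Lemma continuous_line (a b : R[i]) : continuous (fun t : R => cRe (a + t%:C * b)) /\
  continuous (fun t : R => cIm (a + t%:C * b)).
Proof.
have affine (c d : R) : continuous (fun t : R => c + t * d).
  by move=> t; apply: cvgD; [exact: cvg_cst|apply: cvgM; [exact: cvg_id|exact: cvg_cst]].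
split.
  rewrite (_ : (fun t : R => _) = fun t : R => cRe a + t * cRe b)//.
  by apply/funext => t; rewrite cReD cReM /= mul0r subr0.
rewrite (_ : (fun t : R => _) = fun t : R => cIm a + t * cIm b)//.
by apply/funext => t; rewrite cImD cImM /= mul0r addr0.
Qed.

Lemma ccontinuous_cmeasurable_line F (a b : R[i]) : ccontinuous F ->
  cmeasurable (fun t : mR => F (a + t%:C * b)).
Proof.
move=> cF; have [l1 l2] := continuous_line a b.
by have [c1 c2] := ccontinuous_comp_real cF l1 l2; split; exact: continuous_measurable_fun.
Qed.

Lemma measurable_countable_glue d (X : measurableType d) d' (Y : measurableType d')
  (h : X -> int) (G : int -> X -> Y) :
  (forall k, measurable [set x | h x = k]) -> (forall k, measurable_fun setT (G k)) ->
  measurable_fun setT (fun x => G (h x) x).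
Proof.
move=> mh mG _ B mB; rewrite setTI.
have mk k : measurable ([set x | h x = k] `&` (G k @^-1` B)).
  by apply: measurableI => //; rewrite -[X in measurable X]setTI; exact: mG.
rewrite (_ : _ @^-1` B = \bigcup_m ([set x | h x = Posz m] `&` (G (Posz m) @^-1` B)) `|`
   \bigcup_m ([set x | h x = Negz m] `&` (G (Negz m) @^-1` B))); last first.
  apply/seteqP; split => x /=.
    by case E : (h x) => [m|m] Bx; [left|right]; exists m.
  by move=> [[m _ /= [-> ]]|[m _ /= [-> ]]].
by apply: measurableU; apply: bigcupT_measurable => m; exact: mk.
Qed.

(* F(x + iy) is the limit of its values at (floor (nx) / n, y), which are measurable. *)
Lemma ccontinuous_cmeasurable F : ccontinuous F ->
  cmeasurable (fun p : mR * mR => F (p.1 +i* p.2)).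
Proof.
move=> cF; pose fl n (x : R) : int := Num.floor (n.+1%:R * x).
pose G n (k : int) (p : mR * mR) := F ((k%:~R / n.+1%:R : R) +i* p.2).
have mG n k : cmeasurable (G n k).
  have [m1 m2] := ccontinuous_cmeasurable_line (k%:~R / n.+1%:R)%:C 'i cF.
  have GE p : G n k p = F ((k%:~R / n.+1%:R)%:C + (p.2)%:C * 'i).
    by rewrite /G; congr F; apply: complex_eq; rewrite !(cReD, cImD, cReM, cImM) /=; ring.
  split; under eq_fun do rewrite GE.
    exact: (measurableT_comp m1 measurable_snd).
  exact: (measurableT_comp m2 measurable_snd).
apply: (@cmeasurable_cvg _ _ _ (fun n p => G n (fl n p.1) p)).
  move=> n.
  have mh k : measurable [set p : mR * mR | fl n p.1 = k].
    rewrite (_ : [set _ | _] = setT `&` (fun p : mR * mR => n.+1%:R * p.1) @^-1` `[k%:~R, (k + 1)%:~R[); last first.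
      rewrite setTI; apply/seteqP; split => p /=.
        by move=> <-; rewrite in_itv /=; exact: floor_itv.
      by rewrite in_itv /= => /floor_def.
    have mf : measurable_fun setT (fun p : mR * mR => n.+1%:R * p.1).
      by apply: measurable_funM => //; exact: measurable_fst.
    exact: mf.
  split.
    exact: (measurable_countable_glue mh (fun k => (mG n k).1)).
  exact: (measurable_countable_glue mh (fun k => (mG n k).2)).
move=> -[x y] /=; apply/cvgrPdist_lt => e e0.
have [d d0 Fd] := cF (x +i* y) e e0.
near=> n; rewrite sub0r normrN (ger0_norm (normc_ge0 _)); apply: Fd.
have n0 : 0 < n.+1%:R :> R by [].
have -> : ((fl n x)%:~R / n.+1%:R : R) +i* (y : R) - ((x : R) +i* (y : R)) = ((fl n x)%:~R / n.+1%:R - x)%:C.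
  by apply: complex_eq; rewrite !(cReD, cImD, cReN, cImN) /=; ring.
rewrite normc_real; apply: (@le_lt_trans _ _ n.+1%:R^-1).
  have := floor_itv (n.+1%:R * x); rewrite -/(fl n x) => /andP[f1 f2].
  rewrite -(ler_pM2l n0) mulfV ?gt_eqF// -{1}(gtr0_norm n0) -normrM mulrBr mulrCA mulfV ?gt_eqF// mulr1.
  by rewrite intrD in f2; rewrite ler_norml; apply/andP; split; lra.
near: n; have /cvgrPdist_lt/(_ _ d0) := @cvg_harmonic R.
by apply: filterS => n; rewrite sub0r normrN ger0_norm ?invr_ge0.
Unshelve. all: by end_near.
Qed.

End entire_measurability.

(** * Averages over the unit interval *)

Section mean_on_unit_interval.
Variable R : realType.
Local Notation mR := (measurableTypeR R).
Local Notation leb := (@lebesgue_measure R).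
Implicit Types f g : mR -> R[i].

(** Half-open, so that the two halves of the interval partition it exactly; an indicator on the
    whole line, so that changes of variables apply without restricting the domain. *)
Definition chi01 (t : mR) : R := if 0 <= t < 1 then 1 else 0.

Definition mean01 f : R[i] := cintegral leb (fun t => (chi01 t)%:C * f t).

Definition bounded01 f := cmeasurable f /\
  exists M : R, forall t, 0 <= t < 1 -> normc (f t) <= M.

Lemma chi01E : chi01 = \1_(`[0, 1[%classic : set R).
Proof.
by apply/funext => t; rewrite /chi01 indicE mem_setE in_itv /=; case: ifP.
Qed.

Lemma chi01_ge0 t : 0 <= chi01 t. Proof. by rewrite /chi01; case: ifP. Qed.

Lemma measurable_chi01 : measurable_fun [set: mR] chi01.
Proof. by rewrite chi01E; exact: measurable_indic. Qed.

Lemma integral_chi01 : (\int[leb]_t (chi01 t)%:E = 1)%E.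
Proof.
rewrite chi01E integral_indic// setIT.
by have := @lebesgue_measure_itv R `[0, 1[; rewrite /= lte_fin ltr01 oppr0 adde0.
Qed.

Lemma integrable_chi01 M : leb.-integrable setT (fun t => (M * chi01 t)%:E).
Proof.
apply: integrableZl_real; apply/integrableP; split.
  by apply/measurable_EFinP; exact: measurable_chi01.
under eq_integral do rewrite gee0_abs ?lee_fin ?chi01_ge0//.
by rewrite integral_chi01 ltry.
Qed.

Lemma chi01_le f M : (forall t, 0 <= t < 1 -> normc (f t) <= M) -> forall t,
  normc ((chi01 t)%:C * f t) <= M * chi01 t.
Proof.
move=> h t; rewrite normcM normc_real ger0_norm ?chi01_ge0// mulrC.
by rewrite /chi01; case: ifPn => [/h|_]; rewrite ?mulr1 ?mulr0.
Qed.

Lemma cmeasurable_chi01 f : cmeasurable f -> cmeasurable (fun t => (chi01 t)%:C * f t).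
Proof.
by move=> mf; apply: cmeasurableM => //; apply: cmeasurable_real; exact: measurable_chi01.
Qed.

Lemma bounded01_cintegrable f : bounded01 f -> cintegrable leb (fun t => (chi01 t)%:C * f t).
Proof.
move=> [mf [M fM]]; apply: (le_cintegrable _ (integrable_chi01 M) (chi01_le fM)).
exact: cmeasurable_chi01.
Qed.

Lemma normc_mean01 f M : cmeasurable f -> (forall t, 0 <= t < 1 -> normc (f t) <= M) ->
  normc (mean01 f) <= M.
Proof.
move=> mf fM.
have := normc_cintegral_le (cmeasurable_chi01 mf) (integrable_chi01 M) (chi01_le fM).
rewrite RintegralZl//; last first.
  by have := integrable_chi01 1; under eq_fun do rewrite mul1r.
by rewrite [Rintegral _ _ _](_ : _ = 1) ?mulr1// /Rintegral integral_chi01.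
Qed.

Lemma mean01_cst c : mean01 (fun=> c) = c.
Proof.
rewrite /mean01 cintegralZr; last first.
  have := @integrable_chi01 1; under eq_fun do rewrite mul1r.
  by move=> h; split => //; exact: integrable0.
by rewrite cintegral_real /Rintegral integral_chi01 mul1r.
Qed.

Lemma mean01Zl c f : bounded01 f -> mean01 (fun t => c * f t) = c * mean01 f.
Proof.
move=> bf; rewrite /mean01 -cintegralZl; last exact: bounded01_cintegrable.
by apply: eq_cintegral => t; rewrite mulrCA.
Qed.

Lemma mean01D f g : bounded01 f -> bounded01 g ->
  mean01 (fun t => f t + g t) = mean01 f + mean01 g.
Proof.
move=> bf bg; rewrite /mean01 -cintegralD; [|exact: bounded01_cintegrable..].
by apply: eq_cintegral => t; rewrite mulrDr.
Qed.

Lemma eq_mean01 f g : (forall t, 0 <= t < 1 -> f t = g t) -> mean01 f = mean01 g.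
Proof.
move=> fg; apply: eq_cintegral => t; rewrite /chi01.
by case: ifPn => [/fg ->//|_]; rewrite !mul0r.
Qed.

Lemma bounded01_half f b : 0 <= b <= 1/2 -> bounded01 f -> bounded01 (fun t => f (t / 2 + b)).
Proof.
move=> b0 [mf [M fM]]; split.
  apply: (cmeasurable_comp mf); under eq_fun do rewrite mulrC.
  exact: measurable_affine.
by exists M => t t01; apply: fM; lra.
Qed.

Lemma mean01_half f : bounded01 f ->
  mean01 f = 2^-1 * (mean01 (fun t => f (t / 2)) + mean01 (fun t => f (t / 2 + 1/2))).
Proof.
move=> bf.
pose g b (t : R) := (chi01 t)%:C * f (t / 2 + b).
have Ig b : 0 <= b <= 1/2 -> cintegrable leb (g b).
  by move=> b0; apply: bounded01_cintegrable; exact: bounded01_half.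
have sg b c : 0 <= b <= 1/2 -> cintegrable leb (fun t => g b (2 * t + c)).
  have h0 : 0 < 2^-1 :> R by [].
  by move=> /Ig {}Ig; exact: (scales_cintegrable h0 (scales_affine c (ltr0n _ 2)) Ig).
have cg b c : 0 <= b <= 1/2 -> cintegral leb (fun t => g b (2 * t + c)) = 2^-1 * cintegral leb (g b).
  move=> /Ig {}Ig; rewrite (scales_cintegral (scales_affine c (ltr0n _ 2)) Ig).
  by rewrite fmorphV rmorph_nat.
have b0 : 0 <= (0 : R) <= 1/2 by lra.
have b1 : 0 <= (1/2 : R) <= 1/2 by lra.
(* The functions [g b] vanish off [[0, 1[], so [2 t] selects the left half of the interval and
   [2 t - 1] the right half; the two indicators add up to [chi01 t]. *)
transitivity (cintegral leb (fun t => g 0 (2 * t + 0) + g (1/2) (2 * t + (-1)))).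
  apply: eq_cintegral => t; rewrite /g !addr0.
  have -> : 2 * t / 2 = t by field.
  have -> : (2 * t - 1) / 2 + 1/2 = t by field.
  rewrite -mulrDl -rmorphD /=; congr (_%:C * _); rewrite /chi01.
  have [h1|h1] := boolP (0 <= 2 * t < 1); have [h2|h2] := boolP (0 <= 2 * t - 1 < 1);
  have [h3|h3] := boolP (0 <= t < 1); rewrite /= ?addr0 ?add0r//; exfalso; lra.
rewrite cintegralD; [|exact: sg..].
rewrite !cg// -mulrDr; congr (_ * (_ + _)).
by apply: eq_cintegral => t; rewrite /g addr0.
Qed.

End mean_on_unit_interval.

(** * Contour integrals around parallelograms and Goursat's theorem *)

Section goursat.
Variable R : realType.
Local Notation mR := (measurableTypeR R).
Implicit Types (F : R[i] -> R[i]) (z h k : R[i]).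

Definition seg_integral F z h := h * mean01 (fun t : mR => F (z + t%:C * h)).

(** The contour integral around the parallelogram with corner [z] and sides [h] and [k], which may
    be arbitrary complex numbers. *)
Definition rect_integral F z h k := seg_integral F z h + seg_integral F (z + h) k
  - seg_integral F (z + k) h - seg_integral F z k.

Lemma ccontinuous_bounded01 F z h : ccontinuous F ->
  bounded01 (fun t : mR => F (z + t%:C * h)).
Proof.
move=> cF; split; first exact: ccontinuous_cmeasurable_line.
have [l1 l2] := continuous_line z h; have [c1 c2] := ccontinuous_comp_real cF l1 l2.
have n1 : {within `[0, 1], continuous (fun t : R => `|cRe (F (z + t%:C * h))|)}.
  by apply: continuous_subspaceT => t; apply: cvg_norm; exact: c1.
have n2 : {within `[0, 1], continuous (fun t : R => `|cIm (F (z + t%:C * h))|)}.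
  by apply: continuous_subspaceT => t; apply: cvg_norm; exact: c2.
have [t1 _ h1] := EVT_max ler01 n1.
have [t2 _ h2] := EVT_max ler01 n2.
exists (`|cRe (F (z + t1%:C * h))| + `|cIm (F (z + t2%:C * h))|) => t /andP[t0 t1'].
have tI : t \in `[0, 1] by rewrite in_itv /= t0 ltW.
by apply: le_trans (normc_le_ReIm _) _; rewrite lerD ?h1 ?h2.
Qed.

Lemma seg_integral_half F z h : ccontinuous F ->
  seg_integral F z h = seg_integral F z (h / 2) + seg_integral F (z + h / 2) (h / 2).
Proof.
move=> cF; rewrite /seg_integral mean01_half; last exact: ccontinuous_bounded01.
rewrite mulrA -mulrDr; congr (_ * (_ + _)).
  by apply: eq_mean01 => t _; congr F; rewrite rmorphM fmorphV rmorph_nat /=; ring.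
apply: eq_mean01 => t _; congr F.
by rewrite rmorphD !rmorphM fmorphV rmorph_nat rmorph1 /=; field.
Qed.

(** Each inner edge of the subdivision is run through twice, in opposite directions. *)
Lemma rect_integral_quarter F z h k : ccontinuous F ->
  rect_integral F z h k =
  rect_integral F z (h / 2) (k / 2) + rect_integral F (z + h / 2) (h / 2) (k / 2)
  + rect_integral F (z + k / 2) (h / 2) (k / 2)
  + rect_integral F (z + h / 2 + k / 2) (h / 2) (k / 2).
Proof.
move=> cF; rewrite /rect_integral.
rewrite (seg_integral_half z h cF) (seg_integral_half (z + h) k cF).
rewrite (seg_integral_half (z + k) h cF) (seg_integral_half z k cF).
have -> : z + h / 2 + h / 2 = z + h by field.
have -> : z + k / 2 + k / 2 = z + k by field.
have -> : z + k + h / 2 = z + h / 2 + k / 2 + k / 2 by field.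
have -> : z + h / 2 + k / 2 + h / 2 = z + h + k / 2 by field.
have -> : z + k / 2 + h / 2 = z + h / 2 + k / 2 by ring.
have gen (a b c d e f g i j l m n : R[i]) : a + b + (c + d) - (e + f) - (g + i) =
   a + j - l - g + (b + c - m - j) + (l + n - e - i) + (m + d - f - n) by ring.
exact: gen.
Qed.

Lemma ccontinuous_affine (a b : R[i]) : ccontinuous (fun z => a * z + b).
Proof. by move=> z e e0; exact: cdiff_cont (cdiff_affine a b z) _ e0. Qed.

(** The terms quadratic in a side carry the mean [m] of [t] and cancel between opposite sides,
    whatever the value of [m]; the mixed terms [a * h * k] cancel as well. *)
Lemma rect_integral_affine (a b z h k : R[i]) : rect_integral (fun z => a * z + b) z h k = 0.
Proof.
have cA := ccontinuous_affine a b.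
pose m := mean01 (fun t : mR => t%:C).
have bt : bounded01 (fun t : mR => t%:C).
  split; first by apply: cmeasurable_real; exact: measurable_id.
  by exists 1 => t /andP[t0 t1]; rewrite normc_real ger0_norm// ltW.
have segE w l : seg_integral (fun z => a * z + b) w l = l * (a * w + b) + a * l ^+ 2 * m.
  rewrite /seg_integral.
  have -> : mean01 (fun t : mR => a * (w + t%:C * l) + b) =
     mean01 (fun t => (a * w + b) + a * l * t%:C).
    by apply: eq_mean01 => t _; ring.
  rewrite mean01D.
  - by rewrite mean01_cst mean01Zl// -/m; ring.
  - by split; [exact: cmeasurable_cst|exists (normc (a * w + b))].
  - split; first by apply: cmeasurableM; [exact: cmeasurable_cst|apply: bt.1].
    exists (normc (a * l)) => t /andP[t0 t1]; rewrite normcM normc_real ger0_norm//.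
    by rewrite ler_piMr ?normc_ge0// ltW.
by rewrite /rect_integral !segE; ring.
Qed.

Lemma seg_integralB F G z h : ccontinuous F -> ccontinuous G ->
  seg_integral (fun w => F w - G w) z h = seg_integral F z h - seg_integral G z h.
Proof.
move=> cF cG; rewrite /seg_integral.
have bF := ccontinuous_bounded01 z h cF; have bG := ccontinuous_bounded01 z h cG.
under [X in mean01 X]eq_fun do rewrite -mulN1r.
rewrite mean01D//.
  by rewrite mean01Zl// mulN1r mulrBr.
case: bG => mG [M GM]; split; first by apply: cmeasurableM => //; exact: cmeasurable_cst.
by exists M => t /GM; rewrite normcM normcN normc1 mul1r.
Qed.

Lemma normc_seg_integral F z h M : cmeasurable (fun t : mR => F (z + t%:C * h)) ->
  (forall t : R, 0 <= t < 1 -> normc (F (z + t%:C * h)) <= M) ->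
  normc (seg_integral F z h) <= normc h * M.
Proof.
move=> mF FM; rewrite /seg_integral normcM ler_wpM2l ?normc_ge0//.
exact: normc_mean01.
Qed.

Lemma rect_integralB F G z h k : ccontinuous F -> ccontinuous G ->
  rect_integral (fun w => F w - G w) z h k = rect_integral F z h k - rect_integral G z h k.
Proof.
move=> cF cG; rewrite /rect_integral !seg_integralB//.
move: (seg_integral F z h) (seg_integral F (z + h) k) (seg_integral F (z + k) h) (seg_integral F z k).
move: (seg_integral G z h) (seg_integral G (z + h) k) (seg_integral G (z + k) h) (seg_integral G z k).
by move=> *; ring.
Qed.

Lemma ccontinuousB F G : ccontinuous F -> ccontinuous G -> ccontinuous (fun z => F z - G z).
Proof.
move=> cF cG z e e0; have e2 : 0 < e / 2 by rewrite divr_gt0.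
have [d1 d10 h1] := cF z _ e2; have [d2 d20 h2] := cG z _ e2.
exists (Num.min d1 d2); first by rewrite lt_min d10.
move=> w; rewrite lt_min => /andP[/h1 {}h1 /h2 {}h2].
have -> : F w - G w - (F z - G z) = (F w - F z) - (G w - G z) by ring.
apply: le_lt_trans (normcD _ _) _; rewrite normcN; lra.
Qed.

Lemma normc_rect_integral F z h k M : ccontinuous F ->
  (forall s t : R, 0 <= s <= 1 -> 0 <= t <= 1 -> normc (F (z + s%:C * h + t%:C * k)) <= M) ->
  normc (rect_integral F z h k) <= 2 * (normc h + normc k) * M.
Proof.
move=> cF FM; have m w l := ccontinuous_cmeasurable_line w l cF.
have i0 : 0 <= (0 : R) <= 1 by lra.
have i1 : 0 <= (1 : R) <= 1 by lra.
have b1 : normc (seg_integral F z h) <= normc h * M.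
  apply: normc_seg_integral => // t t01; have := FM t 0; rewrite rmorph0 mul0r addr0; apply; lra.
have b2 : normc (seg_integral F (z + h) k) <= normc k * M.
  apply: normc_seg_integral => // t t01; have := FM 1 t; rewrite rmorph1 mul1r; apply; lra.
have b3 : normc (seg_integral F (z + k) h) <= normc h * M.
  apply: normc_seg_integral => // t t01; have := FM t 1; rewrite rmorph1 mul1r addrAC; apply; lra.
have b4 : normc (seg_integral F z k) <= normc k * M.
  apply: normc_seg_integral => // t t01; have := FM 0 t; rewrite rmorph0 mul0r addr0; apply; lra.
rewrite /rect_integral; apply: le_trans (normcD _ _) _; rewrite normcN.
apply: le_trans (lerD (normcD _ _) (lexx _)) _; rewrite normcN.
apply: le_trans (lerD (lerD (normcD _ _) (lexx _)) (lexx _)) _; lra.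
Qed.

(** The intervals [[v n, v n + q n]] are nested, and the supremum of the left ends lies in all of
    them. It locates the limit point in Goursat's theorem and provides completeness in
    [geometric_limit]. *)
Lemma nested_halving (q v : nat -> R) : (forall n, 0 < q n) ->
  (forall n, v n <= v n.+1 /\ v n.+1 + q n.+1 <= v n + q n) ->
  exists l, forall n, v n <= l <= v n + q n.
Proof.
move=> q0 vP.
have mono m n : (m <= n)%N -> v m <= v n /\ v n + q n <= v m + q m.
  move=> /subnKC <-; elim: (n - m)%N => [|d [IH1 IH2]]; first by rewrite addn0.
  by rewrite addnS; have [w1 w2] := vP (m + d)%N; split; [exact: le_trans w1|exact: le_trans IH2].
exists (sup (range v)) => n.
have ub m : ubound (range v) (v m + q m).
  move=> _ [p _ <-]; have [pm|/ltnW mp] := leqP p m.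
    by have [w1 _] := mono _ _ pm; have := q0 m; lra.
  by have [_ w2] := mono _ _ mp; have := q0 p; lra.
apply/andP; split.
  by apply: ub_le_sup; [exists (v 0%N + q 0%N); exact: ub|exists n].
by apply: ge_sup; [exists (v 0%N); exists 0%N|exact: ub].
Qed.

(** If the integral had modulus [M > 0], repeated quartering would keep a piece with modulus at
    least [M / 4^n]. Near the common point of these pieces [F] is affine up to an error [e |w|]; the
    affine part integrates to 0 and the error contributes at most [2 N^2 e / 4^n], with
    [N = |h| + |k|]. *)
Theorem goursat F z h k : holomorphic F -> rect_integral F z h k = 0.
Proof.
move=> eF; have cF := holomorphic_ccontinuous eF.
apply/eq0_normc/eqP; rewrite eq_le normc_ge0 andbT leNgt; apply/negP => M0.
set M := normc _ in M0.
have unit (a p : R) : 0 < p -> 0 <= a <= 1 -> 0 <= a * p <= p by move=> ? ?; nra.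
have near (x a l p : R) : 0 <= a <= p -> x <= l <= x + p -> `|x + a - l| <= p.
  by move=> ? ?; rewrite ler_norml; lra.
have four (c r1 r2 r3 r4 : R) : M <= c * (r1 + r2 + r3 + r4) -> 4 * c * r1 < M ->
    4 * c * r2 < M -> 4 * c * r3 < M -> 4 * c * r4 < M -> False.
  by move: (M) => M' *; lra.
have half (x a p : R) : 0 < p -> a = 0 \/ a = p / 2 -> x <= x + a /\ x + a + p / 2 <= x + p.
  by move=> p0 []->; split; lra.
pose q (n : nat) : R := (2 ^+ n)^-1.
have q0 n : 0 < q n by rewrite invr_gt0 exprn_gt0.
have qS n : q n.+1 = q n / 2 by rewrite /q exprS invfM mulrC.
(* A piece is recorded by the coordinates of its corner in the frame [h], [k], so nesting is a
   statement on real intervals even when [h] and [k] are proportional. *)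
pose P (st : R * R) := z + st.1%:C * h + st.2%:C * k.
pose bad n st := M <= 4 ^+ n * normc (rect_integral F (P st) ((q n)%:C * h) ((q n)%:C * k)).
pose next n (st st' : R * R) :=
  [/\ st.1 <= st'.1, st'.1 + q n.+1 <= st.1 + q n, st.2 <= st'.2 & st'.2 + q n.+1 <= st.2 + q n].
(* An implication, so that the choice function is total; pieces that are not bad receive the default
   [(0, 0)]. *)
have step (x : nat * (R * R)) : exists st', bad x.1 x.2 -> bad x.1.+1 st' /\ next x.1 x.2 st'.
  case: x => n [s t] /=; have [B|nB] := pselect (bad n (s, t)); last by exists (0, 0).
  have hq l : (q n)%:C * l / 2 = (q n.+1)%:C * l.
    have i2 : (2^-1 : R)%:C = 2^-1 by rewrite fmorphV rmorph_nat.
    by rewrite qS rmorphM /= i2 mulrAC.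
  have PE a b : P (s, t) + a%:C * h + b%:C * k = P (s + a, t + b).
    by rewrite /P /= !rmorphD /=; ring.
  have PE1 a : P (s, t) + a%:C * h = P (s + a, t).
    by rewrite /P /= !rmorphD /=; ring.
  have PE2 b : P (s, t) + b%:C * k = P (s, t + b).
    by rewrite /P /= !rmorphD /=; ring.
  move: (B); rewrite /bad rect_integral_quarter// !hq PE PE1 PE2.
  set r1 := rect_integral _ _ _ _; set r2 := rect_integral _ _ _ _.
  set r3 := rect_integral _ _ _ _; set r4 := rect_integral _ _ _ _.
  have tri : normc (r1 + r2 + r3 + r4) <= normc r1 + normc r2 + normc r3 + normc r4.
    apply: le_trans (normcD _ _) _; rewrite lerD2r.
    apply: le_trans (normcD _ _) _; rewrite lerD2r; exact: normcD.
  move=> /le_trans /(_ (ler_wpM2l (exprn_ge0 n (ler0n R 4)) tri)) big.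
  have qn := q0 n.
  have nx a b : (a = 0 \/ a = q n.+1) -> (b = 0 \/ b = q n.+1) -> next n (s, t) (s + a, t + b).
    rewrite /next /= qS => /(half s _ _ qn)[? ?] /(half t _ _ qn)[? ?]; split => //.
  have [b1|b1] := leP M (4 ^+ n.+1 * normc r1).
    by exists (s, t) => _; split => //; have := nx 0 0; rewrite !addr0; apply; left.
  have [b2|b2] := leP M (4 ^+ n.+1 * normc r2).
    by exists (s + q n.+1, t) => _; split => //; have := nx (q n.+1) 0; rewrite !addr0; apply; [right|left].
  have [b3|b3] := leP M (4 ^+ n.+1 * normc r3).
    by exists (s, t + q n.+1) => _; split => //; have := nx 0 (q n.+1); rewrite !addr0; apply; [left|right].
  have [b4|b4] := leP M (4 ^+ n.+1 * normc r4).
    by exists (s + q n.+1, t + q n.+1) => _; split => //; apply: nx; right.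
  by exfalso; move: b1 b2 b3 b4; rewrite !exprS; exact: four big.
have [f fP] := choice step.
pose u := fix u n := if n is m.+1 then f (m, u m) else (0, 0).
have uB n : bad n (u n).
  elim: n => [|n IH]; last by have [] := fP (n, u n) IH.
  rewrite /bad /= expr0 mul1r /P /q /= expr0 invr1 rmorph0 rmorph1 !mul0r !mul1r !addr0//.
have uN n : next n (u n) (u n.+1) by have [] := fP (n, u n) (uB n).
have [|s sP] := nested_halving (v := fun n => (u n).1) q0; first by move=> n; have [] := uN n.
have [|t tP] := nested_halving (v := fun n => (u n).2) q0; first by move=> n; have [] := uN n.
pose N := normc h + normc k.
have N0 : 0 <= N by rewrite addr_ge0 ?normc_ge0.
(* With this error rate the final bound [2 N^2 e] is strictly below [M]; the [+ 1] also covers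
   [N = 0]. *)
have e0 : 0 < M / (2 * N ^+ 2 + 1).
  by rewrite divr_gt0// ltr_wpDl// mulr_ge0// sqr_ge0.
have /holomorphicP/(_ (P (s, t)))[L FL] := eF.
have [d d0 Fd] := FL _ e0.
have [n nd] : exists n, q n * (N + 1) < d.
  have : 0 < d / (N + 1) by rewrite divr_gt0// ltr_wpDl.
  have /cvgrPdist_lt/[apply] := @cvg_expr R (2^-1) (ltac:(by rewrite ger0_norm// invf_lt1// ltr1n)).
  move=> [n _ /(_ n (leqnn n))]; rewrite sub0r normrN exprVn ger0_norm; last exact: ltW.
  by rewrite ltr_pdivlMr ?ltr_wpDl// => h1; exists n.
have qn := q0 n.
pose A w := L * w + (F (P (s, t)) - L * P (s, t)).
have cA : ccontinuous A by exact: ccontinuous_affine.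
have := uB n; rewrite /bad.
have -> : rect_integral F (P (u n)) ((q n)%:C * h) ((q n)%:C * k) =
    rect_integral (fun w => F w - A w) (P (u n)) ((q n)%:C * h) ((q n)%:C * k).
  by rewrite rect_integralB// rect_integral_affine subr0.
have /(normc_rect_integral (ccontinuousB cF cA)) : forall a b : R, 0 <= a <= 1 -> 0 <= b <= 1 ->
   normc (F (P (u n) + a%:C * ((q n)%:C * h) + b%:C * ((q n)%:C * k)) -
     A (P (u n) + a%:C * ((q n)%:C * h) + b%:C * ((q n)%:C * k))) <=
     M / (2 * N ^+ 2 + 1) * (q n * N).
  move=> a b a01 b01.
  have qa : 0 <= a * q n <= q n.
    exact: unit.
  have qb : 0 <= b * q n <= q n by exact: unit.
  pose w := ((u n).1 + a * q n - s)%:C * h + ((u n).2 + b * q n - t)%:C * k.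
  have -> : P (u n) + a%:C * ((q n)%:C * h) + b%:C * ((q n)%:C * k) = P (s, t) + w.
    rewrite /P /w /= !(rmorphD, rmorphB, rmorphN, rmorphM) /=; ring.
  have -> : F (P (s, t) + w) - A (P (s, t) + w) = F (P (s, t) + w) - F (P (s, t)) - L * w.
    by rewrite /A; ring.
  have wN : normc w <= q n * N.
    apply: le_trans (normcD _ _) _; rewrite !normcM !normc_real /N mulrDr lerD//.
      by rewrite ler_wpM2r ?normc_ge0// near.
    by rewrite ler_wpM2r ?normc_ge0// near.
  apply: le_trans (Fd _ _) _; last by rewrite ler_pM2l.
  by apply: le_lt_trans wN _; apply: le_lt_trans nd; rewrite ler_pM2l// lerDl.
rewrite !normcM normc_real gtr0_norm// -mulrDr -/N.
set r := normc _ => rb.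
have : 4 ^+ n * r <= 2 * N ^+ 2 * (M / (2 * N ^+ 2 + 1)).
  apply: le_trans (ler_wpM2l (exprn_ge0 n (ler0n R 4)) rb) _.
  have -> : 4 ^+ n * (2 * (q n * N) * (M / (2 * N ^+ 2 + 1) * (q n * N))) =
     (4 ^+ n * q n ^+ 2) * (2 * N ^+ 2 * (M / (2 * N ^+ 2 + 1))) by ring.
  have -> : 4 ^+ n * q n ^+ 2 = 1.
    rewrite /q exprVn exprAC -[2 ^+ 2]/(2 * 2) -natrM mulfV// gt_eqF// exprn_gt0//.
  by rewrite mul1r.
move=> h1 h2; have := le_trans h2 h1; apply/negP; rewrite -ltNge.
rewrite mulrCA gtr_pMr// ltr_pdivrMr ?mul1r ?ltrDl//.
by rewrite ltr_wpDl// mulr_ge0// sqr_ge0.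
Qed.

End goursat.

Section holomorphic_closure.
Variable R : realType.
Implicit Types (F G : R[i] -> R[i]) (z w : R[i]).

Lemma holomorphic_comp F G : holomorphic F -> holomorphic G -> holomorphic (fun z => F (G z)).
Proof.
move=> /holomorphicP eF /holomorphicP eG; apply/holomorphicP => z.
have [M GM] := eG z; have [L FL] := eF (G z).
by exists (L * M); exact: cdiff_comp.
Qed.

Lemma holomorphicM F G : holomorphic F -> holomorphic G -> holomorphic (fun z => F z * G z).
Proof.
move=> /holomorphicP eF /holomorphicP eG; apply/holomorphicP => z.
have [M GM] := eG z; have [L FL] := eF z.
by eexists; exact: cdiffM FL GM.
Qed.

Lemma holomorphic_affine a b : holomorphic (fun z : R[i] => a * z + b).
Proof. by apply/holomorphicP => z; exists a; exact: cdiff_affine. Qed.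

Lemma holomorphic_cst c : holomorphic (fun=> c : R[i]).
Proof. by have := holomorphic_affine 0 c; under eq_fun do rewrite mul0r add0r. Qed.

Lemma holomorphic_id : holomorphic (fun z : R[i] => z).
Proof. by have := holomorphic_affine 1 0; under eq_fun do rewrite mul1r addr0. Qed.

Lemma holomorphic_cexp : holomorphic (@cexp R).
Proof. by apply/holomorphicP => z; eexists; exact: cdiff_cexp. Qed.

Lemma holomorphic_shift F w : holomorphic F -> holomorphic (fun z => F (z + w)).
Proof.
move=> eF; have := holomorphic_affine 1 w; under eq_fun do rewrite mul1r.
exact: holomorphic_comp.
Qed.

End holomorphic_closure.

(** * The mean value property on circles *)

Section circle_mean.
Variable R : realType.
Local Notation mR := (measurableTypeR R).
Implicit Types (F : R[i] -> R[i]) (z w : R[i]).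

Definition turn (t : R) : R[i] := cos (2 * pi * t) +i* sin (2 * pi * t).

Lemma cexp_turn (t : R) : cexp (t%:C * ((2 * pi)%:C * 'i)) = turn t.
Proof.
have -> : t%:C * ((2 * pi)%:C * 'i) = 0 +i* (2 * pi * t).
  by apply: complex_eq; rewrite !(cReM, cImM) /=; ring.
by rewrite /cexp /turn /= expR0 mul1r.
Qed.

Lemma turn1 : turn 1 = 1.
Proof. by rewrite /turn mulr1 mulr_natl cos2pi sin2pi. Qed.

Lemma normc_turn t : normc (turn t) = 1.
Proof. by rewrite /= cos2Dsin2 sqrtr1. Qed.

Lemma circle_bounded01 F z : holomorphic F ->
  bounded01 (fun t : mR => F (z * turn t)).
Proof.
move=> eF; pose G w := F (z * cexp w).
have eG : holomorphic G.
  by apply: (holomorphic_comp eF (holomorphicM (holomorphic_cst z) (holomorphic_cexp R))).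
have [m [M GM]] := ccontinuous_bounded01 0 ((2 * pi)%:C * 'i) (holomorphic_ccontinuous eG).
have GE t : G (0 + t%:C * ((2 * pi)%:C * 'i)) = F (z * turn t) by rewrite /G add0r cexp_turn.
split; first by move: m; under eq_fun do rewrite GE.
by exists M => t /GM; rewrite GE.
Qed.

(* F(z e^zeta) is entire and 2 i pi-periodic in zeta, so by Goursat's theorem its mean
   over a period does not depend on Re zeta; let Re zeta tend to minus infinity. *)
Theorem circle_mean F z : holomorphic F ->
  mean01 (fun t : mR => F (z * turn t)) = F 0.
Proof.
move=> eF; pose G w := F (z * cexp w).
have eG : holomorphic G.
  by apply: (holomorphic_comp eF (holomorphicM (holomorphic_cst z) (holomorphic_cexp R))).
have cG := holomorphic_ccontinuous eG.
pose k : R[i] := (2 * pi)%:C * 'i.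
have k0 : k != 0.
  rewrite mulf_neq0//; last by apply/eqP => -[/eqP]; rewrite oner_eq0.
  by apply/eqP => -[/eqP]; rewrite gt_eqF// mulr_gt0// pi_gt0.
have ek : cexp k = 1.
  by transitivity (turn 1); [rewrite -[k]mul1r; exact: (cexp_turn 1)|exact: turn1].
have per w : G (w + k) = G w by rewrite /G cexpD ek mulr1.
pose m (x : R) := mean01 (fun t : mR => G (x%:C + t%:C * k)).
(* In Goursat's theorem for the sides [x] and [k], the two sides parallel to the real axis cancel by
   periodicity; the other two are [k * m x] and [k * m 0]. *)
have mE x : m x = m 0.
  have := goursat 0 x%:C k eG; rewrite /rect_integral.
  have -> : seg_integral G (0 + k) x%:C = seg_integral G 0 x%:C.
    by congr (_ * _); apply: eq_mean01 => t _; rewrite addrAC per.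
    rewrite add0r [X in X - _]addrAC subrr add0r => /eqP; rewrite subr_eq0 => /eqP/(mulfI k0).
  by rewrite /m rmorph0.
have -> : mean01 (fun t : mR => F (z * turn t)) = m 0.
  by apply: eq_mean01 => t _; rewrite /G rmorph0 add0r cexp_turn.
apply/eqP; rewrite -subr_eq0; apply/eqP/eq0_normc/eqP; rewrite eq_le normc_ge0 andbT.
apply/ler_addgt0Pl => e e0; rewrite addr0.
have [d d0 Fd] := holomorphic_ccontinuous eF 0 e0.
have [x xd] : exists x : R, normc z * expR x < d.
  have n0 : 0 < normc z + 1 by rewrite ltr_wpDl// normc_ge0.
  exists (ln (d / (normc z + 1) / 2)); rewrite lnK ?posrE ?divr_gt0//.
  rewrite mulrA ltr_pdivrMr// mulrA ltr_pdivrMr//.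
  have := normc_ge0 z; nra.
rewrite -(mE x); have mG := ccontinuous_bounded01 x%:C k cG.
have -> : m x - F 0 = mean01 (fun t : mR => G (x%:C + t%:C * k) + - F 0).
  rewrite mean01D ?mean01_cst//.
  by split; [exact: cmeasurable_cst|exists (normc (- F 0))].
apply: normc_mean01; first by apply: cmeasurableD; [case: mG|exact: cmeasurable_cst].
move=> t _; apply/ltW/Fd.
by rewrite subr0 cexpD cexp_turn normcM (normcM (cexp _)) normc_turn mulr1 normc_cexp.
Qed.

End circle_mean.

(** * The reproducing formula *)

Section area_sigma_finite.
Variable R : realType.
Local Notation mR := (measurableTypeR R).
Local Notation leb := (@lebesgue_measure R).
Local Notation ar := (@area R).

(* The instance of the library for products of sigma-finite measures is not found by
   inference: the one for subprobabilities takes precedence. *)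
Definition sigma_finite_area : set (mR * mR) -> \bar R :=
  (leb \x leb)%E.

HB.instance Definition _ := Measure.on sigma_finite_area.

Let area_sigma_finite : sigma_finite setT sigma_finite_area.
Proof.
have /sigma_finiteP[F [TF ndF Foo]] := sigma_finiteT leb.
exists (fun n => F n `*` F n).
  rewrite -setXTT TF predeqE => -[x y]; split.
    move=> [/= [n _ Fnx] [k _ Gky]]; exists (maxn n k) => //; split.
    - by move: x Fnx; exact/subsetPset/ndF/leq_maxl.
    - by move: y Gky; exact/subsetPset/ndF/leq_maxr.
  by move=> [n _ []/= ? ?]; split; exists n.
move=> k; have [? ?] := Foo k.
split; first exact: measurableX.
by rewrite /sigma_finite_area product_measure1E// lte_mul_pinfty// ge0_fin_numE.
Qed.

HB.instance Definition _ := Measure_isSigmaFinite.Build _ _ _ sigma_finite_area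
  area_sigma_finite.

Lemma cintegral_fubini_area
  (f : mR * (mR * mR) -> R[i]) :
  cmeasurable f ->
  (\int[leb]_x \int[ar]_p (normc (f (x, p)))%:E < +oo)%E ->
  [/\ cmeasurable (fun x => cintegral (ar) (fun p => f (x, p))),
    cmeasurable (fun p => cintegral leb (fun x => f (x, p))) &
  cintegral leb (fun x => cintegral (ar) (fun p => f (x, p))) =
  cintegral (ar) (fun p => cintegral leb (fun x => f (x, p)))].
Proof. exact: (@cintegral_fubini _ _ _ _ R leb sigma_finite_area). Qed.

Lemma fubini_tonelli_area
  (f : mR * (mR * mR) -> \bar R) :
  measurable_fun setT f -> (forall q, 0 <= f q)%E ->
  (\int[leb]_x \int[ar]_p f (x, p) =
   \int[ar]_p \int[leb]_x f (x, p))%E.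
Proof. by move=> mf f0; exact: (@fubini_tonelli _ _ _ _ R leb sigma_finite_area). Qed.

Lemma fubini_tonelli_area2
  (f : (mR * mR) * (mR * mR) -> \bar R) :
  measurable_fun setT f -> (forall q, 0 <= f q)%E ->
  (\int[ar]_p \int[ar]_q f (p, q) = \int[ar]_q \int[ar]_p f (p, q))%E.
Proof. by move=> mf f0; exact: (@fubini_tonelli _ _ _ _ R sigma_finite_area sigma_finite_area). Qed.

End area_sigma_finite.

Section area_mean.
Variable R : realType.
Local Notation leb := (@lebesgue_measure R).
Local Notation ar := (@area R).
Local Notation mR := (measurableTypeR R).
Implicit Types (F : R[i] -> R[i]) (z w : R[i]).

Definition gaussc z : R := expR (- normc z ^+ 2).

Definition tocomplex (p : mR * mR) : R[i] := p.1 +i* p.2.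

Lemma gausscE z : (gaussc z)%:C = cexp (- (z * z^*)).
Proof. by rewrite mulc_conj -rmorphN cexp_real. Qed.

Lemma gaussc_ge0 z : 0 <= gaussc z. Proof. exact: expR_ge0. Qed.

Lemma cmeasurable_tocomplex : cmeasurable tocomplex.
Proof. by split; [exact: measurable_fst|exact: measurable_snd]. Qed.

Lemma measurable_gaussc : measurable_fun setT (fun p => gaussc (tocomplex p)).
Proof.
apply: measurableT_comp => //; apply: measurableT_comp => //.
exact: measurable_normc_sqr cmeasurable_tocomplex.
Qed.

Lemma integral_gaussc : (\int[ar]_p (gaussc (tocomplex p))%:E = pi%:E)%E.
Proof.
rewrite /area fubini_tonelli1; last 2 first.
- apply/measurable_EFinP; exact: measurable_gaussc.
- by move=> p; rewrite lee_fin gaussc_ge0.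
rewrite /fubini_F /=.
have E x y : gaussc (tocomplex (x, y)) = gauss_fun x * gauss_fun y.
  by rewrite /gaussc normc_sqr /= opprD expRD.
have Ig := @integrableT_gauss R.
under eq_integral => x _.
  under eq_integral do rewrite E EFinM.
  rewrite integralZl// integralT_gauss; over.
rewrite integralZr// integralT_gauss -EFinM -expr2 sqr_sqrtr//.
exact: pi_ge0.
Qed.

Lemma integrable_gaussc : ar.-integrable setT (fun p => (gaussc (tocomplex p))%:E).
Proof.
apply/integrableP; split; first by apply/measurable_EFinP; exact: measurable_gaussc.
under eq_integral do rewrite gee0_abs ?lee_fin ?gaussc_ge0//.
by rewrite integral_gaussc ltry.
Qed.

Definition rot (t : R) (p : mR * mR) : mR * mR :=
  (cos (2 * pi * t) * p.1 - sin (2 * pi * t) * p.2,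
   sin (2 * pi * t) * p.1 + cos (2 * pi * t) * p.2).

Lemma tocomplex_rot t p : tocomplex (rot t p) = tocomplex p * turn t.
Proof.
by apply: complex_eq; rewrite /tocomplex /rot /turn !(cReM, cImM) /=; ring.
Qed.

Lemma scales_rot t : scales_integral ar ar (rot t) 1.
Proof. by apply: scales_rotation; rewrite cos2Dsin2. Qed.

Lemma measurable_rot : measurable_fun setT (fun q : mR * (mR * mR) => rot q.1 q.2).
Proof.
have mc (f : R -> R) : continuous f ->
    measurable_fun setT (fun q : mR * (mR * mR) => f (2 * pi * q.1)).
  move=> cf; have mf : measurable_fun [set: mR] (fun t => f (2 * pi * t)).
    apply: (@measurableT_comp _ _ _ _ _ _ (f : mR -> mR)); first exact: continuous_measurable_fun.
    exact: measurable_funM.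
  exact: (measurableT_comp mf measurable_fst).
have c := mc _ (@continuous_cos R); have s := mc _ (@continuous_sin R).
have x : measurable_fun setT (fun q : mR * (mR * mR) => q.2.1).
  exact: (measurableT_comp measurable_fst measurable_snd).
have y : measurable_fun setT (fun q : mR * (mR * mR) => q.2.2).
  exact: (measurableT_comp measurable_snd measurable_snd).
apply/measurable_fun_pairP; split.
  by apply: measurable_funB; exact: measurable_funM.
by apply: measurable_funD; exact: measurable_funM.
Qed.

(* Averaging the integral over rotations turns F into its circle means. *)
Theorem area_mean F : holomorphic F ->
  cintegrable ar (fun p => F (tocomplex p) * (gaussc (tocomplex p))%:C) ->
  cintegral ar (fun p => F (tocomplex p) * (gaussc (tocomplex p))%:C) = pi%:C * F 0.
Proof.
move=> eF; set f := fun p => _; move=> If.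
have mf := cintegrable_measurable If.
have Ef t p : f (rot t p) = F (tocomplex p * turn t) * (gaussc (tocomplex p))%:C.
  by rewrite /f /gaussc tocomplex_rot normcM normc_turn mulr1.
pose Phi (q : mR * (mR * mR)) := (chi01 q.1)%:C * f (rot q.1 q.2).
have mPhi : cmeasurable Phi.
  apply: cmeasurableM; last exact: (cmeasurable_comp mf measurable_rot).
  by apply: cmeasurable_real; apply: (measurableT_comp (@measurable_chi01 R)); exact: measurable_fst.
have nf := integrable_normc If.
have Nt t : (\int[ar]_p (normc (f (rot t p)))%:E = \int[ar]_p (normc (f p))%:E)%E.
  have [_ H] := scales_rot t; rewrite (H (fun p => (normc (f p))%:E)) ?mul1e//.
    exact/measurable_EFinP/measurable_normc.
  by move=> p; rewrite lee_fin normc_ge0.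
have := cintegral_fubini_area mPhi.
have foo : (\int[leb]_x \int[ar]_y (normc (Phi (x, y)))%:E < +oo)%E.
  pose K := fine (\int[ar]_p (normc (f p))%:E)%E.
  have -> : (\int[leb]_x \int[ar]_y (normc (Phi (x, y)))%:E =
      \int[leb]_t (K * chi01 t)%:E)%E; last exact: (integrable_lty measurableT (integrable_chi01 K)).
  apply: eq_integral => t _; rewrite mulrC EFinM fineK; last exact: integrable_fin_num nf.
  rewrite -(Nt t) -ge0_integralZl//; last 3 first.
  - apply/measurable_EFinP/measurable_normc.
    by have := scales_cintegrable ltr01 (scales_rot t) If; exact: cintegrable_measurable.
  - by move=> p _; rewrite lee_fin normc_ge0.
  - by rewrite lee_fin chi01_ge0.
  by apply: eq_integral => p _; rewrite normcM normc_real ger0_norm ?chi01_ge0// EFinM.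
move=> /(_ foo)[_ _].
have -> : cintegral leb (fun t => cintegral ar (fun p => Phi (t, p))) = cintegral ar f.
  transitivity (cintegral leb (fun t => (chi01 t)%:C * cintegral ar f)); last exact: mean01_cst.
  apply: eq_cintegral => t; rewrite /Phi /= cintegralZl; last exact: (scales_cintegrable ltr01 (scales_rot t) If).
  by rewrite (scales_cintegral (scales_rot t) If) mul1r.
move=> ->; transitivity (cintegral ar (fun p => F 0 * (gaussc (tocomplex p))%:C)); last first.
  rewrite cintegralZl; last first.
    by split; [exact: integrable_gaussc|exact: integrable0].
  by rewrite cintegral_real mulrC /Rintegral integral_gaussc.
apply: eq_cintegral => p; rewrite -(circle_mean (tocomplex p) eF).
rewrite /mean01 -cintegralZr; last exact/bounded01_cintegrable/circle_bounded01.
by apply: eq_cintegral => t; rewrite /Phi /= Ef mulrA.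
Qed.

Lemma integral_shift_area (w : R[i]) (f : mR * mR -> R[i]) : cintegrable ar f ->
  cintegral ar (fun p => f (p.1 + cRe w, p.2 + cIm w)) = cintegral ar f.
Proof. by move=> If; rewrite (scales_cintegral (scales_area_shift w) If) mul1r. Qed.

(* The area mean at 0 of F(z + w) exp(- (z + w) conj w), translated by w. *)
Theorem reproducing F w : holomorphic F ->
  cintegrable ar (fun p => F (tocomplex p) *
    (cexp (w * (tocomplex p)^*) * (gaussc (tocomplex p))%:C)) ->
  cintegral ar (fun p => F (tocomplex p) *
    (cexp (w * (tocomplex p)^*) * (gaussc (tocomplex p))%:C)) = pi%:C * F w.
Proof.
move=> eF; set f := fun p => _; move=> If.
pose H z := F (z + w) * cexp (- w^* * (z + w)).
have eH : holomorphic H.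
  apply: (holomorphicM (holomorphic_shift w eF)).
  apply: (holomorphic_comp (holomorphic_cexp R)).
  have := holomorphic_affine (- w^*) (- w^* * w).
  by under eq_fun do rewrite -mulrDr.
have E p : f (p.1 + cRe w, p.2 + cIm w) =
    cexp (w * w^*) * (H (tocomplex p) * (gaussc (tocomplex p))%:C).
  rewrite /f; have -> : tocomplex (p.1 + cRe w, p.2 + cIm w) = tocomplex p + w.
    by apply: complex_eq; rewrite !(cReD, cImD).
  rewrite /H !gausscE; move: (tocomplex p) => z.
  (* Both exponents equal [- z * conj (z + w)]. *)
  have -> : cexp (w * (z + w)^*) * cexp (- ((z + w) * (z + w)^*)) =
      cexp (w * w^*) * cexp (- w^* * (z + w)) * cexp (- (z * z^*)).
    by rewrite -!cexpD; congr cexp; rewrite rmorphD /=; ring.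
  by move: (cexp _) (cexp _) (cexp _) => a b c; ring.
have If' : cintegrable ar (fun p => f (p.1 + cRe w, p.2 + cIm w)).
  exact: (scales_cintegrable ltr01 (scales_area_shift w) If).
have IH : cintegrable ar (fun p => H (tocomplex p) * (gaussc (tocomplex p))%:C).
  have := cintegrableZl (cexp (- (w * w^*))) If'; congr cintegrable.
  by apply/funext => p; rewrite E mulrA -cexpD addNr cexp0 mul1r.
rewrite -(integral_shift_area w If); under eq_cintegral do rewrite E.
rewrite cintegralZl// area_mean// /H add0r mulrCA; congr (_ * _).
by rewrite mulrC -mulrA -cexpD (_ : _ + _ = 0) ?cexp0 ?mulr1//; ring.
Qed.

End area_mean.

(** * Laplace transforms of Gaussian type *)

Section laplace_transform.
Variable R : realType.
Local Notation leb := (@lebesgue_measure R).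
Local Notation mR := (measurableTypeR R).
Implicit Types (g : mR -> R[i]) (z w : R[i]).

(** Integrability against every exponential makes [laplace g] entire, and the class is stable under
    multiplication by the variable, hence under differentiation of the transform. *)
Definition exp_integrable g := cmeasurable g /\
  forall r : R, leb.-integrable setT (fun v => (expR (r * `|v|) * normc (g v))%:E).

Definition laplace g z : R[i] := cintegral leb (fun v => cexp (z * v%:C) * g v).

Lemma normc_cexp_le z (v : R) : normc (cexp (z * v%:C)) <= expR (normc z * `|v|).
Proof.
rewrite normc_cexp ler_expR; apply: le_trans (ler_norm _) _.
by apply: le_trans (Re_le_normc _) _; rewrite normcM normc_real.
Qed.

Lemma cmeasurable_cexp_mul z : cmeasurable (fun v : mR => cexp (z * v%:C)).
Proof.
apply: cmeasurable_cexp; apply: cmeasurableM; first exact: cmeasurable_cst.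
by apply: cmeasurable_real; exact: measurable_id.
Qed.

Lemma laplace_cintegrable g z : exp_integrable g ->
  cintegrable leb (fun v => cexp (z * v%:C) * g v).
Proof.
move=> [mg ig]; apply: (le_cintegrable _ (ig (normc z))).
  by apply: cmeasurableM => //; exact: cmeasurable_cexp_mul.
by move=> v; rewrite normcM ler_wpM2r ?normc_ge0// normc_cexp_le.
Qed.

Lemma exp_integrable_le g (h : mR -> R[i]) : cmeasurable h -> exp_integrable g ->
  (forall v, normc (h v) <= normc (g v)) -> exp_integrable h.
Proof.
move=> mh [mg ig] hg; split=> // r; apply: (le_integrable_real _ (ig r)).
  apply: measurable_funM; last exact: measurable_normc.
  by apply: measurableT_comp => //; apply: measurable_funM => //; exact: measurableT_comp.
by move=> v; rewrite ger0_norm ?mulr_ge0 ?expR_ge0 ?normc_ge0// ler_wpM2l ?expR_ge0.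
Qed.

Lemma exp_integrable_mulX g : exp_integrable g -> exp_integrable (fun v => v%:C * g v).
Proof.
move=> [mg ig]; split.
  by apply: cmeasurableM => //; apply: cmeasurable_real; exact: measurable_id.
move=> r; apply: (le_integrable_real _ (ig (r + 1))).
  apply: measurable_funM.
    by apply: measurableT_comp => //; apply: measurable_funM => //; exact: measurableT_comp.
  apply: measurable_normc; apply: cmeasurableM => //.
  by apply: cmeasurable_real; exact: measurable_id.
move=> v; rewrite ger0_norm ?mulr_ge0 ?expR_ge0 ?normc_ge0// normcM normc_real mulrA.
rewrite ler_wpM2r ?normc_ge0// mulrDl mul1r expRD ler_wpM2l ?expR_ge0//.
by apply: le_trans (expR_ge1Dx _); lra.
Qed.

(** The remainder has integrand [cexp (z v) * (cexp (h v) - 1 - h v) * g v], which for [|h| < 1] is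
    at most [|h|^2] times a fixed integrable function. *)
Lemma laplace_cdiff g z : exp_integrable g ->
  cdiff (laplace g) z (laplace (fun v => v%:C * g v) z).
Proof.
move=> eg; have ev := exp_integrable_mulX eg; case: (eg) => mg ig e e0.
(* The factor is 3, from [cexp_sub1B_le], times 2, from [v^2 <= 2 exp |v|]. The exponent grows by 2:
   once for that bound, once for [exp |h v| <= exp |v|]. *)
pose K := \int[leb]_v (6 * (expR ((normc z + 2) * `|v|) * normc (g v))).
have K0 : 0 <= K.
  by apply: Rintegral_ge0 => v _; rewrite !mulr_ge0 ?expR_ge0 ?normc_ge0.
have iK := integrableZl_real 6 (ig (normc z + 2)).
exists (Num.min 1 (e / (K + 1))); first by rewrite lt_min ltr01 divr_gt0// ltr_wpDl.
move=> h; rewrite lt_min => /andP[h1 he].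
rewrite /laplace [_ * h]mulrC -cintegralZl; last exact: laplace_cintegrable.
rewrite -cintegralB; [|exact: laplace_cintegrable..].
rewrite -cintegralB; last 2 first.
- by apply: cintegrableB; exact: laplace_cintegrable.
- by apply: cintegrableZl; exact: laplace_cintegrable.
have n0 := normc_ge0 h.
have E v : cexp ((z + h) * v%:C) * g v - cexp (z * v%:C) * g v -
   h * (cexp (z * v%:C) * (v%:C * g v)) = cexp (z * v%:C) * (cexp (h * v%:C) - 1 - h * v%:C) * g v.
  by rewrite mulrDl cexpD; ring.
under eq_cintegral do rewrite E.
apply: (@le_trans _ _ (normc h ^+ 2 * K)); last first.
  rewrite expr2 mulrAC; apply: ler_wpM2r => //.
  apply: (@le_trans _ _ (normc h * (K + 1))); first by rewrite ler_wpM2l// lerDl.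
  by rewrite -ler_pdivlMr ?ltr_wpDl// ltW.
rewrite /K -RintegralZl//.
apply: normc_cintegral_le.
- apply: cmeasurableM => //; apply: cmeasurableM; first exact: cmeasurable_cexp_mul.
  apply: cmeasurableB; last first.
    apply: cmeasurableM; first exact: cmeasurable_cst.
    by apply: cmeasurable_real; exact: measurable_id.
  by apply: cmeasurableB; [exact: cmeasurable_cexp_mul|exact: cmeasurable_cst].
- exact: integrableZl_real.
move=> v; rewrite normcM !mulrA ler_wpM2r ?normc_ge0// normcM.
apply: (le_trans (ler_pM (normc_ge0 _) (normc_ge0 _) (normc_cexp_le _ _) (cexp_sub1B_le _))).
rewrite normcM normc_real exprMn.
have s2 : `|v| ^+ 2 <= 2 * expR `|v|.
  have := @expR_ge1Dxn R (`|v|)%R 1 (normr_ge0 _); rewrite /= -[2`!%:R]/2%:R; lra.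
have e1 : expR (normc h * `|v|) <= expR `|v| by rewrite ler_expR ler_piMl// ltW.
rewrite (_ : (normc z + 2) * `|v| = normc z * `|v| + (`|v| + `|v|)); last by ring.
rewrite !expRD.
have x0 := expR_ge0 (normc z * `|v|); have y0 := expR_ge0 `|v|.
have w0 := expR_ge0 (normc h * `|v|).
have P : `|v| ^+ 2 * expR (normc h * `|v|) <= 2 * expR `|v| * expR `|v|.
  by rewrite ler_pM// sqr_ge0.
have Q : 0 <= normc h ^+ 2 * 3 * expR (normc z * `|v|) by rewrite !mulr_ge0// sqr_ge0.
have := ler_wpM2l Q P.
set A := normc h ^+ 2; set B := expR (normc z * _); set C := expR `|v|; set D := expR (normc h * _).
lra.
Qed.

Lemma laplace_holomorphic g : exp_integrable g -> holomorphic (laplace g).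
Proof. by move=> eg; apply/holomorphicP => z; eexists; exact: laplace_cdiff. Qed.

End laplace_transform.

Section real_invariance.
Variable R : realType.

(* By Goursat's theorem over [w, w + 1] x [w, w + iy], whose vertical sides cancel. *)
Lemma holomorphic_real_invariant (F : R[i] -> R[i]) : holomorphic F ->
  (forall (x : R) w, F (w + x%:C) = F w) -> forall z, F z = F 0.
Proof.
move=> eF inv z; have inv1 w : F (w + 1) = F w := inv 1 w.
have inv2 (y : R) w : F (w + y%:C * 'i) = F w.
  have := goursat w 1 (y%:C * 'i) eF; rewrite /rect_integral.
  have segE u : seg_integral F u 1 = F u.
    rewrite /seg_integral mul1r -[RHS]mean01_cst; apply: eq_mean01 => t _.
    by rewrite mulr1 inv.
  have -> : seg_integral F (w + 1) (y%:C * 'i) = seg_integral F w (y%:C * 'i).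
    by congr (_ * _); apply: eq_mean01 => t _; rewrite addrAC; exact: inv1.
  rewrite !segE => h0; apply/esym/eqP; rewrite -subr_eq0 -[X in _ == X]h0; apply/eqP.
  by move: (F _) (F _) (seg_integral _ _ _) => *; ring.
have {1}-> : z = 0 + (cRe z)%:C + (cIm z)%:C * 'i.
  by apply: complex_eq; rewrite !(cReD, cImD, cReM, cImM) /=; ring.
by rewrite inv2 inv.
Qed.

End real_invariance.

(** * Gaussian weights and their Laplace transforms *)

Section gaussian_weight.
Variable R : realType.
Local Notation leb := (@lebesgue_measure R).
Local Notation mR := (measurableTypeR R).

Definition gauss (b : R) (v : mR) : R := expR (- (b * v ^+ 2)).

Lemma measurable_gauss b : measurable_fun setT (gauss b).
Proof.
apply: measurableT_comp => //; apply: measurableT_comp => //.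
by apply: measurable_funM => //; exact: measurable_funX.
Qed.

Lemma integrable_gauss b : 0 < b -> leb.-integrable setT (fun v => (gauss b v)%:E).
Proof.
move=> b0; have s0 : 0 < Num.sqrt b by rewrite sqrtr_gt0.
have si : 0 < (Num.sqrt b)^-1 by rewrite invr_gt0.
have := scales_integrable si (scales_affine 0 s0) (@integrableT_gauss R).
congr integrable; apply/funext => v; rewrite addr0 /gauss /gauss_fun exprMn sqr_sqrtr//.
exact: ltW.
Qed.

Lemma Rintegral_gauss b : 0 < b -> \int[leb]_v gauss b v = Num.sqrt (pi / b).
Proof.
move=> b0; have s0 : 0 < Num.sqrt b by rewrite sqrtr_gt0.
have si : 0 < (Num.sqrt b)^-1 by rewrite invr_gt0.
have := scales_Rintegral (scales_affine 0 s0) (@integrableT_gauss R).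
have -> : \int[leb]_x gauss_fun x = Num.sqrt pi by rewrite /Rintegral integralT_gauss.
rewrite sqrtrM ?pi_ge0// sqrtrV ?ltW// mulrC => <-.
apply: eq_Rintegral => v _; rewrite addr0 /gauss /gauss_fun exprMn sqr_sqrtr// ltW//.
Qed.

(** Completing the square: half of the Gaussian decay absorbs the exponential. *)
Lemma gauss_exp_le b r (v : R) : 0 < b ->
  expR (r * `|v|) * gauss b v <= expR (r ^+ 2 / (2 * b)) * gauss (b / 2) v.
Proof.
move=> b0; rewrite /gauss -!expRD ler_expR -subr_ge0.
have -> : r ^+ 2 / (2 * b) + - (b / 2 * v ^+ 2) - (r * `|v| + - (b * v ^+ 2)) =
   (r - b * `|v|) ^+ 2 / (2 * b).
  rewrite -[v ^+ 2](real_normK (num_real v)); field; exact: lt0r_neq0.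
by rewrite divr_ge0 ?sqr_ge0// mulr_ge0// ltW.
Qed.

(** If [A] is the exponential times the Gaussian, then [A |f| <= A^2 + |f|^2], and [A^2] is again an
    exponential times a Gaussian, now of parameter [2 b], to which [gauss_exp_le] applies. *)
Lemma exp_integrable_gauss_L2 b (f : mR -> R[i]) : 0 < b -> L2 f ->
  exp_integrable (fun v => (gauss b v)%:C * f v).
Proof.
move=> b0 [f1 f2 f3]; have mf : cmeasurable f by split.
have mg : cmeasurable (fun v => (gauss b v)%:C).
  by apply: cmeasurable_real; exact: measurable_gauss.
have If : leb.-integrable setT (fun v => (normc (f v) ^+ 2)%:E).
  apply/integrableP; split; first by apply/measurable_EFinP; exact: measurable_normc_sqr.
  by under eq_integral do rewrite gee0_abs ?lee_fin ?sqr_ge0//.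
split; first exact: cmeasurableM.
move=> r; have Ig := integrableZl_real (expR ((2 * r) ^+ 2 / (2 * (2 * b)))) (@integrable_gauss b b0).
apply: (le_integrable_real _ (integrableD_real Ig If)).
  apply: measurable_funM; last by apply: measurable_normc; exact: cmeasurableM.
  by apply: measurableT_comp => //; apply: measurable_funM => //; exact: measurableT_comp.
move=> v; rewrite ger0_norm ?mulr_ge0 ?expR_ge0 ?normc_ge0// normcM normc_real.
rewrite (ger0_norm (expR_ge0 _)) [leLHS]mulrA.
set A := expR _ * _; have A0 : 0 <= A by rewrite mulr_ge0 ?expR_ge0.
have A2 : A ^+ 2 <= expR ((2 * r) ^+ 2 / (2 * (2 * b))) * gauss b v.
  have := @gauss_exp_le (2 * b) (2 * r) v (mulr_gt0 (ltr0n _ 2) b0).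
  rewrite (_ : 2 * b / 2 = b); last by field.
  apply: le_trans; rewrite /A /gauss -!expRD -expRM_natl le_eqVlt; apply/orP; left.
  by apply/eqP; congr expR; ring.
have := sqr_ge0 (A - normc (f v)); have := mulr_ge0 A0 (normc_ge0 (f v)).
have -> : (A - normc (f v)) ^+ 2 = A ^+ 2 - 2 * (A * normc (f v)) + normc (f v) ^+ 2 by ring.
set P := A * normc (f v); lra.
Qed.

(** The Gaussian is the product of two copies of [gauss (b / 2)], one serving as the weight and the
    other as the square-integrable function. *)
Lemma exp_integrable_gauss b : 0 < b -> exp_integrable (fun v : mR => (gauss b v)%:C).
Proof.
move=> b0; have b2 : 0 < b / 2 by rewrite divr_gt0.
have Ig := @integrable_gauss b b0.
have Lg : L2 (fun v : mR => (gauss (b / 2) v)%:C).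
  split; [exact: measurable_gauss|exact: measurable_cst|].
  have := integrable_lty measurableT Ig; congr (_ < _)%E; apply: eq_integral => v _.
  rewrite normc_real ger0_norm ?expR_ge0// /gauss -expRM_natl.
  by congr ((expR _)%:E); field.
have := exp_integrable_gauss_L2 b2 Lg; congr exp_integrable; apply/funext => v.
by rewrite -rmorphM /= /gauss -expRD; congr ((expR _)%:C); field.
Qed.

(* exp (- z^2 / 4b) * laplace (gauss b) z is entire and, by translation invariance of the
   integral, invariant under real translations; by Goursat's theorem it is constant. *)
Theorem laplace_gauss b z : 0 < b ->
  laplace (fun v : mR => (gauss b v)%:C) z = (Num.sqrt (pi / b))%:C * cexp (z ^+ 2 / (4 * b)%:C).
Proof.
move=> b0; have eg := exp_integrable_gauss b0.
set Phi := laplace _.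
have bC : b%:C != 0 by rewrite fmorph_eq0 gt_eqF.
have c4 : (4 * b)%:C = 4 * b%:C by rewrite rmorphM rmorph_nat.
have tr (x : R) w : Phi w = cexp (w * x%:C - b%:C * x%:C ^+ 2) * Phi (w - 2 * b%:C * x%:C).
  rewrite /Phi /laplace -cintegralZl; last exact: laplace_cintegrable.
  have Iw := @laplace_cintegrable R _ w eg.
  have := scales_cintegral (scales_shift x) Iw; rewrite mul1r => <-.
  apply: eq_cintegral => v; rewrite /gauss -!cexp_real mulrA -!cexpD; congr cexp.
  by rewrite !(rmorphN, rmorphM, rmorphD, rmorphXn) /=; ring.
pose Psi w := cexp (- (4 * b%:C)^-1 * (w * w)) * Phi w.
have ePsi : holomorphic Psi.
  apply: holomorphicM; last exact: laplace_holomorphic.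
  apply: (holomorphic_comp (holomorphic_cexp R)).
  exact: (holomorphicM (holomorphic_cst _) (holomorphicM (holomorphic_id R) (holomorphic_id R))).
have inv (x : R) w : Psi (w + x%:C) = Psi w.
  (* Translating the variable of integration by [x / (2 b)] moves the argument of [Phi] by exactly
     [- x]. *)
  rewrite /Psi (tr (x / (2 * b)) (w + x%:C)) mulrA -cexpD.
  have xE : (x / (2 * b))%:C = x%:C / (2 * b%:C) by rewrite fmorph_div rmorphM rmorph_nat.
  congr (cexp _ * Phi _); rewrite xE; field; exact: bC.
have -> : Phi z = cexp ((4 * b%:C)^-1 * (z * z)) * Psi z.
  by rewrite /Psi mulrA -cexpD mulNr subrr cexp0 mul1r.
rewrite (holomorphic_real_invariant ePsi inv).
rewrite /Psi mul0r mulr0 cexp0 mul1r c4 mulrC; congr (_ * cexp _); last first.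
  by rewrite expr2 mulrC.
rewrite /Phi /laplace -(Rintegral_gauss b0) -cintegral_real; apply: eq_cintegral => v.
by rewrite mul0r cexp0 mul1r.
Qed.

End gaussian_weight.

(** * Square-integrable functions *)

Section L2_space.
Context d (X : measurableType d) (R : realType) (mu : {measure set X -> \bar R}).
Implicit Types f g h : X -> R[i].
Local Notation ri h := (mu.-integrable setT (fun x => (h x)%:E)).

Definition sq_integrable f := cmeasurable f /\ ri (fun x => normc (f x) ^+ 2).

Definition sqnorm f : R := \int[mu]_x normc (f x) ^+ 2.

Definition inner f g : R[i] := cintegral mu (fun x => f x * (g x)^*).

Lemma sqnorm_ge0 f : 0 <= sqnorm f.
Proof. by apply: Rintegral_ge0 => x _; exact: sqr_ge0. Qed.

Lemma sq_integrableE f : cmeasurable f ->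
  (\int[mu]_x (normc (f x) ^+ 2)%:E < +oo)%E -> sq_integrable f.
Proof.
move=> mf foo; split => //; apply/integrableP; split.
  by apply/measurable_EFinP; exact: measurable_normc_sqr.
by under eq_integral do rewrite gee0_abs ?lee_fin ?sqr_ge0//.
Qed.

Lemma sq_integrable_lty f : sq_integrable f -> (\int[mu]_x (normc (f x) ^+ 2)%:E < +oo)%E.
Proof. by case=> _; exact: integrable_lty. Qed.

Lemma sqnormE f : sq_integrable f -> (\int[mu]_x (normc (f x) ^+ 2)%:E = (sqnorm f)%:E)%E.
Proof. by move=> [_ If]; rewrite /sqnorm /Rintegral fineK//; exact: integrable_fin_num If. Qed.

Lemma sq_integrable_le f g : cmeasurable f -> sq_integrable g ->
  (forall x, normc (f x) <= normc (g x)) -> sq_integrable f.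
Proof.
move=> mf [_ Ig] fg; split=> //; apply: (le_integrable_real _ Ig).
  exact: measurable_normc_sqr.
by move=> x; rewrite ger0_norm ?sqr_ge0// ler_pXn2r ?nnegrE ?normc_ge0.
Qed.

Lemma sq_integrableD f g : sq_integrable f -> sq_integrable g ->
  sq_integrable (fun x => f x + g x).
Proof.
move=> [mf If] [mg Ig]; split; first exact: cmeasurableD.
apply: (le_integrable_real _ (integrableD_real (integrableZl_real 2 If) (integrableZl_real 2 Ig))).
  by apply: measurable_normc_sqr; exact: cmeasurableD.
move=> x; rewrite ger0_norm ?sqr_ge0//.
have := normcD (f x) (g x); have := normc_ge0 (f x + g x).
have := sqr_ge0 (normc (f x) - normc (g x)); nra.
Qed.

Lemma sq_integrableZl c f : sq_integrable f -> sq_integrable (fun x => c * f x).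
Proof.
move=> [mf If]; have mc : cmeasurable (fun x => c * f x).
  by apply: cmeasurableM => //; exact: cmeasurable_cst.
split => //; apply: (le_integrable_real _ (integrableZl_real (normc c ^+ 2) If)).
  exact: measurable_normc_sqr.
by move=> x; rewrite normcM exprMn ger0_norm// mulr_ge0 ?sqr_ge0.
Qed.

Lemma sq_integrableB f g : sq_integrable f -> sq_integrable g ->
  sq_integrable (fun x => f x - g x).
Proof.
move=> Lf Lg; apply: (@sq_integrableD f (fun x => - g x)) => //.
by have := sq_integrableZl (-1) Lg; under eq_fun do rewrite mulN1r.
Qed.

(** Plays the part of the triangle inequality while keeping squared norms; the factor 2 reappears in
    [riesz_fischer]. *)
Lemma sqnormD_le f g : sq_integrable f -> sq_integrable g ->
  sqnorm (fun x => f x + g x) <= 2 * sqnorm f + 2 * sqnorm g.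
Proof.
move=> Lf Lg; have [_ I] := sq_integrableD Lf Lg; case: Lf Lg => [mf If] [mg Ig].
rewrite /sqnorm -!RintegralZl// -RintegralD//; [|exact: integrableZl_real..].
apply: le_Rintegral => //.
  by apply: integrableD_real; exact: integrableZl_real.
move=> x _; have := normcD (f x) (g x); have := normc_ge0 (f x + g x).
have := sqr_ge0 (normc (f x) - normc (g x)); nra.
Qed.

Lemma inner_cintegrable f g : sq_integrable f -> sq_integrable g ->
  cintegrable mu (fun x => f x * (g x)^*).
Proof.
move=> [mf If] [mg Ig]; apply: (le_cintegrable _ (integrableD_real If Ig)).
  by apply: cmeasurableM => //; exact: cmeasurableJ.
move=> x; rewrite normcM normc_conj; have := sqr_ge0 (normc (f x) - normc (g x)).
have := normc_ge0 (f x); have := normc_ge0 (g x); nra.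
Qed.

Lemma innerJ f g : sq_integrable f -> sq_integrable g -> inner g f = (inner f g)^*.
Proof.
move=> Lf Lg; rewrite /inner -cintegralJ; last exact: inner_cintegrable.
by apply: eq_cintegral => x; rewrite rmorphM /= conjcK mulrC.
Qed.

Lemma inner_self f : inner f f = (sqnorm f)%:C.
Proof. by rewrite /inner -cintegral_real; apply: eq_cintegral => x; rewrite mulc_conj. Qed.

Lemma innerBl f g h : sq_integrable f -> sq_integrable g -> sq_integrable h ->
  inner (fun x => f x - g x) h = inner f h - inner g h.
Proof.
move=> Lf Lg Lh; rewrite /inner -cintegralB; [|exact: inner_cintegrable..].
by apply: eq_cintegral => x; rewrite mulrBl.
Qed.

Lemma innerZr c f g : sq_integrable f -> sq_integrable g ->
  inner f (fun x => c * g x) = c^* * inner f g.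
Proof.
move=> Lf Lg; rewrite /inner -cintegralZl; last exact: inner_cintegrable.
by apply: eq_cintegral => x; rewrite rmorphM mulrCA.
Qed.

(** Let [A] and [B] be the squared norms and [N] the modulus of the inner product. Integrating
    [2 |f| |g| <= s |f|^2 + |g|^2 / s] gives [2 N <= s A + B / s] for all [s > 0], and [s = N / A]
    yields the claim. *)
Lemma cauchy_schwarz f g : sq_integrable f -> sq_integrable g ->
  normc (inner f g) ^+ 2 <= sqnorm f * sqnorm g.
Proof.
move=> Lf Lg; have [mf If] := Lf; have [mg Ig] := Lg.
set N := normc _; have N0 : 0 <= N by exact: normc_ge0.
have A0 := sqnorm_ge0 f; have B0 := sqnorm_ge0 g.
have am s : 0 < s -> 2 * N <= s * sqnorm f + s^-1 * sqnorm g.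
  move=> s0; rewrite -ler_pdivlMl// /sqnorm -!RintegralZl// -RintegralD//; [|exact: integrableZl_real..].
  have Is := integrableD_real (integrableZl_real s If) (integrableZl_real s^-1 Ig).
  rewrite -RintegralZl//; apply: normc_cintegral_le.
  - by apply: cmeasurableM => //; exact: cmeasurableJ.
  - exact: integrableZl_real.
  move=> x; rewrite normcM normc_conj ler_pdivlMl//.
  have -> : s * normc (f x) ^+ 2 + s^-1 * normc (g x) ^+ 2 =
      2 * (normc (f x) * normc (g x)) + s^-1 * (s * normc (f x) - normc (g x)) ^+ 2.
    by field; exact: lt0r_neq0.
  by rewrite lerDl mulr_ge0 ?sqr_ge0// invr_ge0 ltW.
clearbody N; have [N1|N1] := leP N 0.
  have -> : N = 0 by apply/eqP; rewrite eq_le N1.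
  by rewrite expr0n mulr_ge0.
have [A1|A1] := leP (sqnorm f) 0.
  (* When [sqnorm f] is 0, this [s] turns the bound into [2 N <= N B / (B + 1)] with [B = sqnorm g],
     which is absurd for [N > 0]. *)
  have := am ((sqnorm g + 1) / N) (divr_gt0 (ltr_wpDl B0 ltr01) N1).
  have -> : sqnorm f = 0 by lra.
  rewrite mulr0 add0r invf_div => h; exfalso.
  have : N / (sqnorm g + 1) * sqnorm g <= N.
    by rewrite mulrAC ler_pdivrMr ?ltr_wpDl// ler_pM2l// lerDl.
  lra.
have := am (N / sqnorm f) (divr_gt0 N1 A1).
rewrite divfK ?gt_eqF// invf_div => h.
have : sqnorm f / N * sqnorm g * N = sqnorm f * sqnorm g.
  by rewrite mulrAC divfK// gt_eqF.
nra.
Qed.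

Lemma inner_cvg (u : nat -> X -> R[i]) f g : (forall n, sq_integrable (u n)) ->
  sq_integrable f -> sq_integrable g ->
  sqnorm (fun x => u n x - f x) @[n --> \oo] --> (0 : R) ->
  normc (inner (u n) g - inner f g) @[n --> \oo] --> (0 : R).
Proof.
move=> Lu Lf Lg u0; apply/cvgrPdist_le => e e0.
have e1 : 0 < e ^+ 2 / (sqnorm g + 1).
  by rewrite divr_gt0 ?exprn_gt0// ltr_wpDl// sqnorm_ge0.
have /cvgrPdist_le/(_ _ e1) := u0; apply: filterS => n.
rewrite !sub0r !normrN !ger0_norm ?sqnorm_ge0 ?normc_ge0// => h.
rewrite -innerBl// -(@ler_pXn2r _ 2) ?nnegrE ?normc_ge0 ?(ltW e0)//.
apply: le_trans (cauchy_schwarz (sq_integrableB (Lu n) Lf) Lg) _.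
have g0 := sqnorm_ge0 g.
apply: le_trans (ler_wpM2r g0 h) _.
by rewrite mulrAC ler_pdivrMr ?ltr_wpDl// ler_pM2l ?exprn_gt0// lerDl.
Qed.

(** Dominated convergence: at each point the truncation is eventually exact, and the squared error
    is at most [|f|^2]. *)
Lemma sqnorm_truncate (E : nat -> set X) f : sq_integrable f ->
  (forall n, measurable (E n)) -> (forall x, exists n, forall m, (n <= m)%N -> E m x) ->
  (forall n, sq_integrable (fun x => (\1_(E n) x)%:C * f x)) /\
  sqnorm (fun x => (\1_(E n) x)%:C * f x - f x) @[n --> \oo] --> (0 : R).
Proof.
move=> [mf If] mE Ecov.
have mEf n : cmeasurable (fun x => (\1_(E n) x)%:C * f x).
  by apply: cmeasurableM => //; apply: cmeasurable_real; exact: measurable_indic.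
have le1 n x : normc ((\1_(E n) x)%:C * f x) <= normc (f x).
  rewrite normcM normc_real ler_piMl ?normc_ge0// indicE.
  by case: (_ \in _); rewrite ?normr1 ?normr0.
split; first by move=> n; exact: sq_integrable_le (mEf n) (conj mf If) (le1 n).
rewrite /sqnorm; apply: (Rintegral_cvg0 (g := fun x => normc (f x) ^+ 2)) => //.
- by move=> n; apply: measurable_normc_sqr; exact: cmeasurableB.
- move=> n x; rewrite ger0_norm ?sqr_ge0// ler_pXn2r ?nnegrE ?normc_ge0//.
  rewrite indicE; case: (_ \in _); first by rewrite mul1r subrr normc0 normc_ge0.
  by rewrite mul0r sub0r normcN.
apply: aeW => x; have [n En] := Ecov x; apply: cvg_near_cst.
exists n => // m /= nm; rewrite indicE mem_set; last exact: En.
by rewrite mul1r subrr normc0 expr0n.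
Qed.

End L2_space.

(** For a real sequence, the intervals of half-length [2 C / 2^k] around its terms are nested. Real
    and imaginary parts each contribute one such half-length, whence the 4. *)
Lemma geometric_limit (R : realType) (v : nat -> R[i]) (C : R) : 0 <= C ->
  (forall k, normc (v k.+1 - v k) <= C / 2 ^+ k) ->
  exists l, forall k, normc (v k - l) <= 4 * C / 2 ^+ k.
Proof.
move=> C0 vC; have p0 k : 0 < 2 ^+ k :> R by rewrite exprn_gt0.
have real_case (w : nat -> R) : 0 < C -> (forall k, `|w k.+1 - w k| <= C / 2 ^+ k) ->
    exists l, forall k, `|w k - l| <= 2 * C / 2 ^+ k.
  move=> C1 wC.
  have [||l lP] := @nested_halving R (fun k => 4 * C / 2 ^+ k) (fun k => w k - 2 * C / 2 ^+ k).
  - by move=> k; rewrite !mulr_gt0// invr_gt0.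
  - move=> k; have := wC k; rewrite ler_norml exprS invfM.
    by move: (2 ^+ k)^-1 => q; split; nra.
  exists l => k; have := lP k; rewrite ler_norml; move: (2 ^+ k)^-1 => q; nra.
(* [nested_halving] asks for positive lengths, so [C = 0], where the sequence is constant, is
   treated apart. *)
have [C1|C1] := leP C 0.
  have CE : C = 0 by lra.
  have vk k : v k = v 0%N.
    elim: k => [//|k <-]; apply/eqP; rewrite -subr_eq0; apply/eqP/eq0_normc/eqP.
    by rewrite eq_le normc_ge0 andbT; have := vC k; rewrite CE mul0r.
  by exists (v 0%N) => k; rewrite vk subrr normc0 CE mulr0 mul0r.
have [a aP] := real_case (fun k => cRe (v k)) C1 (fun k => le_trans
  (eq_ind _ (fun u => `|u| <= _) (Re_le_normc _) _ (etrans (cReD _ _) (congr1 _ (cReN _)))) (vC k)).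
have [b bP] := real_case (fun k => cIm (v k)) C1 (fun k => le_trans
  (eq_ind _ (fun u => `|u| <= _) (Im_le_normc _) _ (etrans (cImD _ _) (congr1 _ (cImN _)))) (vC k)).
exists (a +i* b) => k; apply: le_trans (normc_le_ReIm _) _.
rewrite cReD cReN cImD cImN /=; have := aP k; have := bP k; lra.
Qed.

(** * Completeness of L^2 *)

Section riesz_fischer.
Context d (X : measurableType d) (R : realType) (mu : {measure set X -> \bar R}).

(* Along a subsequence with fast decaying increments d_k, the series of 4^k d_k^2 is integrable,
   hence a.e. finite; this controls both the pointwise limit and the distance to it. *)
Theorem riesz_fischer (u : nat -> X -> R[i]) (e : nat -> R) :
  (forall n, sq_integrable mu (u n)) -> e n @[n --> \oo] --> (0 : R) ->
  (forall m n, (m <= n)%N -> sqnorm mu (fun x => u n x - u m x) <= e m) ->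
  exists2 f, sq_integrable mu f & forall m, sqnorm mu (fun x => u m x - f x) <= 2 * e m.
Proof.
move=> Lu e0 ue.
have p0 k : 0 < 2 ^+ k :> R by rewrite exprn_gt0.
(* The factor [4^-k] compensates the weight [4^k] of the series, and [2^-(k+1)] sums to 1, so the
   integral of the series is at most 1. *)
have [phi phiP] : exists phi : nat -> nat, (forall k, (k <= phi k)%N /\ (phi k <= phi k.+1)%N) /\
    forall k, e (phi k) <= (4 ^+ k)^-1 / 2 ^+ k.+1.
  have step (x : nat * nat) : exists n, [/\ (x.1 <= n)%N, (x.2 <= n)%N &
      e n <= (4 ^+ x.1)^-1 / 2 ^+ x.1.+1].
    have d0 : 0 < (4 ^+ x.1)^-1 / 2 ^+ x.1.+1 :> R.
      by rewrite divr_gt0 ?invr_gt0 ?exprn_gt0.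
    have /cvgrPdist_le/(_ _ d0)[N _ HN] := e0.
    exists (maxn N (maxn x.1 x.2)); split; try lia.
    have /HN : (N <= maxn N (maxn x.1 x.2))%N by lia.
    by rewrite sub0r normrN; apply: le_trans; exact: ler_norm.
  have [f fP] := choice step.
  pose phi := fix phi k := if k is j.+1 then f (j.+1, phi j) else f (0%N, 0%N).
  exists phi; split => k.
    split; first by case: k => [|k]; [case: (fP (0%N, 0%N))|case: (fP (k.+1, phi k))].
    by case: (fP (k.+1, phi k)).
  by case: k => [|k]; [case: (fP (0%N, 0%N))|case: (fP (k.+1, phi k))].
case: phiP => phile phie.
pose D k x := 4 ^+ k * normc (u (phi k.+1) x - u (phi k) x) ^+ 2.
have D0 k x : 0 <= D k x by rewrite /D mulr_ge0 ?sqr_ge0// exprn_ge0.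
have LD k : sq_integrable mu (fun x => u (phi k.+1) x - u (phi k) x) by exact: sq_integrableB.
have mD k : measurable_fun setT (fun x => (D k x)%:E).
  apply/measurable_EFinP/measurable_funM => //.
  by apply: measurable_normc_sqr; case: (LD k).
pose S x := (\sum_(k <oo) (D k x)%:E)%E.
have S0 x : (0 <= S x)%E by apply: nneseries_ge0 => k _ _; rewrite lee_fin.
have mS : measurable_fun setT S.
  have := @ge0_emeasurable_sum _ _ _ setT (fun k x => (D k x)%:E) xpredT.
  by apply=> // k x _ _; rewrite lee_fin.
have IS : (\int[mu]_x S x <= 1)%E.
  rewrite integral_nneseries//; last by move=> k x _; rewrite lee_fin.
  apply: le_trans (@epsilon_trick0 R 1 xpredT ler01).
  apply: lee_nneseries => k _; first by move=> _; apply: integral_ge0 => x _; rewrite lee_fin.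
  under eq_integral do rewrite EFinM.
  rewrite ge0_integralZl//; last 2 first.
  - by apply/measurable_EFinP; apply: measurable_normc_sqr; case: (LD k).
  - by move=> x _; rewrite lee_fin sqr_ge0.
  rewrite sqnormE// -EFinM lee_fin.
  have := le_trans (ue _ _ (phile k).2) (phie k).
  move=> h; apply: le_trans (ler_wpM2l (exprn_ge0 k (ler0n R 4)) h) _.
  by rewrite mulrA mulfV ?gt_eqF ?exprn_gt0// natrX.
pose G := [set x | S x \is a fin_num].
have mG : measurable G by have := emeasurable_fin_num measurableT mS; rewrite setTI.
(* Setting the sequence to 0 where [S] is infinite makes it converge at every point, so the limit is
   measurable. *)
pose v k x : R[i] := (\1_G x)%:C * u (phi k) x.
have vS x k : normc (v k.+1 x - v k x) <= Num.sqrt (fine (S x)) / 2 ^+ k.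
  rewrite /v -mulrBr normcM normc_real indicE; have [xG|xG] := boolP (x \in G); last first.
    by rewrite normr0 mul0r divr_ge0 ?sqrtr_ge0 ?exprn_ge0.
  rewrite normr1 mul1r ler_pdivlMr// -(@ler_pXn2r _ 2) ?nnegrE ?mulr_ge0 ?normc_ge0 ?sqrtr_ge0 ?exprn_ge0//.
  rewrite sqr_sqrtr ?fine_ge0// -lee_fin fineK; last by move: xG; rewrite inE.
  have := @nneseries_lim_ge R (fun k => (D k x)%:E) xpredT 0%N k.+1 (fun n _ _ => D0 n x).
  apply: le_trans; rewrite big_nat_recr//= exprMn mulrC exprAC -[2 ^+ 2]natrX.
  by rewrite leeDr// sume_ge0// => i _; rewrite lee_fin.
have ptw x : exists l, forall k, normc (v k x - l) <= 4 * Num.sqrt (fine (S x)) / 2 ^+ k.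
  by apply: geometric_limit (vS x); exact: sqrtr_ge0.
have [f fP] := choice ptw.
have mv k : cmeasurable (v k).
  apply: cmeasurableM; last by case: (Lu (phi k)).
  by apply: cmeasurable_real; exact: measurable_indic.
have mf : cmeasurable f.
  apply: (cmeasurable_cvg mv) => x.
  apply: (@squeeze_cvgr _ _ _ _ (cst 0) (fun k => 4 * Num.sqrt (fine (S x)) * 2^-1 ^+ k)); last 2 first.
  - exact: cvg_cst.
  - rewrite -[X in _ --> X](mulr0 (4 * Num.sqrt (fine (S x)))); apply: cvgM; first exact: cvg_cst.
    by apply: cvg_expr; rewrite ger0_norm// invf_lt1// ltr1n.
  by apply: nearW => k; rewrite normc_ge0/= exprVn.
(* The 16 is the square of the constant 4 of [geometric_limit]. Where [S] is infinite the pointwise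
   bound is trivial, so it holds everywhere and can be integrated. *)
have fle k : (\int[mu]_x (normc (u (phi k) x - f x) ^+ 2)%:E <= (16 / 4 ^+ k)%:E)%E.
  have mk : cmeasurable (fun x => u (phi k) x - f x) by apply: cmeasurableB => //; case: (Lu (phi k)).
  have c0 : (0 <= (16 / 4 ^+ k : R)%:E)%E by rewrite lee_fin divr_ge0 ?exprn_ge0.
  apply: (@le_trans _ _ (\int[mu]_x ((16 / 4 ^+ k)%:E * S x))%E).
    apply: ge0_le_integral => //.
    - by move=> x _; rewrite lee_fin sqr_ge0.
    - by apply/measurable_EFinP; exact: measurable_normc_sqr.
    - by apply: measurable_funeM.
    - move=> x _; have [xG|xG] := boolP (x \in G).
        have SF : S x \is a fin_num by move: xG; rewrite inE.
        rewrite -(fineK SF) -EFinM lee_fin.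
        have := fP x k; rewrite /v indicE xG mul1r => h.
        have : normc (u (phi k) x - f x) ^+ 2 <= (4 * Num.sqrt (fine (S x)) / 2 ^+ k) ^+ 2.
          by rewrite ler_pXn2r ?nnegrE ?normc_ge0 ?divr_ge0 ?mulr_ge0 ?sqrtr_ge0 ?exprn_ge0.
        move=> /le_trans; apply; rewrite !exprMn sqr_sqrtr ?fine_ge0// exprVn exprAC -[2 ^+ 2]natrX.
        by rewrite -[4 ^+ 2]natrX mulrAC.
      have -> : S x = +oo%E.
        by apply/eqP; rewrite -leye_eq leNgt; apply: contra xG; rewrite inE /G /= ge0_fin_numE.
      by rewrite gt0_muley ?leey// lte_fin divr_gt0 ?exprn_gt0.
  rewrite ge0_integralZl// -[leRHS]mule1; exact: lee_wpmul2l.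
have Lk k : sq_integrable mu (fun x => u (phi k) x - f x).
  apply: sq_integrableE; last exact: le_lt_trans (fle k) (ltry _).
  by apply: cmeasurableB => //; case: (Lu (phi k)).
have Lf : sq_integrable mu f.
  have := sq_integrableB (Lu (phi 0%N)) (Lk 0%N); congr sq_integrable.
  by apply/funext => x; rewrite subKr.
exists f => // m; apply/ler_addgt0Pl => eps eps0.
have [k mk ke] : exists2 k, (m <= k)%N & 32 / 4 ^+ k < eps.
  have /cvgrPdist_lt/(_ _ eps0) : 32 * 4^-1 ^+ k @[k --> \oo] --> (0 : R).
    rewrite -[X in _ --> X](mulr0 32); apply: cvgM; first exact: cvg_cst.
    by apply: cvg_expr; rewrite ger0_norm// invf_lt1// ltr1n.
  move=> [N _ HN]; exists (maxn N m); first lia.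
  have /HN : (N <= maxn N m)%N by lia.
  by rewrite sub0r normrN exprVn; apply: le_lt_trans; exact: ler_norm.
have -> : (fun x => u m x - f x) = (fun x => (u m x - u (phi k) x) + (u (phi k) x - f x)).
  by apply/funext => x; rewrite addrA subrK.
have Lmk : sq_integrable mu (fun x => u m x - u (phi k) x) by exact: sq_integrableB.
apply: le_trans (sqnormD_le Lmk (Lk k)) _; rewrite addrC lerD//.
  apply/ltW; apply: le_lt_trans ke.
  have := fle k; rewrite sqnormE// lee_fin => h.
  by apply: le_trans (ler_wpM2l (ler0n R 2) h) _; rewrite mulrA -natrM.
rewrite ler_pM2l//; apply: le_trans (ue m (phi k) _); last exact: leq_trans mk (phile k).1.
by rewrite /sqnorm le_eqVlt; apply/orP; left; apply/eqP; apply: eq_Rintegral => x _; rewrite normcB.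
Qed.

End riesz_fischer.

(** * The Bargmann kernel and its adjoint *)

Section pair_cst.
Context d1 d2 (X : measurableType d1) (Y : measurableType d2).

Lemma measurable_pair_cst (y : Y) : measurable_fun setT (fun x : X => (x, y)).
Proof. by apply/measurable_fun_pairP; split; [exact: measurable_id|exact: measurable_cst]. Qed.

Lemma measurable_cst_pair (x : X) : measurable_fun setT (fun y : Y => (x, y)).
Proof. by apply/measurable_fun_pairP; split; [exact: measurable_cst|exact: measurable_id]. Qed.

End pair_cst.

Lemma measurable_integral_area d (X : measurableType d) (R : realType)
  (f : X * (measurableTypeR R * measurableTypeR R) -> \bar R) :
  measurable_fun setT f -> (forall r, 0 <= f r)%E ->
  measurable_fun setT (fun x => \int[@area R]_p f (x, p))%E.
Proof.
by move=> mf f0; exact: (@measurable_fun_fubini_tonelli_F _ _ X _ R (@sigma_finite_area R) f mf f0).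
Qed.

Lemma integrable_indic_lty d (X : measurableType d) (R : realType) (mu : {measure set X -> \bar R})
  (E : set X) : measurable E -> (mu E < +oo)%E -> mu.-integrable setT (fun x => (\1_E x)%:E).
Proof.
move=> mE Eoo; apply/integrableP; split; first exact/measurable_EFinP/measurable_indic.
by under eq_integral do rewrite gee0_abs ?lee_fin//; rewrite integral_indic// setIT.
Qed.

Lemma normc_cvg_unique (R : realType) (s : nat -> R[i]) (x y : R[i]) :
  normc (s n - x) @[n --> \oo] --> (0 : R) ->
  normc (s n - y) @[n --> \oo] --> (0 : R) -> x = y.
Proof.
move=> sx sy; apply/eqP; rewrite -subr_eq0; apply/eqP/eq0_normc.
apply/eqP; rewrite eq_le normc_ge0 andbT.
have h : normc (s n - x) + normc (s n - y) @[n --> \oo] --> (0 : R).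
  by rewrite -[X in _ --> X]addr0; exact: cvgD.
have h0 : normc (x - y) @[_ --> \oo] --> normc (x - y) by exact: cvg_cst.
apply: (ler_cvg_to h0 h); apply: nearW => n.
have -> : x - y = - (s n - x) + (s n - y) by ring.
by apply: le_trans (normcD _ _) _; rewrite normcN.
Qed.

Lemma eq_seq_cvg (R : realType) (f g : nat -> R) (l : R) : f =1 g ->
  f @ \oo --> l -> g @ \oo --> l.
Proof. by move=> /funext ->. Qed.

Section bargmann_kernel.
Variables (R : realType) (T : R).
Hypothesis T0 : 0 < T.
Local Notation leb := (@lebesgue_measure R).
Local Notation ar := (@area R).
Local Notation mR := (measurableTypeR R).
Local Notation tc := (@tocomplex R).
Implicit Types (f h : mR -> R[i]) (p q : mR * mR) (z w : R[i]) (H : mR * mR -> R[i]).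

(** With [z] divided by [sqrt 2], the exponent of the transform becomes
    [- z^2 / 2 + 2 a z v - a^2 v^2]; [c] is its prefactor. *)
Let a : R := (Num.sqrt T)^-1.
Let c : R := Num.sqrt 2 / (pi * T) `^ 4^-1.

Let a0 : 0 < a. Proof. by rewrite invr_gt0 sqrtr_gt0. Qed.

Let a2 : a ^+ 2 = T^-1. Proof. by rewrite exprVn sqr_sqrtr// ltW. Qed.

Let c0 : 0 < c.
Proof. by rewrite divr_gt0 ?sqrtr_gt0// powR_gt0// mulr_gt0// pi_gt0. Qed.

Let c2 : c ^+ 2 = 2 / Num.sqrt (pi * T).
Proof.
have pT : 0 < pi * T by rewrite mulr_gt0// pi_gt0.
rewrite expr_div_n sqr_sqrtr//; congr (_ / _).
rewrite -powR_mulrn ?powR_ge0// -powRrM.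
have -> : 4^-1 * 2 = 2^-1 :> R by field.
by rewrite powR12_sqrt// ltW.
Qed.

Lemma sq_integrable_L2 f : L2 f <-> sq_integrable leb f.
Proof.
split=> [[f1 f2 f3]|Lf]; first by apply: sq_integrableE.
by have [[f1 f2] _] := Lf; split=> //; exact: sq_integrable_lty.
Qed.

Lemma L2_innerE f h : L2_inner f h = inner leb f h. Proof. by []. Qed.

Lemma bargmannE f z : sq_integrable leb f -> bargmann T f z =
  c%:C * (cexp (- z ^+ 2) * laplace (fun v => (gauss T^-1 v)%:C * f v) ((2 * Num.sqrt (2 / T))%:C * z)).
Proof.
move=> /sq_integrable_L2 Lf; have eg := exp_integrable_gauss_L2 (f := f) (b := T^-1) (ltac:(by rewrite invr_gt0)) Lf.
rewrite /bargmann /laplace -cintegralZl; last exact: laplace_cintegrable.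
congr (_ * _); apply: eq_cintegral => v; rewrite cexpD cexpD -mulrA -mulrA; congr (_ * (_ * (_ * _))).
by rewrite -rmorphN cexp_real /gauss (mulrC T^-1).
Qed.

Lemma rescaled_bargmannE f z : sq_integrable leb f -> rescaled_bargmann T f z =
  c%:C * (cexp (- (z * z) / 2) * laplace (fun v => (gauss T^-1 v)%:C * f v) ((2 * a)%:C * z)).
Proof.
move=> Lf; rewrite /rescaled_bargmann bargmannE//.
have s2 : (Num.sqrt 2)%:C != 0 :> R[i] by rewrite fmorph_eq0 gt_eqF// sqrtr_gt0.
have ss : (Num.sqrt 2)%:C ^+ 2 = 2 :> R[i] by rewrite -rmorphXn /= sqr_sqrtr// rmorph_nat.
congr (_ * (cexp _ * laplace _ _)).
  by rewrite expr_div_n ss expr2 mulNr.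
rewrite sqrtrM// sqrtrV ?ltW// -/a !rmorphM /= -!mulrA; congr (_ * _).
by rewrite mulrCA [_ * (z / _)]mulrC divfK.
Qed.

Lemma rescaled_bargmann_holomorphic f : sq_integrable leb f -> holomorphic (rescaled_bargmann T f).
Proof.
move=> Lf; rewrite (_ : rescaled_bargmann T f = fun z => c%:C * (cexp (- 2^-1 * (z * z)) *
   laplace (fun v => (gauss T^-1 v)%:C * f v) ((2 * a)%:C * z + 0))); last first.
  apply/funext => z; rewrite rescaled_bargmannE// addr0; congr (_ * (cexp _ * _)).
  by rewrite mulNr mulNr mulrC.
have /sq_integrable_L2 Lf' := Lf.
have eg := exp_integrable_gauss_L2 (f := f) (b := T^-1) (ltac:(by rewrite invr_gt0)) Lf'.
apply: (holomorphicM (holomorphic_cst c%:C)).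
apply: (@holomorphicM R (fun z => cexp (- 2^-1 * (z * z))) (fun z => laplace _ ((2 * a)%:C * z + 0))).
  have h2 := holomorphicM (holomorphic_cst (- 2^-1 : R[i])) (holomorphicM (holomorphic_id R) (holomorphic_id R)).
  exact: (holomorphic_comp (holomorphic_cexp R) h2).
exact: (holomorphic_comp (laplace_holomorphic eg) (holomorphic_affine _ _)).
Qed.

(** * The transform as an integral operator into the unweighted L^2 of the plane *)

Definition fock_weight z : R := expR (- (normc z ^+ 2 / 2)) / Num.sqrt pi.

Lemma fock_weight_gt0 z : 0 < fock_weight z.
Proof. by rewrite divr_gt0 ?expR_gt0// sqrtr_gt0 pi_gt0. Qed.

Lemma fock_weight_sqr z : fock_weight z ^+ 2 = gaussc z / pi.
Proof.
rewrite /fock_weight expr_div_n sqr_sqrtr ?pi_ge0//; congr (_ / _).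
by rewrite -expRM_natl /gaussc; congr expR; field.
Qed.

Lemma fock_weightE z : (fock_weight z)%:C = (Num.sqrt pi)^-1%:C * cexp (- (z * z^*) / 2).
Proof.
rewrite /fock_weight rmorphM mulrC /= -cexp_real mulc_conj; congr (_ * cexp _).
by rewrite !(rmorphN, rmorphM, fmorphV, rmorph_nat) /= mulNr.
Qed.

Lemma cmeasurable_fock_weight : cmeasurable (fun p => (fock_weight (tc p))%:C).
Proof.
apply: cmeasurable_real; apply: measurable_funM => //; apply: measurableT_comp => //.
apply: measurableT_comp => //; apply: measurable_funM => //.
exact: measurable_normc_sqr (@cmeasurable_tocomplex R).
Qed.

Definition weighted (F : R[i] -> R[i]) p : R[i] := (fock_weight (tc p))%:C * F (tc p).

Lemma cmeasurable_weighted F : holomorphic F -> cmeasurable (weighted F).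
Proof.
move=> hF; apply: cmeasurableM; first exact: cmeasurable_fock_weight.
exact: (ccontinuous_cmeasurable (holomorphic_ccontinuous hF)).
Qed.

(* [nbargmann f p] is [S f z * exp (- |z|^2 / 2) / sqrt pi] at [z = p.1 + i p.2], so that the Fock
   norm of [S f] is the norm of [nbargmann f] in the unweighted L^2(C); [nkernel] is the kernel of
   this integral operator and [nadjoint] its adjoint, below denoted S^*. *)
Definition nkernel p (v : mR) : R[i] := (c / Num.sqrt pi)%:C *
  cexp (- (tc p * tc p) / 2 + (2 * a)%:C * tc p * v%:C - (T^-1 * v ^+ 2)%:C - tc p * (tc p)^* / 2).

Definition nbargmann f p : R[i] := cintegral leb (fun v => nkernel p v * f v).

(** The weight contributes [- (x^2 + y^2) / 2] and cancels the growth [y^2 / 2] of [- z^2 / 2],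
    which leaves a perfect square free of [y]. All the functions [nkernel p] thus have moduli that
    are translates of one Gaussian. *)
Lemma normc_nkernel p v : normc (nkernel p v) = c / Num.sqrt pi * expR (- (a * v - p.1) ^+ 2).
Proof.
rewrite /nkernel normcM normc_real normc_cexp ger0_norm; last by rewrite divr_ge0 ?sqrtr_ge0 ?(ltW c0).
congr (_ * expR _).
have i2 : (2^-1 : R[i]) = (2^-1 : R)%:C by rewrite fmorphV rmorph_nat.
rewrite i2 !(cReD, cReN, cReM, cImD, cImN, cImM, cReJ, cImJ) /= !(mulr0, mul0r, addr0, subr0, add0r).
rewrite -a2; move: (p.1 : R) (p.2 : R) (v : R) => x y u; by field.
Qed.

Lemma cmeasurable_nkernel2 : cmeasurable (fun r : mR * (mR * mR) => nkernel r.2 r.1).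
Proof.
have mz : cmeasurable (fun r : mR * (mR * mR) => tc r.2).
  exact: (cmeasurable_comp (@cmeasurable_tocomplex R) measurable_snd).
have mv : cmeasurable (fun r : mR * (mR * mR) => (r.1 : R)%:C).
  by apply: cmeasurable_real; exact: measurable_fst.
have m2 (e : R[i]) : cmeasurable (fun r : mR * (mR * mR) => e) by exact: cmeasurable_cst.
apply: cmeasurableM => //; apply: cmeasurable_cexp.
apply: cmeasurableB; last by apply: cmeasurableM => //; apply: cmeasurableM => //; exact: cmeasurableJ.
apply: cmeasurableB; last first.
  apply: cmeasurable_real; apply: measurable_funM => //; apply: measurable_funX; exact: measurable_fst.
apply: cmeasurableD.
  by apply: cmeasurableM => //; apply: cmeasurableN; exact: cmeasurableM.
by apply: cmeasurableM => //; exact: cmeasurableM.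
Qed.

Lemma cmeasurable_nkernel p : cmeasurable (nkernel p).
Proof.
have mp : measurable_fun setT (fun v : mR => (v, p)).
  by apply/measurable_fun_pairP; split; [exact: measurable_id|exact: measurable_cst].
exact: (cmeasurable_comp cmeasurable_nkernel2 mp).
Qed.

Let kappa : R := (c / Num.sqrt pi) ^+ 2 * (a^-1 * Num.sqrt (pi / 2)).

Lemma sq_integrable_nkernel p : sq_integrable leb (nkernel p) /\ sqnorm leb (nkernel p) = kappa.
Proof.
have E v : normc (nkernel p v) ^+ 2 = (c / Num.sqrt pi) ^+ 2 * gauss 2 (a * v + - p.1).
  by rewrite normc_nkernel exprMn -expRM_natl /gauss mulrN.
have ia : 0 < a^-1 by rewrite invr_gt0.
have I2 := @integrable_gauss R 2 (ltr0n _ 2).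
have Ig := scales_integrable ia (scales_affine (- p.1) a0) I2.
split.
  split; first exact: cmeasurable_nkernel.
  by under eq_fun do rewrite E; exact: integrableZl_real.
rewrite /sqnorm; under eq_Rintegral do rewrite E.
by rewrite RintegralZl// (scales_Rintegral (scales_affine (- p.1) a0) I2) Rintegral_gauss.
Qed.

Lemma sq_integrable_nkernelJ p : sq_integrable leb (fun v => (nkernel p v)^*).
Proof.
have [Lk _] := sq_integrable_nkernel p; apply: (sq_integrable_le _ Lk).
  by apply: cmeasurableJ; exact: cmeasurable_nkernel.
by move=> v; rewrite normc_conj.
Qed.

Lemma nbargmann_inner f p : nbargmann f p = inner leb f (fun v => (nkernel p v)^*).
Proof.
rewrite /nbargmann /inner; apply: eq_cintegral => v; rewrite mulrC; congr (_ * _).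
exact/esym/conjcK.
Qed.

Lemma nbargmannE f p : sq_integrable leb f -> nbargmann f p = weighted (rescaled_bargmann T f) p.
Proof.
move=> Lf; rewrite /weighted rescaled_bargmannE//.
have /sq_integrable_L2 Lf' := Lf.
have eg := exp_integrable_gauss_L2 (f := f) (b := T^-1) (ltac:(by rewrite invr_gt0)) Lf'.
rewrite /laplace -cintegralZl; last exact: laplace_cintegrable.
have I1 := cintegrableZl (cexp (- (tc p * tc p) / 2)) (laplace_cintegrable ((2 * a)%:C * tc p) eg).
rewrite -cintegralZl//.
have I2 := cintegrableZl c%:C I1.
rewrite -cintegralZl//; apply: eq_cintegral => v.
rewrite /nkernel fock_weightE mulrA mulrA mulrA mulrA; congr (_ * _).
rewrite rmorphM /= -cexp_real !cexpD /gauss.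
have -> : cexp (- (T^-1 * v ^+ 2)%:C) = cexp (- (T^-1 * v ^+ 2))%:C by rewrite rmorphN.
have -> : - (tc p * (tc p)^*) / 2 = - (tc p * (tc p)^* / 2) by rewrite mulNr.
by move: (cexp _) (cexp _) (cexp _) (cexp _) => A B C D; ring.
Qed.

(** The bound is uniform in [p], which makes truncations of [nbargmann f] to sets of finite area
    square-integrable before [nbargmann f] itself is known to be so. *)
Lemma nbargmann_bound f p : sq_integrable leb f ->
  normc (nbargmann f p) ^+ 2 <= kappa * sqnorm leb f.
Proof.
move=> Lf; rewrite nbargmann_inner; apply: le_trans (cauchy_schwarz Lf (sq_integrable_nkernelJ p)) _.
rewrite mulrC -(sq_integrable_nkernel p).2 /sqnorm; under [X in X * _]eq_Rintegral do rewrite normc_conj.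
by [].
Qed.

Lemma cmeasurable_pairing f H : cmeasurable f -> cmeasurable H ->
  cmeasurable (fun r : mR * (mR * mR) => nkernel r.2 r.1 * f r.1 * (H r.2)^*).
Proof.
move=> mf mH; apply: cmeasurableM.
  apply: cmeasurableM; first exact: cmeasurable_nkernel2.
  exact: (cmeasurable_comp mf measurable_fst).
by apply: cmeasurableJ; exact: (cmeasurable_comp mH measurable_snd).
Qed.

(** Tonelli's theorem: the integral in [v] is at most [K |H p|], and [H] is integrable. It is
    applied to square-integrable [f] for the adjoint relation, and to the constant 1 for the
    integrability of [nadjoint H]. *)
Lemma pairing_lty f H (K : R) : cmeasurable f -> cintegrable ar H ->
  (forall p, (\int[leb]_v (normc (nkernel p v) * normc (f v))%:E <= K%:E)%E) ->
  (\int[leb]_v \int[ar]_p (normc (nkernel p v * f v * (H p)^*))%:E < +oo)%E.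
Proof.
move=> mf IH HK; have mH := cintegrable_measurable IH.
have mQ := cmeasurable_pairing mf mH.
have := @fubini_tonelli_area R (fun r : mR * (mR * mR) => (normc (nkernel r.2 r.1 * f r.1 * (H r.2)^*))%:E).
move=> /= ->; last 2 first.
- exact/measurable_EFinP/measurable_normc.
- by move=> r; rewrite lee_fin normc_ge0.
have I1 := integrable_normc IH.
apply: le_lt_trans (integrable_lty measurableT (integrableZl_real K I1)).
have mQ2 p : cmeasurable (fun v => nkernel p v * f v * (H p)^*).
  exact: (cmeasurable_comp mQ (measurable_pair_cst p)).
apply: ge0_le_integral => //.
- by move=> p _; apply: integral_ge0 => v _; rewrite lee_fin normc_ge0.
- have mN : measurable_fun setT (fun r : mR * (mR * mR) =>
      (normc (nkernel r.2 r.1 * f r.1 * (H r.2)^*))%:E).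
    exact/measurable_EFinP/measurable_normc.
  apply: (measurable_fun_fubini_tonelli_G (m1 := leb) _ mN).
  by move=> r; rewrite lee_fin normc_ge0.
- by apply/measurable_EFinP; apply: measurable_funM => //; exact: measurable_normc.
move=> p _; rewrite mulrC EFinM.
apply: (@le_trans _ _ ((normc (H p))%:E * \int[leb]_v (normc (nkernel p v) * normc (f v))%:E)%E).
  rewrite -ge0_integralZl//; last 3 first.
  - apply/measurable_EFinP; apply: measurable_funM; apply: measurable_normc => //.
    exact: cmeasurable_nkernel.
  - by move=> v _; rewrite lee_fin mulr_ge0 ?normc_ge0.
  - by rewrite lee_fin normc_ge0.
  apply: ge0_le_integral => //.
  - by move=> v _; rewrite lee_fin normc_ge0.
  - exact/measurable_EFinP/measurable_normc.
  - apply: measurable_funeM; apply/measurable_EFinP; apply: measurable_funM; apply: measurable_normc => //.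
    exact: cmeasurable_nkernel.
  by move=> v _; rewrite -EFinM lee_fin !normcM normc_conj mulrC.
by apply: lee_wpmul2l (HK p); rewrite lee_fin normc_ge0.
Qed.

Lemma pairing_lty_sq f H : sq_integrable leb f -> cintegrable ar H ->
  (\int[leb]_v \int[ar]_p (normc (nkernel p v * f v * (H p)^*))%:E < +oo)%E.
Proof.
move=> Lf IH; have [mf If] := Lf.
apply: (@pairing_lty f H (2^-1 * kappa + 2^-1 * sqnorm leb f)) => // p.
have [Lk kE] := sq_integrable_nkernel p; have [mk Ik] := Lk.
have I1 := integrableD_real (integrableZl_real 2^-1 Ik) (integrableZl_real 2^-1 If).
have -> : 2^-1 * kappa + 2^-1 * sqnorm leb f =
    \int[leb]_v (2^-1 * normc (nkernel p v) ^+ 2 + 2^-1 * normc (f v) ^+ 2).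
  rewrite RintegralD//; [|exact: integrableZl_real..].
  by rewrite !RintegralZl// -kE.
rewrite /Rintegral fineK; last exact: integrable_fin_num I1.
apply: ge0_le_integral => //.
- by move=> v _; rewrite lee_fin mulr_ge0 ?normc_ge0.
- by apply/measurable_EFinP; apply: measurable_funM; exact: measurable_normc.
- by have := measurable_int _ I1.
move=> v _; rewrite lee_fin.
have := sqr_ge0 (normc (nkernel p v) - normc (f v)); move: (normc _) (normc _) => s t; nra.
Qed.

(** Since the kernel is bounded, the integral converges absolutely for integrable [H];
    square-integrable functions are reached through their truncations. *)
Definition nadjoint H v : R[i] := cintegral ar (fun p => (nkernel p v)^* * H p).

Let C0 : 0 <= c / Num.sqrt pi.
Proof. by rewrite mulr_ge0 ?invr_ge0 ?sqrtr_ge0// ltW. Qed.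

Lemma nkernel_integral p : (\int[leb]_v (normc (nkernel p v))%:E = (c / Num.sqrt pi * (a^-1 * Num.sqrt pi))%:E)%E.
Proof.
have ia : 0 < a^-1 by rewrite invr_gt0.
have I1 := @integrable_gauss R 1 ltr01.
have Ig := scales_integrable ia (scales_affine (- p.1) a0) I1.
have E v : normc (nkernel p v) = c / Num.sqrt pi * gauss 1 (a * v + - p.1).
  by rewrite normc_nkernel /gauss mul1r.
under eq_integral do rewrite E EFinM.
rewrite (integralZl measurableT Ig) [RHS]EFinM.
suff -> : (\int[leb]_v (gauss 1 (a * v + - p.1))%:E = (a^-1 * Num.sqrt pi)%:E)%E by [].
have := scales_Rintegral (scales_affine (- p.1) a0) I1.
rewrite Rintegral_gauss// divr1 => <-.
by rewrite /Rintegral fineK//; exact: integrable_fin_num Ig.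
Qed.

Lemma nkernel_le p v : normc (nkernel p v) <= c / Num.sqrt pi.
Proof.
rewrite normc_nkernel ler_piMr//.
by rewrite -[leRHS]expR0 ler_expR oppr_le0 sqr_ge0.
Qed.

Lemma nkernelH_cintegrable H v : cintegrable ar H -> cintegrable ar (fun p => (nkernel p v)^* * H p).
Proof.
move=> IH; have mH := cintegrable_measurable IH.
apply: (le_cintegrable _ (integrableZl_real (c / Num.sqrt pi) (integrable_normc IH))).
  apply: cmeasurableM => //; apply: cmeasurableJ.
  exact: (cmeasurable_comp cmeasurable_nkernel2 (measurable_cst_pair v)).
by move=> p; rewrite normcM normc_conj ler_wpM2r ?normc_ge0// nkernel_le.
Qed.

Lemma nadjointJ H v : cintegrable ar H ->
  (nadjoint H v)^* = cintegral ar (fun p => nkernel p v * (H p)^*).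
Proof.
move=> IH; rewrite /nadjoint -cintegralJ; last exact: nkernelH_cintegrable.
by apply: eq_cintegral => p; rewrite rmorphM; congr (_ * _); exact: conjcK.
Qed.

(** The kernel is bounded, so [nadjoint H] is bounded; the kernel has the same finite integral in
    [v] for every [p], so [nadjoint H] is integrable. A bounded integrable function is
    square-integrable. *)
Lemma sq_integrable_nadjoint H : cintegrable ar H -> sq_integrable leb (nadjoint H).
Proof.
move=> IH; have mH := cintegrable_measurable IH.
have foo : (\int[leb]_v \int[ar]_p (normc (nkernel p v * 1 * (H p)^*))%:E < +oo)%E.
  apply: (pairing_lty (f := fun=> 1) (K := c / Num.sqrt pi * (a^-1 * Num.sqrt pi))) => //.
  by move=> p; rewrite -(nkernel_integral p) normc1; under eq_integral do rewrite mulr1.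
have m1 : cmeasurable (fun=> 1 : R[i]) by move=> d X; exact: cmeasurable_cst.
have mQ := cmeasurable_pairing (m1 _ mR) mH.
have [mA _ _] := cintegral_fubini_area mQ foo.
have EA v : cintegral ar (fun p => nkernel p v * 1 * (H p)^*) = (nadjoint H v)^*.
  by rewrite nadjointJ//; apply: eq_cintegral => p; rewrite mulr1.
have mad : cmeasurable (nadjoint H).
  have := cmeasurableJ mA; congr cmeasurable; apply/funext => v.
  exact: (etrans (congr1 conjc (EA v)) (conjcK _)).
set M := c / Num.sqrt pi * \int[ar]_p normc (H p).
have M0 : 0 <= M.
  by rewrite mulr_ge0//; apply: Rintegral_ge0 => p _; exact: normc_ge0.
have bnd v : normc (nadjoint H v) <= M.
  apply: le_trans (normc_cintegral (nkernelH_cintegrable v IH)) _.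
  rewrite /M -RintegralZl//; last exact: integrable_normc.
  apply: le_Rintegral => //.
  - exact: integrable_normc (nkernelH_cintegrable v IH).
  - by apply: integrableZl_real; exact: integrable_normc.
  by move=> p _; rewrite normcM normc_conj ler_wpM2r ?normc_ge0// nkernel_le.
have mI : measurable_fun setT (fun v : mR => (\int[ar]_p (normc (nkernel p v * 1 * (H p)^*))%:E)%E).
  have mN : measurable_fun setT (fun r : mR * (mR * mR) =>
      (normc (nkernel r.2 r.1 * 1 * (H r.2)^*))%:E).
    exact/measurable_EFinP/measurable_normc.
  have N0 (r : mR * (mR * mR)) : (0 <= (normc (nkernel r.2 r.1 * 1 * (H r.2)^*))%:E)%E.
    by rewrite lee_fin normc_ge0.
  exact: (measurable_integral_area mN N0).
apply: sq_integrableE => //.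
apply: (@le_lt_trans _ _ (M%:E * \int[leb]_v \int[ar]_p (normc (nkernel p v * 1 * (H p)^*))%:E)%E); last first.
  by rewrite lte_mul_pinfty// lee_fin.
rewrite -ge0_integralZl//; last by move=> v _; apply: integral_ge0 => p _; rewrite lee_fin normc_ge0.
apply: ge0_le_integral => //.
- by move=> v _; rewrite lee_fin sqr_ge0.
- exact/measurable_EFinP/measurable_normc_sqr.
- exact: measurable_funeM.
move=> v _; rewrite expr2 EFinM; apply: lee_pmul; rewrite ?lee_fin ?normc_ge0//.
have Iv := nkernelH_cintegrable v IH.
have := normc_cintegral Iv; rewrite -lee_fin => /le_trans; apply.
rewrite /Rintegral fineK; last exact: integrable_fin_num (integrable_normc Iv).
have -> // : (\int[ar]_p (normc ((nkernel p v)^* * H p))%:E = \int[ar]_p (normc (nkernel p v * 1 * (H p)^*))%:E)%E.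
apply: eq_integral => p _; congr (_%:E).
by rewrite mulr1 (normcM (nkernel p v)) (normcM _ (H p)) !normc_conj.
Qed.

Lemma nadjointP f H : sq_integrable leb f -> cintegrable ar H ->
  inner ar (nbargmann f) H = inner leb f (nadjoint H).
Proof.
move=> Lf IH; have mH := cintegrable_measurable IH; have [mf _] := Lf.
have [_ _ E] := cintegral_fubini_area (cmeasurable_pairing mf mH) (pairing_lty_sq Lf IH).
have Ik p : cintegrable leb (fun v => nkernel p v * f v).
  have [Lk _] := sq_integrable_nkernel p.
  have := inner_cintegrable Lf (sq_integrable_nkernelJ p); congr cintegrable.
  by apply/funext => v; rewrite mulrC; congr (_ * _); exact: conjcK.
transitivity (cintegral ar (fun p => cintegral leb (fun v => nkernel p v * f v * (H p)^*))).
  by apply: eq_cintegral => p; rewrite cintegralZr.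
rewrite -E; apply: eq_cintegral => v.
rewrite [Num.conj (nadjoint H v)](nadjointJ v IH) -cintegralZl.
  by apply: eq_cintegral => p; rewrite mulrAC mulrC.
have := cintegrableJ (nkernelH_cintegrable v IH); congr cintegrable.
by apply/funext => p; rewrite rmorphM; congr (_ * _); exact: conjcK.
Qed.

(* The reproducing kernel [exp (z conj w) / pi] of the Fock space, in the same normalization. *)
Definition rkernel (p q : mR * mR) : R[i] := pi^-1%:C *
  cexp (tc p * (tc q)^* - tc p * (tc p)^* / 2 - tc q * (tc q)^* / 2).

(** This is the kernel of S S^*. The integral in [v] is the Laplace transform of [exp (- 2 v^2 / T)]
    at [2 a (z + conj w)], with exponent [(z + conj w)^2 / 2]; the squares cancel against those of
    the two kernels and leave [z * conj w]. The constant is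
    [c^2 / pi * sqrt (pi T / 2) = sqrt 2 / pi]. *)
Lemma nbargmann_nkernelJ p q :
  nbargmann (fun v => (nkernel q v)^*) p = (Num.sqrt 2)%:C * rkernel p q.
Proof.
have b0 : 0 < 2 * T^-1 by rewrite mulr_gt0 ?invr_gt0.
set z := tc p; set w := tc q.
set A := (c ^+ 2 / pi)%:C * cexp (- (z * z + w^* * w^*) / 2 - z * z^* / 2 - w * w^* / 2).
have E v : nkernel p v * (nkernel q v)^* =
    A * (cexp ((2 * a)%:C * (z + w^*) * v%:C) * (gauss (2 * T^-1) v)%:C).
  have -> : (gauss (2 * T^-1) v)%:C = cexp (- (T^-1 * v ^+ 2)%:C - (T^-1 * v ^+ 2)%:C).
    by rewrite -rmorphN -rmorphD cexp_real /gauss; congr (expR _)%:C; ring.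
  rewrite /A /nkernel -/z -/w; move: C0 => _.
  have -> (k : R) : k ^+ 2 / pi = (k / Num.sqrt pi) ^+ 2 by rewrite expr_div_n sqr_sqrtr// pi_ge0.
  move: (c / Num.sqrt pi) => K.
  have -> X : Num.conj (K%:C * cexp X) = K%:C * cexp X^*.
    by rewrite rmorphM /= cexp_conj; congr (_ * _); exact: conjc_real.
  have -> : (- (w * w) / 2 + (2 * a)%:C * w * v%:C - (T^-1 * v ^+ 2)%:C - w * w^* / 2)^* =
     - (w^* * w^*) / 2 + (2 * a)%:C * w^* * v%:C - (T^-1 * v ^+ 2)%:C - w^* * w / 2.
    have i2 : (2^-1 : R[i]) = (2^-1 : R)%:C by rewrite fmorphV rmorph_nat.
    by rewrite i2; apply: complex_eq; rewrite !(cReD, cReN, cReM, cImD, cImN, cImM, cReJ, cImJ) /=; ring.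
  rewrite [LHS]mulrACA -[RHS]mulrA -!cexpD -rmorphM -expr2; congr (_ * cexp _).
  by move: (2^-1 : R[i]) (T^-1 * v ^+ 2)%:C (2 * a)%:C v%:C (w^* : R[i]) (z^* : R[i]) => *; ring.
rewrite /nbargmann; under eq_cintegral do rewrite E.
have eg := exp_integrable_gauss b0.
rewrite cintegralZl; last exact: laplace_cintegrable.
have -> : forall x, cintegral leb (fun v => cexp (x * v%:C) * (gauss (2 * T^-1) v)%:C) =
  laplace (fun v => (gauss (2 * T^-1) v)%:C) x by [].
rewrite laplace_gauss// /rkernel -/z -/w.
have cM (x y : R) : x%:C * y%:C = (x * y)%:C by rewrite rmorphM.
rewrite /A [LHS]mulrACA -cexpD cM [RHS]mulrA cM; congr (_ * cexp _).
  congr (_%:C); rewrite c2 mulrAC; have -> : pi / (2 / T) = pi * T / 2 by rewrite invf_div mulrA.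
  have pT : 0 < pi * T by rewrite mulr_gt0// pi_gt0.
  rewrite (@sqrtrM _ (pi * T)) ?(ltW pT)// [Num.sqrt 2^-1]sqrtrV//; congr (_ / _).
  rewrite mulrA divfK; last by rewrite gt_eqF// sqrtr_gt0.
  by rewrite -{1}[2](@sqr_sqrtr _ 2)// expr2 mulfK// gt_eqF// sqrtr_gt0.
have -> : ((2 * a)%:C * (z + w^*)) ^+ 2 / (4 * (2 / T))%:C = (z + w^*) ^+ 2 / 2.
  rewrite exprMn -rmorphXn mulrAC -fmorphV -rmorphM.
  have -> : (2 * a) ^+ 2 / (4 * (2 / T)) = 2^-1.
    by rewrite exprMn a2; field; rewrite gt_eqF.
  by rewrite fmorphV rmorph_nat mulrC.
by move: (w^* : R[i]) (z^* : R[i]) => x y; field.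
Qed.

(** The real part of the exponent is [- |z - w|^2 / 2], so the modulus is a convolution kernel and
    its integrals over either variable are constant. *)
Lemma normc_rkernel p q : normc (rkernel p q) = pi^-1 * gauss 2^-1 (p.1 - q.1) * gauss 2^-1 (p.2 - q.2).
Proof.
rewrite /rkernel normcM normc_real normc_cexp ger0_norm; last by rewrite invr_ge0 pi_ge0.
rewrite -[RHS]mulrA; congr (_ * _); rewrite /gauss -expRD; congr expR.
have i2 : (2^-1 : R[i]) = (2^-1 : R)%:C by rewrite fmorphV rmorph_nat.
rewrite i2 !(cReD, cReN, cReM, cImD, cImN, cImM, cReJ, cImJ) /= !(mulr0, mul0r, addr0, subr0, add0r).
move: (p.1 : R) (p.2 : R) (q.1 : R) (q.2 : R) => x y u v; by field.
Qed.

Lemma rkernel_mass q : (\int[ar]_p (normc (rkernel p q))%:E = 2%:E)%E.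
Proof.
have h0 : 0 < 2^-1 :> R by rewrite invr_gt0.
have Ig (x : R) := scales_integrable ltr01 (scales_shift (- x)) (integrable_gauss h0).
have Eg (x : R) : (\int[leb]_v (gauss 2^-1 (v - x))%:E = (Num.sqrt (2 * pi))%:E)%E.
  have := scales_Rintegral (scales_shift (- x)) (integrable_gauss h0).
  rewrite mul1r Rintegral_gauss// invrK mulrC => <-.
  by rewrite /Rintegral fineK//; exact: integrable_fin_num (Ig x).
have pi1 : 0 <= pi^-1 :> R by rewrite invr_ge0 pi_ge0.
have mg (x : R) := measurable_int _ (Ig x).
under eq_integral do rewrite normc_rkernel.
rewrite /area fubini_tonelli1; last 2 first.
- apply/measurable_EFinP; apply: measurable_funM.
    apply: measurable_funM => //.
    have /measurable_EFinP := mg q.1; move/measurableT_comp; apply; exact: measurable_fst.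
  have /measurable_EFinP := mg q.2; move/measurableT_comp; apply; exact: measurable_snd.
- by move=> p; rewrite lee_fin !mulr_ge0// expR_ge0.
rewrite /fubini_F /=.
under eq_integral => x _.
  under eq_integral do rewrite EFinM.
  rewrite (integralZl measurableT (Ig q.2)) Eg.
  rewrite EFinM -muleA (muleC _ (Num.sqrt _)%:E) muleA -EFinM.
  over.
rewrite (integralZl measurableT (Ig q.1)) Eg -EFinM; congr (_%:E).
rewrite -mulrA -expr2 sqr_sqrtr ?mulr_ge0 ?pi_ge0// mulrCA mulVf ?mulr1//.
by rewrite gt_eqF// pi_gt0.
Qed.

Lemma rkernelC p q : normc (rkernel p q) = normc (rkernel q p).
Proof. by rewrite !normc_rkernel /gauss -(opprB p.1) sqrrN -(opprB p.2) sqrrN. Qed.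

Lemma rkernel_le p q : normc (rkernel p q) <= pi^-1.
Proof.
have pi1 : 0 <= pi^-1 :> R by rewrite invr_ge0 pi_ge0.
rewrite normc_rkernel -mulrA ler_piMr// /gauss -expRD -[leRHS]expR0 ler_expR.
by rewrite -opprD oppr_le0 addr_ge0// mulr_ge0 ?sqr_ge0// invr_ge0.
Qed.

Lemma cmeasurable_rkernel2 : cmeasurable (fun r : (mR * mR) * (mR * mR) => rkernel r.1 r.2).
Proof.
have m1 := cmeasurable_comp (@cmeasurable_tocomplex R)
  (measurable_fst : measurable_fun setT (@fst (mR * mR)%type (mR * mR)%type)).
have m2 := cmeasurable_comp (@cmeasurable_tocomplex R)
  (measurable_snd : measurable_fun setT (@snd (mR * mR)%type (mR * mR)%type)).
have mc (e : R[i]) : cmeasurable (fun r : (mR * mR) * (mR * mR) => e) by exact: cmeasurable_cst.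
apply: cmeasurableM => //; apply: cmeasurable_cexp.
apply: cmeasurableB.
  apply: cmeasurableB; first by apply: cmeasurableM => //; exact: cmeasurableJ.
  by apply: cmeasurableM => //; apply: cmeasurableM => //; exact: cmeasurableJ.
by apply: cmeasurableM => //; apply: cmeasurableM => //; exact: cmeasurableJ.
Qed.

Lemma cmeasurable_rkernel q : cmeasurable (fun p => rkernel p q).
Proof. exact: (cmeasurable_comp cmeasurable_rkernel2 (measurable_pair_cst q)). Qed.

Lemma integrable_normc_rkernel q : ar.-integrable setT (fun p => (normc (rkernel p q))%:E).
Proof.
apply/integrableP; split.
  by apply/measurable_EFinP/measurable_normc; exact: cmeasurable_rkernel.
by under eq_integral do rewrite gee0_abs ?lee_fin ?normc_ge0//; rewrite rkernel_mass ltry.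
Qed.

Lemma rkernel_integrable (h : mR * mR -> R) q : ar.-integrable setT (fun p => (h p)%:E) ->
  ar.-integrable setT (fun p => (normc (rkernel p q) * h p)%:E).
Proof.
move=> Ih; have /measurable_EFinP mh := measurable_int _ Ih.
apply: (le_integrable_real _ (integrableZl_real pi^-1 (integrable_norm_real Ih))).
  by apply: measurable_funM => //; apply: measurable_normc; exact: cmeasurable_rkernel.
by move=> p; rewrite normrM ger0_norm ?normc_ge0// ler_wpM2r// rkernel_le.
Qed.

(** Tonelli's theorem, with the symmetry [rkernelC] supplying the mass of the kernel in its second
    variable. *)
Lemma rkernel_convolution (h : mR * mR -> R) : ar.-integrable setT (fun p => (h p)%:E) ->
  (forall p, 0 <= h p) ->
  ar.-integrable setT (fun q => (\int[ar]_p (normc (rkernel p q) * h p))%:E) /\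
  \int[ar]_q \int[ar]_p (normc (rkernel p q) * h p) = 2 * \int[ar]_p h p.
Proof.
move=> Ih h0; have /measurable_EFinP mh := measurable_int _ Ih.
have mf : measurable_fun setT (fun r : (mR * mR) * (mR * mR) => (normc (rkernel r.1 r.2) * h r.1)%:E).
  apply/measurable_EFinP; apply: measurable_funM.
    exact/measurable_normc/cmeasurable_rkernel2.
  exact: (measurableT_comp mh measurable_fst).
have f0 (r : (mR * mR) * (mR * mR)) : (0 <= (normc (rkernel r.1 r.2) * h r.1)%:E)%E.
  by rewrite lee_fin mulr_ge0 ?normc_ge0.
have E1 q : (\int[ar]_p (normc (rkernel p q) * h p))%:E = (\int[ar]_p (normc (rkernel p q) * h p)%:E)%E.
  by rewrite /Rintegral fineK//; exact: integrable_fin_num (rkernel_integrable q Ih).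
have E2 : (\int[ar]_q \int[ar]_p (normc (rkernel p q) * h p)%:E = (2 * \int[ar]_p h p)%:E)%E.
  transitivity (\int[ar]_p \int[ar]_q (normc (rkernel p q) * h p)%:E)%E.
    exact: (esym (fubini_tonelli_area2 mf f0)).
  rewrite EFinM /Rintegral fineK; last exact: integrable_fin_num Ih.
  rewrite -(integralZl measurableT Ih); apply: eq_integral => p _.
  under eq_integral do rewrite mulrC EFinM rkernelC.
  rewrite ge0_integralZl//; last 3 first.
  - by apply/measurable_EFinP/measurable_normc; exact: cmeasurable_rkernel.
  - by move=> q _; rewrite lee_fin normc_ge0.
  - by rewrite lee_fin.
  by rewrite rkernel_mass muleC.
have mG : measurable_fun setT (fun q => (\int[ar]_p (normc (rkernel p q) * h p)%:E)%E).
  have mf' : measurable_fun setT (fun r : (mR * mR) * (mR * mR) => (normc (rkernel r.2 r.1) * h r.2)%:E).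
    exact: (measurableT_comp mf (measurable_fun_pair measurable_snd measurable_fst)).
  by apply: (measurable_integral_area mf') => r; rewrite lee_fin mulr_ge0 ?normc_ge0.
split.
  under eq_fun do rewrite E1; apply/integrableP; split => //.
  have G0 q : (0 <= \int[ar]_p (normc (rkernel p q) * h p)%:E)%E.
    by apply: integral_ge0 => p _; rewrite lee_fin mulr_ge0 ?normc_ge0.
  under eq_integral do rewrite (gee0_abs (G0 _)).
  by rewrite E2 ltry.
by rewrite {1}/Rintegral; under eq_integral do rewrite E1; rewrite E2.
Qed.

Lemma rkernelH_cintegrable H q : cintegrable ar H ->
  cintegrable ar (fun p => rkernel p q * (H p)^*).
Proof.
move=> IH; have mH := cintegrable_measurable IH.
apply: (le_cintegrable _ (integrableZl_real pi^-1 (integrable_normc IH))).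
  by apply: cmeasurableM; [exact: cmeasurable_rkernel|exact: cmeasurableJ].
by move=> p; rewrite [leLHS]normcM normc_conj ler_wpM2r ?normc_ge0// rkernel_le.
Qed.

(** Evaluation of S at [q] is an inner product with the conjugate of [nkernel q]; [nadjointP] moves
    S onto this function, whose transform is [nbargmann_nkernelJ]. *)
Lemma nbargmann_nadjoint H q : cintegrable ar H ->
  nbargmann (nadjoint H) q = (Num.sqrt 2)%:C * inner ar H (fun p => rkernel p q).
Proof.
move=> IH; have LA := sq_integrable_nadjoint IH; have LJ := sq_integrable_nkernelJ q.
rewrite nbargmann_inner innerJ// -nadjointP//.
have Ik := rkernelH_cintegrable q IH.
have -> : inner ar (nbargmann (fun v => (nkernel q v)^*)) H =
    (Num.sqrt 2)%:C * cintegral ar (fun p => rkernel p q * (H p)^*).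
  by rewrite -cintegralZl//; apply: eq_cintegral => p; rewrite nbargmann_nkernelJ [RHS]mulrA.
rewrite rmorphM; congr (_ * _).
  exact: conjc_real.
rewrite [LHS](esym (cintegralJ Ik)).
by apply: eq_cintegral => p; rewrite [LHS]rmorphM mulrC; congr (_ * _); exact: conjcK.
Qed.

Lemma cmeasurable_nbargmann f : sq_integrable leb f -> cmeasurable (nbargmann f).
Proof.
move=> Lf; have := cmeasurable_weighted (rescaled_bargmann_holomorphic Lf).
by congr cmeasurable; apply/funext => p; rewrite nbargmannE.
Qed.

(* Schur's test for the kernel [sqrt 2 * rkernel] of S S^*, whose modulus has all its marginal
   integrals equal to 2 sqrt 2. *)
Lemma nadjoint_schur H : cintegrable ar H -> sq_integrable ar H ->
  sqnorm leb (nadjoint H) <= 2 * Num.sqrt 2 * sqnorm ar H.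
Proof.
move=> IH [mH LH]; have LA := sq_integrable_nadjoint IH.
have s2 : 0 <= Num.sqrt 2 :> R by exact: sqrtr_ge0.
have [IG EG] := rkernel_convolution LH (fun p => sqr_ge0 (normc (H p))).
set G := fun q => \int[ar]_p (normc (rkernel p q) * normc (H p) ^+ 2).
have one_int := integrable_normc_rkernel.
have one_val q : \int[ar]_p normc (rkernel p q) = 2 by rewrite /Rintegral rkernel_mass.
have B q : normc (nbargmann (nadjoint H) q * (H q)^*) <=
    Num.sqrt 2 / 2 * G q + Num.sqrt 2 * normc (H q) ^+ 2.
  rewrite [leLHS]normcM normc_conj nbargmann_nadjoint// [X in X * _]normcM normc_real ger0_norm//.
  rewrite -!mulrA -mulrDr ler_wpM2l//.
  apply: (@le_trans _ _ (\int[ar]_p (normc (H q) * (normc (rkernel p q) * normc (H p))))).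
    have Ik := rkernelH_cintegrable q IH.
    rewrite RintegralZl//; last exact: rkernel_integrable (integrable_normc IH).
    rewrite mulrC ler_wpM2l ?normc_ge0//.
    have mk := cmeasurable_rkernel q.
    apply: normc_cintegral_le; last by move=> p; rewrite [leLHS]normcM normc_conj mulrC.
      by apply: cmeasurableM => //; exact: cmeasurableJ.
    exact: rkernel_integrable (integrable_normc IH).
  (* Under the kernel [|H q| |H p| <= (|H p|^2 + |H q|^2) / 2] is used; the mass 2 of the kernel
     turns the last term into [|H q|^2]. *)
  have -> : 2^-1 * G q + normc (H q) ^+ 2 =
     \int[ar]_p (2^-1 * (normc (rkernel p q) * normc (H p) ^+ 2) +
        2^-1 * normc (H q) ^+ 2 * normc (rkernel p q)).
    rewrite RintegralD//; [|exact/integrableZl_real/rkernel_integrable|exact: integrableZl_real].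
    rewrite RintegralZl//; last exact: rkernel_integrable.
    have -> : \int[ar]_p (2^-1 * normc (H q) ^+ 2 * normc (rkernel p q)) =
        2^-1 * normc (H q) ^+ 2 * \int[ar]_p normc (rkernel p q).
      exact: (@RintegralZl _ _ R ar setT (fun p => normc (rkernel p q)) _ measurableT (one_int q)).
    by rewrite one_val; congr (_ + _); field.
  apply: le_Rintegral => //.
  - by apply/integrableZl_real/rkernel_integrable; exact: integrable_normc.
  - by apply: integrableD_real; apply: integrableZl_real => //; exact: rkernel_integrable.
  move=> p _; have k0 := normc_ge0 (rkernel p q).
  have := mulr_ge0 k0 (sqr_ge0 (normc (H q) - normc (H p))).
  move: (normc _) (normc _) (normc _) => k x y; nra.
have IR := integrableD_real (integrableZl_real (Num.sqrt 2 / 2) IG) (integrableZl_real (Num.sqrt 2) LH).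
have -> : sqnorm leb (nadjoint H) = normc (inner ar (nbargmann (nadjoint H)) H).
  by rewrite nadjointP// inner_self normc_real ger0_norm// sqnorm_ge0.
apply: (le_trans (normc_cintegral_le _ IR B)).
  by apply: cmeasurableM; [exact: cmeasurable_nbargmann|exact: cmeasurableJ].
rewrite RintegralD//; [|exact: integrableZl_real..].
rewrite !RintegralZl// EG /sqnorm; move: (\int[ar]_p _) (Num.sqrt 2) => x y.
by rewrite le_eqVlt; apply/orP; left; apply/eqP; field.
Qed.

(** * Boundedness by truncation, the weighted reproducing property and surjectivity *)

Lemma area_exhaustion : exists E : nat -> set (mR * mR),
  [/\ forall n, measurable (E n), forall n, (ar (E n) < +oo)%E,
      forall m n, (m <= n)%N -> E m `<=` E n &
      forall p, exists n, forall m, (n <= m)%N -> E m p].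
Proof.
have /sigma_finiteP[E [TE ndE Eoo]] := sigma_finiteT (@sigma_finite_area R).
have sE m n : (m <= n)%N -> E m `<=` E n by move=> mn; apply/subsetPset/ndE.
exists E; split => // [n|n|p]; [by case: (Eoo n)|by case: (Eoo n)|].
have [n _ En] : (\bigcup_i E i) p by rewrite -TE.
by exists n => m nm; exact: sE nm _ En.
Qed.

Lemma truncation_cintegrable (E : set (mR * mR)) H : measurable E -> (ar E < +oo)%E ->
  sq_integrable ar (fun p => (\1_E p)%:C * H p) -> cintegrable ar (fun p => (\1_E p)%:C * H p).
Proof.
move=> mE Eoo [mH IH].
have IE := integrable_indic_lty mE Eoo.
apply: (le_cintegrable mH (integrableD_real IE IH)) => p.
rewrite indicE; case: (p \in E) => /=; last by rewrite mul0r normc0 expr0n addr0.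
rewrite mul1r; have := sqr_ge0 (normc (H p) - 2^-1); nra.
Qed.

(* By duality: the truncation H of S f satisfies |H|^2 = (S f, H) = (f, S^* H). *)
Lemma sq_integrable_nbargmann f : sq_integrable leb f -> sq_integrable ar (nbargmann f).
Proof.
move=> Lf; have mS := cmeasurable_nbargmann Lf.
have [E [mE Eoo ndE covE]] := area_exhaustion.
pose H n p := (\1_(E n) p)%:C * nbargmann f p.
have mH n : cmeasurable (H n).
  by apply: cmeasurableM => //; apply: cmeasurable_real; exact: measurable_indic.
have HE n p : normc (H n p) ^+ 2 = \1_(E n) p * normc (nbargmann f p) ^+ 2.
  by rewrite /H normcM normc_real exprMn indicE; case: (_ \in _); rewrite ?normr0 ?normr1 ?expr0n ?expr1n ?mul0r.
have K0 : 0 <= kappa * sqnorm leb f := le_trans (sqr_ge0 _) (nbargmann_bound 0 Lf).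
have LH n : sq_integrable ar (H n).
  split => //.
  have IE := integrable_indic_lty (mE n) (Eoo n).
  apply: (le_integrable_real _ (integrableZl_real (kappa * sqnorm leb f) IE)).
    exact: measurable_normc_sqr.
  move=> p; rewrite ger0_norm ?sqr_ge0// HE mulrC ler_wpM2r//; last exact: nbargmann_bound.
have IH n : cintegrable ar (H n) := truncation_cintegrable (mE n) (Eoo n) (LH n).
have bnd n : sqnorm ar (H n) <= 2 * Num.sqrt 2 * sqnorm leb f.
  have e1 : (sqnorm ar (H n))%:C = inner leb f (nadjoint (H n)).
    rewrite -nadjointP// -inner_self; apply: eq_cintegral => p.
    by rewrite /H indicE; case: (_ \in _); rewrite /= ?mul1r// !mul0r rmorph0 mulr0.
  have := cauchy_schwarz Lf (sq_integrable_nadjoint (IH n)).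
  rewrite -e1 normc_real ger0_norm ?sqnorm_ge0// => h1.
  have h2 := nadjoint_schur (IH n) (LH n).
  have F0 := sqnorm_ge0 leb f; have N0 := sqnorm_ge0 ar (H n).
  have h3 := le_trans h1 (ler_wpM2l F0 h2).
  (* [h3] bounds the square of [sqnorm ar (H n)] by a multiple of itself, and one factor is divided
     out when it is nonzero. *)
  have [N1|N1] := leP (sqnorm ar (H n)) 0.
    by apply: le_trans N1 _; rewrite !mulr_ge0// sqrtr_ge0.
  by rewrite -(ler_pM2r N1) -expr2; apply: le_trans h3 _; rewrite mulrCA mulrA.
apply: sq_integrableE => //.
apply: (@le_lt_trans _ _ (2 * Num.sqrt 2 * sqnorm leb f)%:E); last exact: ltry.
have lim p : limn (fun n => (normc (H n p) ^+ 2)%:E) = (normc (nbargmann f p) ^+ 2)%:E.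
  apply/cvg_lim => //; apply: cvg_near_cst; have [n Hn] := covE p.
  by exists n => // m /= nm; rewrite HE indicE mem_set ?mul1r//; exact: Hn.
have -> : (\int[ar]_p (normc (nbargmann f p) ^+ 2)%:E =
    limn (fun n => \int[ar]_p (normc (H n p) ^+ 2)%:E))%E.
  rewrite -monotone_convergence//.
  - by apply: eq_integral => p _; rewrite lim.
  - by move=> n; apply/measurable_EFinP/measurable_normc_sqr.
  - by move=> n p _; rewrite lee_fin sqr_ge0.
  move=> p _ m n mn; rewrite lee_fin !HE ler_wpM2r ?sqr_ge0// !indicE ler_nat.
  by case: (boolP (p \in E m)) => // pm; rewrite mem_set//; apply: (ndE m n mn); rewrite inE in pm.
apply: lime_le.
  apply: ereal_nondecreasing_is_cvgn => m n mn; apply: ge0_le_integral => //.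
  - by move=> p _; rewrite lee_fin sqr_ge0.
  - by apply/measurable_EFinP/measurable_normc_sqr.
  - by apply/measurable_EFinP/measurable_normc_sqr.
  move=> p _; rewrite lee_fin !HE ler_wpM2r ?sqr_ge0// !indicE ler_nat.
  by case: (boolP (p \in E m)) => // pm; rewrite mem_set//; apply: (ndE m n mn); rewrite inE in pm.
by apply: nearW => n; rewrite sqnormE// lee_fin.
Qed.

Lemma fockP F : fock F <-> holomorphic F /\ sq_integrable ar (weighted F).
Proof.
have E p : normc (weighted F p) ^+ 2 = pi^-1 * (normc (F (tc p)) ^+ 2 * expR (- normc (tc p) ^+ 2)).
  rewrite /weighted normcM normc_real exprMn real_normK ?num_real// fock_weight_sqr /gaussc; ring.
have pi1 : 0 <= pi^-1 :> R by rewrite invr_ge0 pi_ge0.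
have EI : holomorphic F -> (pi^-1%:E * \int[ar]_p (normc (F (tc p)) ^+ 2 * expR (- normc (tc p) ^+ 2))%:E =
    \int[ar]_p (normc (weighted F p) ^+ 2)%:E)%E.
  move=> hF; rewrite -ge0_integralZl//.
  - by apply: eq_integral => p _; rewrite E EFinM.
  - apply/measurable_EFinP; apply: measurable_funM; last exact: measurable_gaussc.
    apply: measurable_normc_sqr; exact: (ccontinuous_cmeasurable (holomorphic_ccontinuous hF)).
  by move=> p _; rewrite lee_fin mulr_ge0 ?sqr_ge0// expR_ge0.
split=> [[/entireP hF h]|[hF h]]; split => //.
- apply: sq_integrableE; first exact: cmeasurable_weighted.
  by rewrite -EI.
- exact/entireP.
- by have := sq_integrable_lty h; rewrite -EI.
Qed.

Lemma fock_innerE F G : fock F -> fock G -> fock_inner F G = inner ar (weighted F) (weighted G).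
Proof.
move=> /fockP[hF LF] /fockP[hG LG].
have pi0 : (pi : R) != 0 by rewrite gt_eqF// pi_gt0.
have I := inner_cintegrable LF LG.
rewrite /fock_inner.
have -> : cintegral ar (fun p => let z := p.1 +i* p.2 in F z * (G z)^* * (expR (- normc z ^+ 2))%:C) =
    cintegral ar (fun p => pi%:C * (weighted F p * (weighted G p)^*)).
  apply: eq_cintegral => p; rewrite /weighted -/(tc p) /=.
  have -> : (expR (- normc (tc p) ^+ 2))%:C = pi%:C * ((fock_weight (tc p))%:C * (fock_weight (tc p))%:C) :> R[i].
    rewrite -!rmorphM; congr (_%:C); rewrite -expr2 fock_weight_sqr mulrC divfK//.
  have -> : Num.conj ((fock_weight (tc p))%:C * G (tc p)) = (fock_weight (tc p))%:C * (G (tc p))^*.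
    by rewrite rmorphM; congr (_ * _); exact: conjc_real.
  by move: (fock_weight _)%:C (F _) (Num.conj _) => w x y; ring.
rewrite cintegralZl// mulrA -rmorphM mulVf// rmorph1 mul1r.
by [].
Qed.

Lemma sq_integrable_rkernel q : sq_integrable ar (fun p => rkernel p q).
Proof.
have mk := cmeasurable_rkernel q.
split => //.
apply: (le_integrable_real _ (integrableZl_real pi^-1 (integrable_normc_rkernel q))).
  exact: measurable_normc_sqr.
by move=> p; rewrite ger0_norm ?sqr_ge0// expr2 ler_wpM2r ?normc_ge0// rkernel_le.
Qed.

(** In [reproducing], half of the Gaussian in [z] is supplied by [weighted F] and half by the
    kernel; the half Gaussian in [w] that remains in the kernel becomes the weight of the value at
    [q]. *)
Lemma weighted_reproducing F q : holomorphic F -> sq_integrable ar (weighted F) ->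
  inner ar (weighted F) (fun p => rkernel p q) = weighted F q.
Proof.
move=> hF LF; have pi0 : (pi : R) != 0 by rewrite gt_eqF// pi_gt0.
have I := inner_cintegrable LF (sq_integrable_rkernel q).
set w := tc q.
have E p : weighted F p * (rkernel p q)^* = (fock_weight w / pi)%:C *
   (F (tc p) * (cexp (w * (tc p)^*) * (gaussc (tc p))%:C)).
  have i2 : (2^-1 : R[i]) = (2^-1 : R)%:C by rewrite fmorphV rmorph_nat.
  have -> : Num.conj (rkernel p q) = pi^-1%:C * cexp (w * (tc p)^* - tc p * (tc p)^* / 2 - w * w^* / 2).
    rewrite /rkernel rmorphM -/w; congr (_ * _).
      exact: conjc_real.
    rewrite [LHS](esym (cexp_conj _)); congr cexp.
    by rewrite i2; apply: complex_eq; rewrite !(cReD, cReN, cReM, cImD, cImN, cImM, cReJ, cImJ) /=; ring.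
  have -> : (fock_weight w / pi)%:C = (fock_weight w)%:C * pi^-1%:C by rewrite rmorphM.
  rewrite /weighted !fock_weightE gausscE.
  have -> : cexp (w * (tc p)^* - tc p * (tc p)^* / 2 - w * w^* / 2) =
     cexp (w * (tc p)^*) * cexp (- (tc p * (tc p)^*) / 2) * cexp (- (w * w^*) / 2).
    by rewrite -!cexpD; congr cexp; rewrite !mulNr.
  have -> : cexp (- (tc p * (tc p)^*)) = cexp (- (tc p * (tc p)^*) / 2) * cexp (- (tc p * (tc p)^*) / 2).
    by rewrite -cexpD; congr cexp; field.
  by move: (cexp _) (cexp _) (cexp _) (F _) (_^-1)%:C (_^-1)%:C => *; ring.
have w0 : fock_weight w / pi != 0 by rewrite mulf_neq0 ?invr_eq0// gt_eqF// fock_weight_gt0.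
have I' : cintegrable ar (fun p => F (tc p) * (cexp (w * (tc p)^*) * (gaussc (tc p))%:C)).
  have := cintegrableZl (fock_weight w / pi)^-1%:C I; congr cintegrable; apply/funext => p.
  by rewrite E mulrA -rmorphM mulVf// rmorph1 mul1r.
rewrite /inner; under eq_cintegral do rewrite E.
by rewrite cintegralZl// reproducing// mulrA -rmorphM divfK.
Qed.

(* u is the limit of S^* applied to truncations of F, and S S^* / sqrt 2 is the integral operator of the
   reproducing kernel, which fixes F. *)
Theorem fock_surjective F : holomorphic F -> sq_integrable ar (weighted F) ->
  exists2 u, sq_integrable leb u &
   (forall p, nbargmann u p = (Num.sqrt 2)%:C * weighted F p) /\
   forall h, sq_integrable leb h -> inner ar (nbargmann h) (weighted F) = inner leb h u.
Proof.
move=> hF LW; set W := weighted F in LW *.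
have [E [mE Eoo ndE covE]] := area_exhaustion.
have [LH H0] := sqnorm_truncate LW mE covE.
set H := fun n p => (\1_(E n) p)%:C * W p.
have IH n : cintegrable ar (H n) by exact: truncation_cintegrable.
pose e n := 2 * Num.sqrt 2 * sqnorm ar (fun p => H n p - W p).
have e0 : e n @[n --> \oo] --> (0 : R).
  by rewrite -[X in _ --> X](mulr0 (2 * Num.sqrt 2)); apply: cvgM => //; exact: cvg_cst.
have Lu n := sq_integrable_nadjoint (IH n).
have nadjB m n v : nadjoint (H n) v - nadjoint (H m) v = nadjoint (fun p => H n p - H m p) v.
  rewrite /nadjoint -cintegralB; [|exact: nkernelH_cintegrable..].
  by apply: eq_cintegral => p; rewrite mulrBr.
(* The sets increase, so [H n - H m] is pointwise at most [H m - W] in modulus, and the bound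
   depends on [m] alone. *)
have ue m n : (m <= n)%N -> sqnorm leb (fun v => nadjoint (H n) v - nadjoint (H m) v) <= e m.
  move=> mn; under [X in sqnorm leb X]eq_fun do rewrite nadjB.
  have Lnm := sq_integrableB (LH n) (LH m).
  apply: le_trans (nadjoint_schur (cintegrableB (IH n) (IH m)) Lnm) _.
  rewrite ler_wpM2l ?mulr_ge0 ?sqrtr_ge0//.
  have [_ I1] := Lnm; have [_ I2] := sq_integrableB (LH m) LW.
  apply: le_Rintegral => // p _; rewrite ler_pXn2r ?nnegrE ?normc_ge0//.
  rewrite /H !indicE; case: (boolP (p \in E m)) => pm.
    rewrite mem_set; last by apply: (ndE m n mn); rewrite inE in pm.
    by rewrite !mul1r !subrr.
  case: (_ \in _); rewrite ?mul1r !mul0r ?sub0r ?subr0 ?normcN//.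
  by rewrite normc0 normc_ge0.
have [u Lu' uP] := riesz_fischer Lu e0 ue.
have u0 : sqnorm leb (fun v => nadjoint (H n) v - u v) @[n --> \oo] --> (0 : R).
  apply: (@squeeze_cvgr _ _ _ _ (cst 0) (fun n => 2 * e n)); last 2 first.
  - exact: cvg_cst.
  - by rewrite -[X in _ --> X](mulr0 2); apply: cvgM => //; exact: cvg_cst.
  by apply: nearW => n; rewrite sqnorm_ge0 uP.
exists u => //; split.
  move=> q.
  have k1 := inner_cvg Lu Lu' (sq_integrable_nkernelJ q) u0.
  have k2 := inner_cvg LH LW (sq_integrable_rkernel q) H0.
  (* Both sides are now inner products with fixed square-integrable functions, so convergence in
     norm gives convergence at the point [q]. *)
  rewrite nbargmann_inner /W -weighted_reproducing// -/W.
  apply: (normc_cvg_unique k1).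
  have k3 : Num.sqrt 2 * normc (inner ar (H n) (fun p => rkernel p q) -
      inner ar W (fun p => rkernel p q)) @[n --> \oo] --> (0 : R).
    by rewrite -[X in _ --> X](mulr0 (Num.sqrt 2)); apply: cvgM => //; exact: cvg_cst.
  apply: (eq_seq_cvg _ k3) => n.
  by rewrite -nbargmann_inner (nbargmann_nadjoint q (IH n)) -mulrBr [RHS]normcM normc_real ger0_norm.
move=> h Lh; have LS := sq_integrable_nbargmann Lh.
rewrite innerJ// [RHS]innerJ//; congr (_^*).
have k1 := inner_cvg Lu Lu' Lh u0.
have k2 := inner_cvg LH LW LS H0.
apply: (normc_cvg_unique k2).
apply: (eq_seq_cvg _ k1) => n.
have LA := Lu n; have LHn := LH n.
rewrite (innerJ Lh LA) -(nadjointP Lh (IH n)) [in RHS](innerJ LS LHn).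
by [].
Qed.

End bargmann_kernel.

(** * Injectivity of the Laplace transform *)

Section laplace_injectivity.
Variable R : realType.
Local Notation leb := (@lebesgue_measure R).
Local Notation mR := (measurableTypeR R).
Implicit Types (g : mR -> R[i]) (z w : R[i]).

(** Centred at [al]: its modulus is at most 1 on the right of [al] if [Im z >= 0] and on the left if
    [Im z <= 0], and it is 1 at [z = 0]. *)
Let phase (al : R) z (v : R) : R[i] := cexp ('i * z * (v - al)%:C).

Let normc_phase al z v : normc (phase al z v) = expR (- (cIm z * (v - al))).
Proof.
rewrite normc_cexp; congr expR; rewrite !(cReM, cImM) /=.
by rewrite !(mul0r, mulr0, mul1r, add0r, subr0, sub0r); ring.
Qed.

Let cmeasurable_phase al z : cmeasurable (phase al z : mR -> R[i]).
Proof.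
apply: cmeasurable_cexp; apply: cmeasurableM; first exact: cmeasurable_cst.
apply: cmeasurable_real; apply: measurable_funB; first exact: measurable_id.
exact: measurable_cst.
Qed.

Let null_point (P : mR -> Prop) (al : R) : (forall v, v != al -> P v) -> {ae leb, forall v, P v}.
Proof.
move=> H; exists [set al]; split; first exact: measurable_set1.
  exact: lebesgue_measure_set1.
by move=> v /= nP; apply/eqP; apply: contra_notT nP; exact: H.
Qed.

Section half_line.
Variables (al : R) (g : mR -> R[i]).
Hypothesis Ig : cintegrable leb g.

(** The sign condition treats both half lines at once: support on the right of [al] with
    [Im z >= 0], or on the left with [Im z <= 0]. *)
Lemma half_line_bound z : (forall v, g v != 0 -> 0 <= cIm z * (v - al)) ->
  normc (cintegral leb (fun v => phase al z v * g v)) <= \int[leb]_v normc (g v).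
Proof.
move=> zg; have mg := cintegrable_measurable Ig.
apply: normc_cintegral_le.
- by apply: cmeasurableM.
- exact: integrable_normc.
move=> v; have [->|gv] := eqVneq (g v) 0; first by rewrite mulr0 normc0.
rewrite [leLHS]normcM normc_phase ler_piMl ?normc_ge0// -[leRHS]expR0 ler_expR oppr_le0.
exact: zg.
Qed.

Lemma half_line_decay z : (forall v, g v != 0 -> v != al -> 0 < cIm z * (v - al)) ->
  normc (cintegral leb (fun v => phase al (n%:R * z) v * g v)) @[n --> \oo] --> (0 : R).
Proof.
move=> zg; have mg := cintegrable_measurable Ig.
have cn n : cIm (n%:R * z) = n%:R * cIm z.
  by rewrite -(rmorph_nat (real_complex R)) cImM /= mul0r addr0.
have bnd n v : normc (phase al (n%:R * z) v * g v) <= normc (g v).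
  have [->|gv] := eqVneq (g v) 0; first by rewrite mulr0 normc0.
  rewrite [leLHS]normcM normc_phase ler_piMl ?normc_ge0// -[leRHS]expR0 ler_expR oppr_le0 cn.
  have [->|va] := eqVneq v al; first by rewrite subrr mulr0.
  by rewrite -mulrA mulr_ge0// ltW// zg.
have := @cintegral_cvg _ _ R leb (fun n v => phase al (n%:R * z) v * g v) (fun=> 0)
  (fun v => normc (g v)).
rewrite cintegral0 => h.
have {h} := h _ _ (integrable_normc Ig) bnd.
under eq_cvg do rewrite subr0; apply.
- by move=> n; apply: cmeasurableM.
- exact: cmeasurable_cst.
- by move=> v; rewrite normc0 normc_ge0.
(* At [v = al] the phase has modulus 1 for every [n]; at the other points of the support it decays
   geometrically. *)
apply: (@null_point _ al) => v va.
have [->|gv] := eqVneq (g v) 0.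
  by apply: cvg_near_cst; apply: nearW => n; rewrite mulr0 subr0 normc0.
set x := cIm z * (v - al); have x0 : 0 < x by exact: zg.
have : expR (- x) ^+ n * normc (g v) @[n --> \oo] --> (0 : R).
  rewrite -[X in _ --> X](mul0r (normc (g v))); apply: cvgM; last exact: cvg_cst.
  by apply: cvg_expr; rewrite ger0_norm ?expR_ge0// -expR0 ltr_expR oppr_lt0.
apply: eq_seq_cvg => n.
by rewrite subr0 [RHS]normcM normc_phase cn -expRM_natl -mulrA mulrN.
Qed.

End half_line.

Section exp_integrable_half_line.
Variables (g : mR -> R[i]) (al : R).
Hypotheses (eg : exp_integrable g) (g0 : forall z, laplace g z = 0).

Let lo (v : mR) : R[i] := (\1_(`]-oo, al]%classic : set R) v)%:C * g v.
Let hi (v : mR) : R[i] := (\1_(`]al, +oo[%classic : set R) v)%:C * g v.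

Let exp_integrable_part (A : set mR) : measurable A -> exp_integrable (fun v => (\1_A v)%:C * g v).
Proof.
move=> mA; have [mg _] := eg; apply: (exp_integrable_le _ eg).
  by apply: cmeasurableM => //; apply: cmeasurable_real; exact: measurable_indic.
move=> v; rewrite normcM normc_real indicE; case: (_ \in _).
  by rewrite normr1 mul1r.
by rewrite normr0 mul0r normc_ge0.
Qed.

Let elo : exp_integrable lo. Proof. by apply: exp_integrable_part; exact: measurable_itv. Qed.
Let ehi : exp_integrable hi. Proof. by apply: exp_integrable_part; exact: measurable_itv. Qed.

Let cint h : exp_integrable h -> cintegrable leb h.
Proof.
move=> eh; have := laplace_cintegrable 0 eh; congr cintegrable; apply/funext => v.
by rewrite mul0r cexp0 mul1r.
Qed.

(* E is bounded in each closed half plane, the upper one by [E_hi], and tends to 0 along every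
   nonreal ray; being entire it vanishes at 0, as its mean over circles of radius n. *)
Let E z : R[i] := cintegral leb (fun v => phase al z v * lo v).

Let partE h z : exp_integrable h -> cintegral leb (fun v => phase al z v * h v) =
  cexp ('i * z * (- al)%:C) * laplace h ('i * z).
Proof.
move=> eh; rewrite /laplace -cintegralZl; last exact: laplace_cintegrable.
apply: eq_cintegral => v; rewrite [RHS]mulrA -cexpD; congr (cexp _ * _).
by rewrite -mulrDr -rmorphD addrC.
Qed.

Let E_hi z : E z = - cintegral leb (fun v => phase al z v * hi v).
Proof.
apply/eqP; rewrite -addr_eq0 /E !partE// -mulrDr.
have -> : laplace lo ('i * z) + laplace hi ('i * z) = laplace g ('i * z).
  rewrite /laplace -cintegralD; [|exact: laplace_cintegrable..].
  apply: eq_cintegral => v; rewrite /lo /hi -mulrDr -mulrDl; congr (_ * _).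
  rewrite -[RHS]mul1r; congr (_ * _); rewrite -rmorphD !indicE !mem_setE !in_itv /= andbT.
  by case: leP => _; rewrite ?addr0 ?add0r.
by rewrite g0 mulr0.
Qed.

Let holomorphic_E : holomorphic E.
Proof.
have -> : E = fun z => cexp (('i * (- al)%:C) * z + 0) * laplace lo ('i * z + 0).
  by apply/funext => z; rewrite /E partE// !addr0; congr (cexp _ * _); rewrite mulrAC.
apply: (@holomorphicM R (fun z => cexp _) (fun z => laplace _ _)).
  exact: (holomorphic_comp (holomorphic_cexp R) (holomorphic_affine _ _)).
exact: (holomorphic_comp (laplace_holomorphic elo) (holomorphic_affine _ _)).
Qed.

Let lo_le v : lo v != 0 -> v <= al.
Proof.
by rewrite /lo indicE mem_setE in_itv /=; case: (v <= al) => //; rewrite mul0r eqxx.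
Qed.

Let hi_gt v : hi v != 0 -> al < v.
Proof.
by rewrite /hi indicE mem_setE in_itv /= andbT; case: (al < v) => //; rewrite mul0r eqxx.
Qed.

Let nrm := \int[leb]_v normc (lo v) + \int[leb]_v normc (hi v).

Let E_bound z : normc (E z) <= nrm.
Proof.
have p1 : 0 <= \int[leb]_v normc (lo v) by apply: Rintegral_ge0 => v _; exact: normc_ge0.
have p2 : 0 <= \int[leb]_v normc (hi v) by apply: Rintegral_ge0 => v _; exact: normc_ge0.
have [z0|z0] := leP 0 (cIm z).
  rewrite E_hi normcN; apply: le_trans (half_line_bound (cint ehi) _) _.
    by move=> v /hi_gt av; rewrite mulr_ge0// subr_ge0 ltW.
  by rewrite lerDr.
apply: le_trans (half_line_bound (cint elo) _) _; last by rewrite lerDl.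
by move=> v /lo_le va; rewrite mulr_le0 ?subr_le0// ltW.
Qed.

Let E_decay z : cIm z != 0 -> normc (E (n%:R * z)) @[n --> \oo] --> (0 : R).
Proof.
have [z0 _|z0 _|//] := ltgtP (cIm z) 0.
  apply: (half_line_decay (cint elo)) => v /lo_le va nva.
  by rewrite nmulr_rgt0// subr_lt0 lt_neqAle nva.
apply: (eq_seq_cvg _ (@half_line_decay al hi (cint ehi) z _)).
  by move=> n; rewrite E_hi normcN.
by move=> v /hi_gt va _; rewrite mulr_gt0// subr_gt0.
Qed.

Let E0 : E 0 = 0.
Proof.
have cm n := circle_mean n%:R holomorphic_E.
have bE n := circle_bounded01 n%:R holomorphic_E.
have := @cintegral_cvg _ _ R leb (fun n t => (chi01 t)%:C * E (n%:R * turn t)) (fun=> 0)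
  (fun t => nrm * chi01 t).
rewrite cintegral0.
have cE n : cintegral leb (fun t => (chi01 t)%:C * E (n%:R * turn t)) = E 0 by exact: cm.
under eq_cvg do rewrite cE subr0.
have N0 : 0 <= nrm := le_trans (normc_ge0 _) (E_bound 0).
move=> h; apply/eq0_normc.
suff : normc (E 0) @[n --> \oo] --> (0 : R).
  by move=> k; have := @cvg_unique _ (@Rhausdorff R) _ _ _ _ (cvg_cst (normc (E 0))) k; apply.
apply: h.
- by move=> n; apply: cmeasurable_chi01; case: (bE n).
- exact: cmeasurable_cst.
- exact: integrable_chi01.
- by move=> n; apply: chi01_le => t _; exact: E_bound.
- by move=> t; rewrite normc0 mulr_ge0// chi01_ge0.
(* These parameters are the two real points of the circle, on whose rays no decay of [E] is
   available. *)
have : leb.-negligible ([set 0; 2^-1] : set R).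
  exists [set 0; 2^-1]; split => //.
    by apply: measurableU; exact: measurable_set1.
  apply/countable_lebesgue_measure0/finite_set_countable.
  by rewrite finite_setU; split; exact: finite_set1.
apply: negligibleS => t nP; apply: contrapT => n2; apply: nP.
have t0 : t != 0 by apply/eqP => e; apply: n2; left.
have t1 : t != 2^-1 by apply/eqP => e; apply: n2; right.
have [t01|t01] := boolP (0 <= t < 1); last first.
  by apply: cvg_near_cst; apply: nearW => n; rewrite /chi01 (negbTE t01) mul0r subr0 normc0.
have s0 : cIm (turn t) != 0.
  move: t01 => /andP[t_ge0 t_lt1]; have p0 := pi_gt0 R.
  have {}t0 : 0 < t by rewrite lt_neqAle eq_sym t0.
  rewrite /=; have [t2|t2] := ltP t 2^-1.
    rewrite gt_eqF// sin_gt0_pi// mulr_gt0 ?mulr_gt0//=.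
    by rewrite -mulrA mulrCA gtr_pMr//; lra.
  have {}t2 : 2^-1 < t by rewrite lt_neqAle eq_sym t1.
  have -> : 2 * pi * t = 2 * pi * (t - 2^-1) + pi by field.
  rewrite sinDpi oppr_eq0 gt_eqF// sin_gt0_pi// mulr_gt0 ?mulr_gt0//= ?subr_gt0//.
  by rewrite -mulrA mulrCA gtr_pMr//; lra.
have := E_decay s0; apply: eq_seq_cvg => n.
by rewrite /chi01 t01 mul1r subr0.
Qed.

Lemma laplace_eq0_half_line : cintegral leb lo = 0.
Proof.
rewrite -[RHS]E0 /E; apply: eq_cintegral => v.
by rewrite /phase mulr0 mul0r cexp0 mul1r.
Qed.

End exp_integrable_half_line.

(** Almost everywhere [h] is the derivative of its primitive from minus infinity, here the constant
    0. *)
Lemma half_line_integral_eq0 (h : mR -> R) : leb.-integrable setT (fun v => (h v)%:E) ->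
  (forall x : R, \int[leb]_(v in `]-oo, x]) h v = 0) -> {ae leb, forall v, h v = 0}.
Proof.
move=> Ih h0.
have := @FTC1Ny R h.
have I1 (y : R) : leb.-integrable `]-oo, y] (EFin \o h).
  by apply: (integrableS measurableT).
have I2 : locally_integrable [set: R] h by apply: open_integrable_locally => //; exact: openT.
move=> /(_ I1 I2) /=.
rewrite (_ : (fun x : R => \int[leb]_(t in `]-oo, x]) h t) = cst 0); last by apply/funext => x; rewrite h0.
apply: filterS; first exact: (ae_filter_ringOfSetsType leb).
by move=> x [_ <-]; rewrite derive1_cst.
Qed.

Theorem laplace_injective g : exp_integrable g -> (forall z, laplace g z = 0) ->
  {ae leb, forall v, g v = 0}.
Proof.
move=> eg g0.
have Ig : cintegrable leb g.
  have := laplace_cintegrable 0 eg; congr cintegrable; apply/funext => v.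
  by rewrite mul0r cexp0 mul1r.
have lo0 x := laplace_eq0_half_line x eg g0.
have [I1 I2] := Ig.
have H1 : {ae leb, forall v, cRe (g v) = 0}.
  apply: half_line_integral_eq0 => // x.
  transitivity (cRe (cintegral leb (fun v : mR => (\1_(`]-oo, x]%classic : set R) v)%:C * g v))); last by rewrite lo0.
  rewrite /= Rintegral_mkcond; apply: eq_Rintegral => v _.
  by rewrite patchE indicE cReM /= mul0r subr0; case: (_ \in _); rewrite ?mul1r ?mul0r.
have H2 : {ae leb, forall v, cIm (g v) = 0}.
  apply: half_line_integral_eq0 => // x.
  transitivity (cIm (cintegral leb (fun v : mR => (\1_(`]-oo, x]%classic : set R) v)%:C * g v))); last by rewrite lo0.
  rewrite /= Rintegral_mkcond; apply: eq_Rintegral => v _.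
  by rewrite patchE indicE cImM /= mul0r addr0; case: (_ \in _); rewrite ?mul1r ?mul0r.
apply: filterS2 H1 H2 => v r0 i0; exact: complex_eq.
Qed.

End laplace_injectivity.

(** * Transforms of the Hermite functions *)

Section hermite_functions.
Variable R : realType.
Local Notation leb := (@lebesgue_measure R).
Local Notation mR := (measurableTypeR R).
Implicit Types (z w : R[i]) (p : {poly R}).

Lemma deriv_hermite (K : nzRingType) n : (hermite K n.+1)^`() = hermite K n *+ (2 * n.+1).
Proof.
elim: n => [|n IH].
  by rewrite /= mulr1 -polyC1 derivC subr0 derivMn derivX.
have -> : hermite K n.+2 = ('X * hermite K n.+1) *+ 2 - (hermite K n.+1)^`() by [].
rewrite derivB derivMn derivM derivX mul1r IH derivMn mulrnDl mulrnAr -addrA mulrnAC -mulrnBl.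
have -> : ('X * hermite K n) *+ 2 - (hermite K n)^`() = hermite K n.+1 by [].
by rewrite -mulrnDr; congr (_ *+ _); lia.
Qed.

(* [exp (- (1/4) d^2/dz^2) z^n]: multiplication by z is conjugated by this operator to
   [z - (1/2) d/dz]. *)
Fixpoint heat_poly (K : fieldType) n : {poly K} :=
  if n is m.+1 then 'X * heat_poly K m - 2^-1 *: (heat_poly K m)^`() else 1.

(** The counterpart of [deriv_hermite]: both families are, up to scaling, lowered by
    differentiation, and both defining recurrences become three-term recurrences of the same
    shape. *)
Lemma deriv_heat_poly (K : numFieldType) n : (heat_poly K n.+1)^`() = n.+1%:R *: heat_poly K n.
Proof.
elim: n => [|n IH].
  by rewrite /= mulr1 -polyC1 derivC scaler0 subr0 derivX scale1r.
have -> : heat_poly K n.+2 = 'X * heat_poly K n.+1 - 2^-1 *: (heat_poly K n.+1)^`() by [].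
rewrite derivB derivM derivX mul1r derivZ IH derivZ -addrA -scalerAr [2^-1 *: _]scalerA.
rewrite [2^-1 * _]mulrC -scalerA -scalerBr.
rewrite -[X in X + _]scale1r.
have -> : 'X * heat_poly K n - 2^-1 *: (heat_poly K n)^`() = heat_poly K n.+1 by [].
by rewrite -scalerDl nat1r.
Qed.

Lemma heat_poly_recurrence (K : numFieldType) n :
  heat_poly K n.+2 = 'X * heat_poly K n.+1 - (n.+1%:R / 2) *: heat_poly K n.
Proof.
have -> : heat_poly K n.+2 = 'X * heat_poly K n.+1 - 2^-1 *: (heat_poly K n.+1)^`() by [].
by rewrite deriv_heat_poly scalerA [2^-1 * _]mulrC.
Qed.

(** The [k]-th term of [heat_monomial n z] divided by [sqrt (n!)], extended by 0 beyond [n / 2] so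
    that sums for different [n] can share one range. *)
Let b n k z : R[i] := if (2 * k <= n)%N then
  ((- 4^-1) ^+ k / (k`!%:R * (n - 2 * k)`!%:R))%:C * z ^+ (n - 2 * k) else 0.

Let h n z := \sum_(0 <= k < n./2.+1) b n k z.

Let h_ext n N z : (n./2 < N)%N -> h n z = \sum_(0 <= k < N) b n k z.
Proof.
move=> nN; rewrite (@big_cat_nat _ _ _ n./2.+1 0 N)//= [X in _ + X]big_nat_cond [X in _ + X]big1 ?addr0//.
move=> k; rewrite andbT => /andP[nk _]; rewrite /b ifN// -ltnNge; lia.
Qed.

(** Write [n + 2 = (n + 2 - 2 k) + 2 k]. The first summand cancels in [(n + 2 - 2 k)!] and gives
    [z * b n.+1 k z]; the second cancels in [k!] and gives [- 1/2] times the term of index [k - 1],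
    as [2 * (- 1/4) = - 1/2]. *)
Let b_rec n k z : n.+2%:R * b n.+2 k z = z * b n.+1 k z - (if k is j.+1 then b n j z else 0) / 2.
Proof.
have f0 m : m`!%:R != 0 :> R by rewrite pnatr_eq0 -lt0n fact_gt0.
have combine (r c1 c2 c3 : R) m : r * c1 = c2 - c3 / 2 ->
    r%:C * (c1%:C * z ^+ m.+1) = z * (c2%:C * z ^+ m) - c3%:C * z ^+ m.+1 / 2.
  move=> E; transitivity ((r * c1)%:C * z ^+ m.+1); first by rewrite rmorphM mulrA.
  rewrite E rmorphB rmorphM fmorphV rmorph_nat /= exprS; ring.
have nC m : m%:R = (m%:R : R)%:C :> R[i] by rewrite rmorph_nat.
case: k => [|j]; rewrite /b.
  rewrite muln0 !subn0 /= mul0r subr0 expr0 fact0 nC.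
  rewrite (combine _ _ (1 / (1%:R * n.+1`!%:R)) 0).
    by rewrite (_ : 0%:C = 0 :> R[i])// !mul0r subr0.
  by rewrite !mul1r mul0r subr0 factS natrM invfM mulrA mulfV ?mul1r ?pnatr_eq0.
have [kn|nk] := leqP (2 * j.+1) n.+1.
  have [m mE] : exists m, n.+1 = (2 * j.+1 + m)%N by exists (n.+1 - 2 * j.+1)%N; lia.
  have -> : (2 * j.+1 <= n.+2)%N by lia.
  have -> : (2 * j <= n)%N by lia.
  have -> : (n.+2 - 2 * j.+1 = m.+1)%N by lia.
  have -> : (n.+1 - 2 * j.+1 = m)%N by lia.
  have -> : (n - 2 * j = m.+1)%N by lia.
  rewrite nC; apply: combine.
  have -> : n.+2 = (2 * j.+1 + m.+1)%N by lia.
  rewrite !factS !natrM exprS natrD natrM; field.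
  by rewrite !f0 !nat1r !pnatr_eq0.
have [kn|kn] := eqVneq (2 * j.+1)%N n.+2.
  have -> : (2 * j <= n)%N by lia.
  have -> : (n - 2 * j = 0)%N by lia.
  have cM (x y : R) : x%:C * y%:C = (x * y)%:C by rewrite rmorphM.
  have cN (x : R) : - x%:C = (- x)%:C by rewrite rmorphN.
  have i2 : 2^-1 = (2^-1 : R)%:C :> R[i] by rewrite fmorphV rmorph_nat.
  rewrite -kn leqnn subnn expr0 !mulr1 mulr0 sub0r nC i2 !cM cN; congr (_%:C).
  rewrite factS exprS !natrM; field.
  by rewrite !f0 !nat1r !pnatr_eq0.
rewrite ifN; last by lia.
by rewrite ifN ?mulr0 ?mul0r ?subr0//; lia.
Qed.

Let h_rec n z : n.+2%:R * h n.+2 z = z * h n.+1 z - h n z / 2.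
Proof.
rewrite (@h_ext n.+2 n.+3) ?(@h_ext n.+1 n.+3) ?(@h_ext n n.+2)//; [|lia..].
rewrite [X in _ = _ - X]mulr_suml !mulr_sumr.
rewrite (eq_bigr (fun k => z * b n.+1 k z - (if k is j.+1 then b n j z else 0) / 2)); last first.
  by move=> k _; rewrite b_rec.
rewrite big_split /=; congr (_ + _).
rewrite sumrN; congr (- _).
by rewrite [LHS]big_nat_recl//= mul0r add0r.
Qed.

Lemma heat_monomialE n z : heat_monomial n z = (Num.sqrt n`!%:R)^-1%:C * (heat_poly R[i] n).[z].
Proof.
have f0 m : m`!%:R != 0 :> R by rewrite pnatr_eq0 -lt0n fact_gt0.
have H m : (heat_poly R[i] m).[z] = m`!%:R * h m z /\ (heat_poly R[i] m.+1).[z] = m.+1`!%:R * h m.+1 z.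
  elim: m => [|m [IH1 IH2]].
    split.
      by rewrite /h /b big_nat1 /= hornerC !expr0 fact0 !mul1r invr1 rmorph1 mul1r.
    rewrite /h /b big_nat1 /= mulr1 -polyC1 derivC scaler0 subr0 hornerX expr1 expr0.
    have -> : (1 - 2 * 0)`! = 1%N by [].
    by rewrite fact0 !mul1r invr1 rmorph1 mul1r.
  split => //; rewrite heat_poly_recurrence hornerD hornerN hornerZ hornerM hornerX IH1 IH2.
  transitivity (m.+1`!%:R * (m.+2%:R * h m.+2 z)); last first.
    by rewrite mulrA -natrM mulnC -factS.
  rewrite h_rec factS natrM; ring.
have [-> _] := H n.
rewrite /heat_monomial /h !mulr_sumr; apply: eq_big_nat => k /andP[_ kn].
have k2 : (2 * k <= n)%N by lia.
rewrite /b k2 !mulrA; congr (_ * _).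
rewrite -(rmorph_nat (real_complex R)) -!rmorphM; congr (_%:C).
have s2 : n`!%:R = Num.sqrt n`!%:R * Num.sqrt n`!%:R :> R by rewrite -expr2 sqr_sqrtr.
have s0 : Num.sqrt n`!%:R != 0 :> R by rewrite gt_eqF// sqrtr_gt0 ltr0n fact_gt0.
have s3 : (Num.sqrt n`!%:R)^-1 * n`!%:R = Num.sqrt n`!%:R :> R.
  by rewrite [X in _ * X]s2 mulrA mulVf// mul1r.
by rewrite s3 mulrAC mulrA.
Qed.

Lemma cdiff_horner (p : {poly R[i]}) z : cdiff (fun w => p.[w]) z p^`().[z].
Proof.
elim/poly_ind: p => [|p c IH].
  have := cdiff_affine 0 0 z; rewrite deriv0 horner0; congr cdiff.
  by apply/funext => w; rewrite horner0 mul0r addr0.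
have hid : cdiff (fun w : R[i] => w) z 1.
  by have := cdiff_affine 1 0 z; congr cdiff; apply/funext => w; rewrite mul1r addr0.
have := cdiff_comp (cdiffM IH hid) (cdiff_affine 1 c (p.[z] * z)).
rewrite derivD derivM derivX derivC addr0 !mulr1 mul1r hornerD hornerM hornerX; congr cdiff.
by apply/funext => w; rewrite hornerD hornerM hornerX hornerC mul1r.
Qed.

Lemma exp_integrable_poly p : exp_integrable (fun u : mR => (p.[u] * gauss 2 u)%:C).
Proof.
have [C pC] := poly_le_expR p.
have b0 : 0 < 3 / 2 :> R by rewrite divr_gt0.
have C0 : 0 <= C by have := pC 0; rewrite expr0n mul0r expR0 mulr1; exact: le_trans.
have [mg ig] := exp_integrable_gauss b0.
have eC : exp_integrable (fun u : mR => (C * gauss (3 / 2) u)%:C).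
  split; first by apply: cmeasurable_real; apply: measurable_funM => //; exact: measurable_gauss.
  move=> r; have := integrableZl_real C (ig r); congr integrable; apply/funext => v.
  by rewrite !normc_real normrM (ger0_norm C0) mulrCA.
apply: (exp_integrable_le _ eC).
  apply: cmeasurable_real; apply: measurable_funM; last exact: measurable_gauss.
  by apply: continuous_measurable_fun; exact: continuous_horner.
move=> v; rewrite [leLHS]normc_real [leRHS]normc_real !normrM (ger0_norm C0) !(ger0_norm (expR_ge0 _)).
apply: le_trans (ler_wpM2r (expR_ge0 _) (pC v)) _.
rewrite -mulrA ler_wpM2l// -expRD le_eqVlt; apply/orP; left; apply/eqP.
by congr expR; field.
Qed.

(** The parameter 2 collects two factors [exp (- v^2 / T)], one from [psi] and one from the
    transform, once [v] is scaled by [sqrt T]. *)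
Definition hermite_laplace n w := laplace (fun u : mR => ((hermite R n).[u] * gauss 2 u)%:C) w.

Let kap : R := (2 * Num.sqrt 2)^-1.

(** Multiplication by [u] under the integral is [d/dw], and [deriv_hermite] replaces [H_n'], so the
    Hermite recurrence becomes [2 d/dw] minus [2 n] times the transform of index [n - 1]. On
    [cexp (w^2 / 8)] times a heat polynomial in [kap * w] this is the heat recurrence. The scale
    [kap] inverts the factor in [w = 2 sqrt 2 z], the point where [bargmann_psi] evaluates. *)
Lemma hermite_laplaceE n w : hermite_laplace n w =
  (Num.sqrt (pi / 2))%:C * cexp (w ^+ 2 / 8) * ((Num.sqrt 2) ^+ n)%:C * (heat_poly R[i] n).[kap%:C * w].
Proof.
have s20 : Num.sqrt 2 != 0 :> R by rewrite gt_eqF// sqrtr_gt0.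
have ss : Num.sqrt 2 * Num.sqrt 2 = 2 :> R by rewrite -expr2 sqr_sqrtr.
set A := (Num.sqrt (pi / 2))%:C.
set r2 : R[i] := (Num.sqrt 2)%:C.
have r22 : r2 * r2 = 2 by rewrite -rmorphM ss rmorph_nat.
have kapE : kap%:C = r2 / 4.
  have -> : r2 / 4 = (Num.sqrt 2 / 4)%:C by rewrite rmorphM fmorphV rmorph_nat.
  congr (_%:C); apply: (mulIf s20); rewrite mulrAC ss /kap invfM divfK//.
  by field.
have P0 x : hermite_laplace 0 x = A * cexp (x ^+ 2 / 8).
  rewrite /hermite_laplace /=.
  have -> : (fun u : mR => ((1 : {poly R}).[u] * gauss 2 u)%:C) = (fun u => (gauss 2 u)%:C).
    by apply/funext => u; rewrite hornerC mul1r.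
  rewrite laplace_gauss//; congr (_ * cexp (_ / _)).
  by rewrite !(rmorphM, rmorph_nat) /= -natrM.
have step k x L : cdiff (hermite_laplace k) x L ->
    hermite_laplace k.+1 x = 2 * L - (if k is m.+1 then (2 * m.+1)%:R * hermite_laplace m x else 0).
  move=> dL; have eH := exp_integrable_poly (hermite R k).
  have -> := cdiff_unique dL (laplace_cdiff x eH).
  have eX := exp_integrable_mulX eH.
  have eD := exp_integrable_poly (hermite R k)^`().
  have -> : hermite_laplace k.+1 x = 2 * laplace (fun v => v%:C * ((hermite R k).[v] * gauss 2 v)%:C) x -
      laplace (fun v : mR => ((hermite R k)^`().[v] * gauss 2 v)%:C) x.
    rewrite /hermite_laplace /laplace -cintegralZl; last exact: laplace_cintegrable.
    rewrite -cintegralB; last exact: laplace_cintegrable; last first.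
      by apply: cintegrableZl; exact: laplace_cintegrable.
    apply: eq_cintegral => v; rewrite mulrCA -mulrBr; congr (_ * _).
    rewrite -(rmorph_nat (real_complex R)) -!rmorphM -rmorphB; congr (_%:C).
    by rewrite /= !(hornerE, hornerMn) /=; ring.
  congr (_ - _); case: k {dL eH eX} eD => [|m] eD.
    have -> : (hermite R 0)^`() = 0 by rewrite /= -polyC1 derivC.
    rewrite /laplace -[RHS](cintegral0 leb); apply: eq_cintegral => v.
    by rewrite horner0 mul0r mulr0.
  rewrite /hermite_laplace /laplace -cintegralZl; last exact/laplace_cintegrable/exp_integrable_poly.
  apply: eq_cintegral => v; rewrite deriv_hermite hornerMn mulrCA; congr (_ * _).
  by rewrite -(rmorph_nat (real_complex R)) -rmorphM; congr (_%:C); rewrite -mulr_natl mulrA.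
pose Q k x := A * cexp (x ^+ 2 / 8) * ((Num.sqrt 2) ^+ k)%:C * (heat_poly R[i] k).[kap%:C * x].
have dQ k x : cdiff (Q k) x (A * ((Num.sqrt 2) ^+ k)%:C * cexp (x ^+ 2 / 8) *
     (x / 4 * (heat_poly R[i] k).[kap%:C * x] + kap%:C * (heat_poly R[i] k)^`().[kap%:C * x])).
  have did : cdiff (fun w : R[i] => w) x 1.
    by have := cdiff_affine 1 0 x; congr cdiff; apply/funext => y; rewrite mul1r addr0.
  have dsq : cdiff (fun w : R[i] => w ^+ 2 / 8) x (x / 4).
    have := cdiffM (cdiffM did did) (cdiff_affine 0 8^-1 x).
    rewrite (_ : _ + _ = x / 4); last by field.
    by congr cdiff; apply/funext => y; rewrite mul0r add0r expr2.
  have dk : cdiff (fun w : R[i] => kap%:C * w) x kap%:C.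
    by have := cdiff_affine kap%:C 0 x; congr cdiff; apply/funext => y; rewrite addr0.
  have d1 := cdiff_comp dsq (cdiff_cexp (x ^+ 2 / 8)).
  have d2 := cdiff_comp dk (cdiff_horner (heat_poly R[i] k) (kap%:C * x)).
  have := cdiffM (cdiff_affine 0 (A * ((Num.sqrt 2) ^+ k)%:C) x) (cdiffM d1 d2).
  rewrite mul0r !add0r; congr cdiff.
    by apply/funext => y; rewrite /Q mul0r add0r; move: (cexp _) => X; ring.
  by move: (cexp _) => X; ring.
(* Two consecutive indices are carried along because the recurrence has three terms. *)
have H m : (forall x, hermite_laplace m x = Q m x) /\ (forall x, hermite_laplace m.+1 x = Q m.+1 x).
  have one : forall x, hermite_laplace 0 x = Q 0 x.
    by move=> x; rewrite P0 /Q expr0 rmorph1 hornerC !mulr1.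
  have nxt k : (forall x, hermite_laplace k x = Q k x) ->
      (forall x, (if k is j.+1 then (2 * j.+1)%:R * hermite_laplace j x else 0) =
       4 * (kap%:C * (A * ((Num.sqrt 2) ^+ k)%:C * cexp (x ^+ 2 / 8) * (heat_poly R[i] k)^`().[kap%:C * x]))) ->
      forall x, hermite_laplace k.+1 x = Q k.+1 x.
    move=> En En' x; have EQ : hermite_laplace k = Q k by apply/funext.
    have := dQ k x; rewrite -EQ => /step ->; rewrite En' /Q.
    have -> : heat_poly R[i] k.+1 = 'X * heat_poly R[i] k - 2^-1 *: (heat_poly R[i] k)^`() by [].
    have e2 : (Num.sqrt 2 ^+ k.+1)%:C = (Num.sqrt 2 ^+ k)%:C * r2 by rewrite exprSr rmorphM.
    rewrite hornerD hornerN hornerZ hornerM hornerX e2 kapE.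
    move: (cexp _) (((Num.sqrt 2) ^+ k)%:C) (horner _ _) (horner _ _) => X Y Z W.
    transitivity (A * X * Y * ((r2 * r2) / 4 * x * W - r2 / 2 * Z)); first by rewrite r22; field.
    by field.
  elim: m => [|m [IH1 IH2]].
    split => //; apply: nxt => // x.
    have -> : (heat_poly R[i] 0)^`() = 0 by rewrite /= -polyC1 derivC.
    by rewrite horner0 !mulr0.
  split => //; apply: nxt => // x.
  have e2 : (Num.sqrt 2 ^+ m.+1)%:C = (Num.sqrt 2 ^+ m)%:C * r2 by rewrite exprSr rmorphM.
  rewrite IH1 deriv_heat_poly /Q hornerZ e2 natrM kapE.
  move: (cexp _) (((Num.sqrt 2) ^+ m)%:C) (horner _ _) => X Y Z.
  transitivity (r2 * r2 * (m.+1%:R * (A * X * Y * Z))); first by rewrite r22; ring.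
  by field.
by have [-> _] := H n.
Qed.

Theorem bargmann_psi (T : R) n : 0 < T -> bargmann T (psi T n) = @heat_monomial R n.
Proof.
move=> T0; apply/funext => z; rewrite heat_monomialE.
have s20 : 0 < Num.sqrt 2 :> R by rewrite sqrtr_gt0.
pose a := (Num.sqrt T)^-1; have a0 : 0 < a by rewrite invr_gt0 sqrtr_gt0.
have a2 : a ^+ 2 = T^-1 by rewrite exprVn sqr_sqrtr// ltW.
pose N := (2 ^+ n * n`!%:R * Num.sqrt (pi * T)) `^ (- 2^-1).
set w := (2 * Num.sqrt 2)%:C * z.
pose F (u : mR) := cexp (w * u%:C) * ((hermite R n).[u] * gauss 2 u)%:C.
have IF : cintegrable leb F := laplace_cintegrable w (exp_integrable_poly (hermite R n)).
have E v : cexp (- z ^+ 2 + (2 * Num.sqrt (2 / T))%:C * z * v%:C - (v ^+ 2 / T)%:C) * psi T n v =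
    cexp (- z ^+ 2) * N%:C * F (a * v + 0).
  rewrite /psi -/N /F addr0 !cexpD -rmorphN cexp_real.
  have -> : (2 * Num.sqrt (2 / T))%:C * z * v%:C = w * (a * v)%:C.
    rewrite /w sqrtrM// sqrtrV ?ltW// -/a !rmorphM /=; ring.
  have -> : v / Num.sqrt T = a * v by rewrite mulrC.
  have -> : (hermite R n).[a * v] * gauss 2 (a * v) =
      (hermite R n).[a * v] * expR (- (v ^+ 2 / T)) * expR (- (v ^+ 2 / T)).
    rewrite -mulrA -expRD /gauss exprMn a2; congr (_ * expR _); ring.
  rewrite !rmorphM /=; move: (cexp _) (cexp _) => X Y; ring.
rewrite /bargmann; under eq_cintegral do rewrite E.
have ia : 0 < a^-1 by rewrite invr_gt0.
have Ia := scales_cintegrable ia (scales_affine 0 a0) IF.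
rewrite cintegralZl// (scales_cintegral (scales_affine 0 a0) IF).
have -> : cintegral leb F = hermite_laplace n w by [].
rewrite hermite_laplaceE.
have -> : kap%:C * w = z.
  by rewrite /w mulrA -rmorphM mulVf ?rmorph1 ?mul1r// mulf_neq0// gt_eqF.
have -> : w ^+ 2 / 8 = z ^+ 2.
  rewrite /w exprMn -rmorphXn exprMn sqr_sqrtr//.
  have -> : 2 ^+ 2 * 2 = 8%:R :> R by rewrite -natrX -natrM.
  by rewrite rmorph_nat mulrAC mulfV ?mul1r// pnatr_eq0.
have combine (c0 N0 b0 p0 q0 : R) (X Y Z : R[i]) :
    c0%:C * (X * N0%:C * (b0%:C * (p0%:C * Y * q0%:C * Z))) = (c0 * N0 * b0 * p0 * q0)%:C * (X * Y) * Z.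
  by rewrite !rmorphM /=; ring.
(* Since [w^2 / 8 = z^2], the Gaussian of the Laplace transform cancels the factor [cexp (- z^2)] of
   the Bargmann kernel; an identity between real constants remains. *)
rewrite combine -cexpD addNr cexp0 mulr1; congr (_%:C * _).
have pT : 0 < pi * T by rewrite mulr_gt0// pi_gt0.
have pT4 : (pi * T) `^ 4^-1 = Num.sqrt (Num.sqrt (pi * T)).
  rewrite -powR12_sqrt ?sqrtr_ge0// -(powR12_sqrt (ltW pT)) -powRrM; congr (_ `^ _).
  by field.
have S0 : 0 < Num.sqrt (pi * T) by rewrite sqrtr_gt0.
have f0 : 0 < n`!%:R :> R by rewrite ltr0n fact_gt0.
have NE : N = (Num.sqrt 2 ^+ n * Num.sqrt n`!%:R * Num.sqrt (Num.sqrt (pi * T)))^-1.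
  rewrite /N powRN powR12_sqrt ?mulr_ge0 ?exprn_ge0 ?(ltW f0) ?(ltW S0)//; congr (_^-1).
  rewrite sqrtrM ?mulr_ge0 ?exprn_ge0 ?(ltW f0)// sqrtrM ?exprn_ge0//; congr (_ * _ * _).
  by rewrite -{1}[2](@sqr_sqrtr _ 2)// exprAC sqrtr_sqr ger0_norm// exprn_ge0// ltW.
have yy : Num.sqrt (Num.sqrt (pi * T)) * Num.sqrt (Num.sqrt (pi * T)) = Num.sqrt pi * Num.sqrt T.
  by rewrite -expr2 sqr_sqrtr ?(ltW S0)// sqrtrM// pi_ge0.
have p2 : Num.sqrt (pi / 2) = Num.sqrt pi / Num.sqrt 2 :> R.
  by rewrite (@sqrtrM _ (pi : R)) ?pi_ge0// (@sqrtrV _ (2 : R)).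
rewrite pT4 NE p2 invrK.
have r0 : Num.sqrt 2 != 0 :> R by rewrite gt_eqF.
have x0 : Num.sqrt 2 ^+ n != 0 :> R by rewrite expf_neq0.
have m0 : Num.sqrt n`!%:R != 0 :> R by rewrite gt_eqF// sqrtr_gt0.
have y0 : Num.sqrt (Num.sqrt (pi * T)) != 0 :> R by rewrite gt_eqF// sqrtr_gt0.
have t0 : Num.sqrt T != 0 by rewrite gt_eqF// sqrtr_gt0.
have p0 : Num.sqrt (pi : R) != 0 by rewrite gt_eqF// sqrtr_gt0 pi_gt0.
move: yy r0 x0 m0 y0 t0 p0.
move: (Num.sqrt 2) (Num.sqrt 2 ^+ n) (Num.sqrt n`!%:R) (Num.sqrt (Num.sqrt (pi * T)))
  (Num.sqrt T) (Num.sqrt (pi : R)) => r x m y t p yy r0 x0 m0 y0 t0 p0.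
transitivity ((p * t) / (y * y) / m); first by field; rewrite r0 x0 m0 y0.
by rewrite yy mulfV ?mul1r// mulf_neq0.
Qed.

End hermite_functions.

(** * The rescaled Bargmann transform *)

Section bargmann_operator.
Variables (R : realType) (T : R).
Hypothesis T0 : 0 < T.
Local Notation leb := (@lebesgue_measure R).
Local Notation ar := (@area R).
Local Notation mR := (measurableTypeR R).
Local Notation tc := (@tocomplex R).
Local Notation S := (rescaled_bargmann T).
Implicit Types (f h : mR -> R[i]) (F G : R[i] -> R[i]) (z : R[i]).

(** The weight has no zero. Identities between transforms can therefore be checked on [nbargmann],
    where linearity and inner products are available. *)
Lemma weighted_inj F G : weighted F =1 weighted G -> F = G.
Proof.
move=> FG; apply/funext => z; have := FG (cRe z, cIm z); rewrite /weighted.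
have -> : tc (cRe z, cIm z) = z by apply: complex_eq.
by apply: mulfI; rewrite fmorph_eq0 gt_eqF// fock_weight_gt0.
Qed.

Lemma nbargmann_linear (k : R[i]) f h : sq_integrable leb f -> sq_integrable leb h ->
  nbargmann T (fun v => k * f v + h v) =1 (fun p => k * nbargmann T f p + nbargmann T h p).
Proof.
move=> Lf Lh p; have I g : sq_integrable leb g -> cintegrable leb (fun v => nkernel T p v * g v).
  move=> Lg; have := inner_cintegrable Lg (sq_integrable_nkernelJ T0 p); congr cintegrable.
  by apply/funext => v; rewrite mulrC; congr (_ * _); exact: conjcK.
rewrite /nbargmann -cintegralZl; last exact: I.
rewrite -cintegralD; [|exact: cintegrableZl (I _ Lf)|exact: I].
by apply: eq_cintegral => v; rewrite mulrDr mulrCA.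
Qed.

Lemma sq_integrable_linear (k : R[i]) f h : sq_integrable leb f -> sq_integrable leb h ->
  sq_integrable leb (fun v => k * f v + h v).
Proof. by move=> Lf Lh; apply: sq_integrableD => //; exact: sq_integrableZl. Qed.

Lemma rescaled_bargmann_linear : linear_on_L2 S.
Proof.
move=> k f h /sq_integrable_L2 Lf /sq_integrable_L2 Lh; apply: weighted_inj => p.
rewrite -nbargmannE//; last exact: sq_integrable_linear.
by rewrite nbargmann_linear// !nbargmannE// /weighted mulrDr mulrCA.
Qed.

Lemma L2_eq_sqnorm f h : sq_integrable leb f -> sq_integrable leb h -> L2_eq f h ->
  sqnorm leb (fun v => f v - h v) = 0.
Proof.
move=> Lf Lh fh; have [mB _] := sq_integrableB Lf Lh.
rewrite /sqnorm /Rintegral.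
have -> : (\int[leb]_v (normc (f v - h v) ^+ 2)%:E = \int[leb]_v (cst 0 v))%E.
  apply: ae_eq_integral => //; first exact/measurable_EFinP/measurable_normc_sqr.
  apply: filterS fh => v fhv vT.
  by rewrite fhv// subrr normc0 expr0n.
by rewrite integral0.
Qed.

Lemma L2_eq_inner f h g : sq_integrable leb f -> sq_integrable leb h -> sq_integrable leb g ->
  L2_eq f h -> inner leb f g = inner leb h g.
Proof.
move=> Lf Lh Lg fh; apply/eqP; rewrite -subr_eq0 -innerBl//; apply/eqP/eq0_normc.
have := cauchy_schwarz (sq_integrableB Lf Lh) Lg.
by rewrite L2_eq_sqnorm// mul0r => h0; apply/eqP; rewrite -sqrf_eq0 eq_le h0 sqr_ge0.
Qed.

Lemma L2_eq_nbargmann f h : sq_integrable leb f -> sq_integrable leb h -> L2_eq f h ->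
  nbargmann T f =1 nbargmann T h.
Proof.
move=> Lf Lh fh p; rewrite !nbargmann_inner; apply: L2_eq_inner => //.
exact: sq_integrable_nkernelJ.
Qed.

Lemma maps_rescaled_bargmann : maps_L2_fock S.
Proof.
split=> [f /sq_integrable_L2 Lf|f h /sq_integrable_L2 Lf /sq_integrable_L2 Lh fh].
  apply/fockP; split; first exact: rescaled_bargmann_holomorphic.
  have := sq_integrable_nbargmann T0 Lf; congr sq_integrable.
  by apply/funext => p; rewrite nbargmannE.
by apply: weighted_inj => p; rewrite -!nbargmannE//; exact: L2_eq_nbargmann.
Qed.

Lemma injective_rescaled_bargmann : injective_on_L2 S.
Proof.
move=> f h Lf' Lh' Sfh; have /sq_integrable_L2 Lf := Lf'; have /sq_integrable_L2 Lh := Lh'.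
have Lg := sq_integrable_linear (-1) Lh Lf.
set g := fun v => -1 * h v + f v in Lg.
have Sg z : S g z = 0 by rewrite rescaled_bargmann_linear// Sfh mulN1r addNr.
have Tinv : 0 < T^-1 by rewrite invr_gt0.
have eg := exp_integrable_gauss_L2 Tinv ((sq_integrable_L2 g).2 Lg).
have k0 : (2 / Num.sqrt T)%:C != 0 :> R[i].
  by rewrite fmorph_eq0 mulf_neq0// invr_eq0 gt_eqF// sqrtr_gt0.
have L0 z : laplace (fun v : mR => (gauss T^-1 v)%:C * g v) z = 0.
  have := Sg ((2 / Num.sqrt T)%:C^-1 * z); rewrite rescaled_bargmannE//.
  have -> : (2 / Num.sqrt T)%:C * ((2 / Num.sqrt T)%:C^-1 * z) = z by rewrite mulrA mulfV// mul1r.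
  have cT : (Num.sqrt 2 / (pi * T) `^ 4^-1)%:C != 0 :> R[i].
    by rewrite fmorph_eq0 gt_eqF// divr_gt0 ?sqrtr_gt0// powR_gt0// mulr_gt0// pi_gt0.
  move/(canRL (mulKf cT)); rewrite mulr0 => /(canRL (mulKf (cexp_neq0 _))).
  by rewrite mulr0.
have := laplace_injective eg L0; apply: filterS => v /eqP.
rewrite mulf_eq0 fmorph_eq0 gt_eqF/= ?expR_gt0// => /eqP; rewrite /g mulN1r => e _.
by apply/eqP; rewrite -subr_eq0 addrC e.
Qed.

Let s20 : (Num.sqrt 2)%:C != 0 :> R[i].
Proof. by rewrite fmorph_eq0 gt_eqF// sqrtr_gt0. Qed.

Lemma onto_rescaled_bargmann : onto_fock S.
Proof.
move=> F /fockP[hF LF]; have [u Lu [uF _]] := fock_surjective T0 hF LF.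
have L0 : sq_integrable leb (fun=> 0 : R[i]).
  by have := sq_integrableB Lu Lu; congr sq_integrable; apply/funext => v; rewrite subrr.
have Lk := sq_integrableZl ((Num.sqrt 2)%:C^-1) Lu.
exists (fun v => (Num.sqrt 2)%:C^-1 * u v); first exact/sq_integrable_L2.
apply: weighted_inj => p; rewrite -nbargmannE//.
have := nbargmann_linear ((Num.sqrt 2)%:C^-1) Lu L0 p; under eq_fun do rewrite addr0.
move=> ->; rewrite uF mulrA mulVf// mul1r.
rewrite [X in _ + X](_ : _ = 0) ?addr0//.
by rewrite /nbargmann -[RHS](cintegral0 leb); apply: eq_cintegral => v; rewrite mulr0.
Qed.

(* In [fock_surjective] for F = S h, injectivity identifies u with sqrt 2 h. *)
Lemma isometry_rescaled_bargmann f h : L2 f -> L2 h ->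
  fock_inner (S f) (S h) = (Num.sqrt 2)%:C * L2_inner f h.
Proof.
move=> Lf' Lh'; have /sq_integrable_L2 Lf := Lf'; have /sq_integrable_L2 Lh := Lh'.
have [fockS _] := maps_rescaled_bargmann.
have fSf := fockS _ Lf'; have fSh := fockS _ Lh'; have [hS LS] := (fockP _).1 fSh.
rewrite fock_innerE// L2_innerE.
have [u Lu [uS uI]] := fock_surjective T0 hS LS.
have := uI _ Lf; rewrite (_ : nbargmann T f = weighted (S f)); last first.
  by apply/funext => p; rewrite nbargmannE.
move=> ->.
have Lk := sq_integrableZl (Num.sqrt 2)%:C Lh.
have uh : L2_eq u (fun v => (Num.sqrt 2)%:C * h v).
  apply: injective_rescaled_bargmann; [exact/sq_integrable_L2..|].
  apply: weighted_inj => p; rewrite -!nbargmannE// uS -nbargmannE//.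
  rewrite /nbargmann -cintegralZl.
    by apply: eq_cintegral => v; rewrite mulrCA.
  have := inner_cintegrable Lh (sq_integrable_nkernelJ T0 p); congr cintegrable.
  by apply/funext => v; rewrite mulrC; congr (_ * _); exact: conjcK.
rewrite innerJ// (L2_eq_inner Lu Lk Lf uh) -innerJ// innerZr//; congr (_ * _).
exact: conjc_real.
Qed.

Lemma fockZ (k : R[i]) F : fock F -> fock (fun z => k * F z).
Proof.
move=> /fockP[hF LF]; apply/fockP; split; first exact: holomorphicM (holomorphic_cst k) hF.
have := sq_integrableZl k LF; congr sq_integrable.
by apply/funext => p; rewrite /weighted mulrCA.
Qed.

Lemma fock_innerZ (k : R) F G : fock F -> fock G ->
  fock_inner (fun z => k%:C * F z) (fun z => k%:C * G z) = (k ^+ 2)%:C * fock_inner F G.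
Proof.
move=> fF fG; have fkF := fockZ k%:C fF; have fkG := fockZ k%:C fG.
rewrite !fock_innerE//; have [_ LF] := (fockP _).1 fF; have [_ LG] := (fockP _).1 fG.
rewrite /inner -cintegralZl; last exact: inner_cintegrable.
apply: eq_cintegral => p; rewrite /weighted.
have -> : Num.conj ((fock_weight (tc p))%:C * (k%:C * G (tc p))) =
    k%:C * Num.conj ((fock_weight (tc p))%:C * G (tc p)).
  rewrite mulrCA rmorphM; congr (_ * _).
  exact: conjc_real.
by rewrite rmorphXn /= expr2; move: (Num.conj _) => X; ring.
Qed.

Lemma unitary_scaled_bargmann : unitary_L2_fock (fun f z => (2 `^ (- 4^-1))%:C * S f z).
Proof.
set k : R := 2 `^ (- 4^-1); have k0 : 0 < k by exact: powR_gt0.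
have k2 : k ^+ 2 * Num.sqrt 2 = 1.
  rewrite -powR_mulrn ?ltW// /k -powRrM.
  have -> : - 4^-1 * 2%:R = - 2^-1 :> R by field.
  by rewrite powRN powR12_sqrt// mulVf// gt_eqF// sqrtr_gt0.
have kC : k%:C != 0 :> R[i] by rewrite fmorph_eq0 gt_eqF.
have [fockS wdS] := maps_rescaled_bargmann.
split.
- split=> [f Lf|f h Lf Lh fh]; first by apply: fockZ; exact: fockS.
  by rewrite (wdS _ _ Lf Lh fh).
- move=> c f h Lf Lh; apply/funext => z.
  by rewrite (rescaled_bargmann_linear c Lf Lh) mulrDr mulrCA.
- move=> F /(fockZ k%:C^-1) /onto_rescaled_bargmann[f Lf SF]; exists f => //.
  by apply/funext => z; rewrite SF mulrA mulfV// mul1r.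
- move=> f h Lf Lh; rewrite fock_innerZ; [|exact: fockS..].
  by rewrite isometry_rescaled_bargmann// mulrA -rmorphM k2 rmorph1 mul1r.
Qed.

End bargmann_operator.

Theorem proposition3p8 (R : realType) (T : R) (hT : 0 < T) :
  (forall n : nat, bargmann T (psi T n) = @heat_monomial R n) /\
  (maps_L2_fock (rescaled_bargmann T) /\
   injective_on_L2 (rescaled_bargmann T) /\
   onto_fock (rescaled_bargmann T) /\
   (forall f h : R -> R[i], L2 f -> L2 h ->
      fock_inner (rescaled_bargmann T f) (rescaled_bargmann T h)
      = (Num.sqrt 2)%:C * L2_inner f h)) /\
  unitary_L2_fock
    (fun (f : R -> R[i]) (z : R[i]) =>
       (2 `^ (- 4^-1))%:C * rescaled_bargmann T f z).
Proof.
split; first by move=> n; exact: bargmann_psi.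
split; last exact: unitary_scaled_bargmann.
split; first exact: maps_rescaled_bargmann.
split; first exact: injective_rescaled_bargmann.
split; first exact: onto_rescaled_bargmann.
exact: isometry_rescaled_bargmann.
Qed.
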